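(* Let $\alpha\in\mathbb{R}\setminus\mathbb{Q}$ satisfy $0\le\beta(\alpha)<\infty$ and let $f$ be a (real-valued) trigonometric polynomial on $\mathbb{R}/\mathbb{Z}$. Then for every $\eta>0$ there exists $\lambda_0=\lambda_0(f,\eta,\beta(\alpha))>0$ such that for every real $\lambda$ with $|\lambda|\le\lambda_0$ there exists $m_\star=m_\star(\lambda,f,\eta,\alpha)>0$ such that $$E_m^+-E_m^-\le e^{-\eta|m|}\qquad\text{for all } m\in\mathbb{Z}\setminus\{0\}\text{ with }|m|\ge m_\star .$$
   Context: For $f$ real analytic on $\mathbb{R}/\mathbb{Z}$, $\lambda,\theta\in\mathbb{R}$ and $\alpha$ irrational, the quasi-periodic Schrödinger operator on $\ell^2(\mathbb{Z})$ is $(H_{\lambda f,\alpha,\theta}x)_n=x_{n+1}+x_{n-1}+\lambda f(\theta+n\alpha)x_n$. Its spectrum does not depend on $\theta$ and is denoted $\Sigma_{\lambda f,\alpha}$. $\beta(\alpha)=\limsup_{k\to\infty}\frac{-\ln\|k\alpha\|_{\mathbb{R}/\mathbb{Z}}}{|k|}$, where $\|x\|_{\mathbb{R}/\mathbb{Z}}=\min_{k\in\mathbb{Z}}|x-k|$. Fibered rotation number: let $S_{\lambda f,E}(x)=\begin{pmatrix}E-\lambda f(x)&-1\\1&0\end{pmatrix}$. For a continuous $A:\mathbb{R}/\mathbb{Z}\to \mathrm{SL}(2,\mathbb{R})$ homotopic to the identity, the map $(x,v)\mapsto(x+\alpha,A(x)v/\|A(x)v\|)$ on $\mathbb{R}/\mathbb{Z}\times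 S^1$ (with $S^1$ parametrized by $y\mapsto(\cos2\pi y,\sin2\pi y)$) lifts to $F(x,y)=(x+\alpha,y+\psi(x,y))$ with $\psi$ continuous and 1-periodic in both variables; the fibered rotation number of $(\alpha,A)$ is $\lim_{n\to\infty}\frac1n\sum_{k=0}^{n-1}\psi(F^k(x,y))$ mod $\mathbb{Z}$ (independent of $(x,y)$ and of the lift). For $A=S_{\lambda f,E}$ it has a representative $\rho_{\lambda f,\alpha}(E)\in[0,\tfrac12]$, which is a continuous non-increasing surjective function $\mathbb{R}\to[0,\frac12]$ of $E$, equal to $\frac12$ for $E\le\min\Sigma_{\lambda f,\alpha}$ and to $0$ for $E\ge\max\Sigma_{\lambda f,\alpha}$ (equivalently, $1-2\rho_{\lambda f,\alpha}$ is the integrated density of states). For $m\in\mathbb{Z}\setminus\{0\}$, the numbers $E_m^-\le E_m^+$ are defined by $[E_m^-,E_m^+]=\{E\in\mathbb{R}:2\rho_{\lambda f,\alpha}(E)=m\alpha \bmod\mathbb{Z}\}$. *)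

(* Defs.v *)
From HB Require Import structures.
From mathcomp Require Import all_boot all_order all_algebra.
From mathcomp Require Import all_classical all_reals all_analysis.

Set Implicit Arguments.
Unset Strict Implicit.
Unset Printing Implicit Defensive.

Import Order.TTheory GRing.Theory Num.Theory.
Import numFieldNormedType.Exports.

Local Open Scope classical_set_scope.
Local Open Scope ring_scope.

(* Functions on the circle R/Z are represented by 1-periodic functions on R. *)

Section QuasiPeriodicSchrodinger.
Variable R : realType.
Implicit Types (alpha lam E x y r : R) (f : R -> R) (A : R -> 'M[R]_2).

(* The real form of a finite sum of c_k e^(2 i pi k x), |k| <= N, with
   c_(-k) the complex conjugate of c_k. *)
Definition trig_poly f : Prop :=
  exists (N : nat) (a b : nat -> R), forall x,
    f x = \sum_(k < N.+1) (a k * cos (2 * pi * k%:R * x)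
                           + b k * sin (2 * pi * k%:R * x)).

Definition dist_to_Z x : R := inf [set `|x - k%:~R| | k in [set: int]].

(* The term k = 0 is a junk value, invisible to the limsup; negative k give
   the same values since dist_to_Z is even. *)
Definition beta alpha : \bar R :=
  limn_esup (fun k : nat => (- ln (dist_to_Z (k%:R * alpha)) / k%:R)%:E).

Definition schrodinger_cocycle lam f E : R -> 'M[R]_2 := fun x =>
  block_mx (E - lam * f x)%:M (-1)%:M
           1%:M               0%:M : 'M[R]_(1 + 1).

Definition circle_pt y : 'cV[R]_2 :=
  col_mx (cos (2 * pi * y))%:M (sin (2 * pi * y))%:M : 'cV[R]_(1 + 1).

(* The library's norm on matrices is the sup norm, hence this definition. *)
Definition euclid_norm (v : 'cV[R]_2) : R := Num.sqrt (\sum_i v i 0 ^+ 2).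

Definition projective_lift A (psi : R * R -> R) : Prop :=
  [/\ continuous psi,
      (forall x y, psi (x + 1, y) = psi (x, y) /\ psi (x, y + 1) = psi (x, y)) &
      forall x y, let w := A x *m circle_pt y in
        circle_pt (y + psi (x, y)) = (euclid_norm w)^-1 *: w].

Definition skew_product alpha (psi : R * R -> R) (p : R * R) : R * R :=
  (p.1 + alpha, p.2 + psi p).

(* r represents, modulo Z, the fibered rotation number of (alpha, A). *)
Definition fibered_rotation_number alpha A r : Prop :=
  exists (psi : R * R -> R) (j : int), projective_lift A psi /\
    forall p : R * R,
      (fun n : nat => n%:R^-1 *
         \sum_(k < n) psi (iter k (skew_product alpha psi) p))
        @ \oo --> r + j%:~R.

(* The representative in [0, 1/2] is unique; 0 is the default of xget, used
   only if there is none. *)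
Definition rho lam f alpha E : R :=
  xget 0 [set r | 0 <= r <= 2^-1 /\
                  fibered_rotation_number alpha (schrodinger_cocycle lam f E) r].

Definition gap_edges lam f alpha (m : int) (Em Ep : R) : Prop :=
  Em <= Ep /\
  [set E | exists j : int, 2 * rho lam f alpha E = m%:~R * alpha + j%:~R]
    = `[Em, Ep]%classic.

End QuasiPeriodicSchrodinger.

(* Main.v *)
(* Suppose that the gap [E1, E2] labelled by m is wider than exp(-eta |m|); let E be
   its midpoint and dl its half-width. The edges have the same rotation number, so,
   by counting eigenvalues of Jacobi matrices, H_x - E is bounded below by dl on
   finitely supported sequences, uniformly in x. Averaging over orbits transfers this
   bound to the dual operator, whose off-diagonal part is small. The determinant of a
   box of the dual operator is a trigonometric polynomial in the phase; by Lagrange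
   interpolation at orbit points, whose mutual distances are controlled by
   beta(alpha), it is not too small for some translate of the box. Hence, with
   h = |m| / 28, a least squares solution of (dual - E) w = delta supported at
   distance <= 12 h from the source has an exponentially small error. Superposing
   these w over the phases yields approximate Green functions of H_x - E which are
   trigonometric polynomials of degree <= 12 h in x. They are almost parallel to the
   decaying solution of H_x u = E u on the right half-line, so the direction of that
   solution turns n / 2 times around the circle with |n| <= 24 h. This invariant
   direction forces 2 rho = n alpha mod Z, thus n = m, whereas 24 h < |m|. *)
Require Import Defs.
From HB Require Import structures.
From mathcomp Require Import all_boot all_order all_algebra.
From mathcomp Require Import all_fingroup.
From mathcomp Require Import zify ring lra.
From mathcomp Require Import complex.
Set Implicit Arguments.
Unset Strict Implicit.
Unset Printing Implicit Defensive.
Import Order.TTheory GRing.Theory Num.Theory.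
Local Open Scope ring_scope.

(** * Lagrange interpolation and cofactors of banded matrices *)

(** A determinant of the dual operator can be tiny at particular phases, so decay cannot be asked of
    a prescribed box, and the dual equation has no decaying exact Green function at every phase. The
    gap supplies what is missing. The residual [r] of the least squares problem solves the
    homogeneous dual equation, and its squared norm equals its modulus at the source. Good boxes on
    both sides of the source make [r] small in two windows; cut off there, [r] is almost annihilated
    by the dual operator, so the lower bound [dl] makes it small at the source, hence everywhere.

    A box of [4h] sites has a determinant of degree [8h], hence [8h + 1] translates to try and [12h]
    sites on each side. The decaying direction has no sign, and one Green function may vanish at
    some [x]; a sum of two squares cures both, doubles the degree to [24h], and [28h <= |m|] leaves
    room.

    Weak coupling buys a decay rate [ln mu] as large as wished. It has to beat only fixed multiples
    of [h]: the entropy of the box, the small divisors (through [beta]) and the inverse gap width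
    (through [eta]). This fixes the dependence of [lam0]. *)

Lemma lagrange_lead_coef (F : fieldType) (N : nat) (p : {poly F})
    (z : 'I_N.+1 -> F) :
  injective z -> (size p <= N.+1)%N ->
  p`_N = \sum_j p.[z j] / \prod_(i | i != j) (z j - z i).
Proof.
move=> zI sp.
pose D j := \prod_(i | i != j) (z j - z i).
pose L j := \prod_(i | i != j) ('X - (z i)%:P).
have D0 j : D j != 0.
  by apply/prodf_neq0 => i ij; rewrite subr_eq0 (inj_eq zI) eq_sym.
have sL j : size (L j) = N.+1.
  rewrite /L -big_filter size_prod_XsubC; congr S.
  have -> : [seq i <- index_enum 'I_N.+1 | i != j] = enum (predC1 j).
    by rewrite [index_enum 'I_N.+1]unlock; apply: eq_filter.
  by rewrite -cardE cardC1 card_ord.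
have Lz j i : (L j).[z i] = if i == j then D j else 0.
  rewrite /L horner_prod; case: eqP => [->|/eqP ij].
    by apply: eq_bigr => k _; rewrite !hornerE.
  by rewrite (bigD1 i) //= !hornerE subrr mul0r.
pose q := \sum_j (p.[z j] / D j) *: L j.
have -> : p = q.
  apply/eqP; rewrite -subr_eq0; apply/eqP.
  apply: (@roots_geq_poly_eq0 _ _ [seq z i | i <- enum 'I_N.+1]).
  - apply/allP => _ /mapP[i _ ->]; rewrite rootE hornerD hornerN horner_sum.
    rewrite (bigD1 i) //= big1 => [|j ji].
      by rewrite hornerZ Lz eqxx mulfVK // addr0 subrr.
    by rewrite hornerZ Lz eq_sym (negbTE ji) mulr0.
  - by rewrite map_inj_uniq // enum_uniq.
  - rewrite size_map size_enum_ord (leq_trans (size_polyD _ _)) // geq_max sp.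
    rewrite size_polyN (leq_trans (size_sum _ _ _)) //; apply/bigmax_leqP => i _.
    by rewrite (leq_trans (size_scale_leq _ _)) // sL.
rewrite coef_sum; apply: eq_bigr => j _; rewrite coefZ.
have -> : (L j)`_N = 1.
  have /monicP <- : L j \is monic by apply: monic_prod_XsubC.
  by rewrite lead_coefE sL.
rewrite mulr1 -/(q.[z j]) horner_sum (bigD1 j) //= big1 => [|i ij].
  by rewrite hornerZ Lz eqxx mulfVK // addr0.
by rewrite hornerZ Lz eq_sym (negbTE ij) mulr0.
Qed.

(** Otherwise every [|p.[z j]|] lies below [c |p_N| / (N + 1)], and the interpolation formula for
    the top coefficient gives [|p_N| < |p_N|]. *)
Lemma lagrange_lower_bound (C : numFieldType) (N : nat) (p : {poly C})
    (z : 'I_N.+1 -> C) (c : C) :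
  (size p <= N.+1)%N -> 0 < c ->
  (forall j, c <= \prod_(i | i != j) `|z j - z i|) ->
  exists j, c * `|p`_N| <= N.+1%:R * `|p.[z j]|.
Proof.
move=> sp c0 cP.
have zI : injective z.
  move=> j i zji; apply/eqP/negP => /negP ij.
  have := cP j; rewrite (bigD1 i) 1?eq_sym //= zji subrr normr0 mul0r.
  by move/(lt_le_trans c0); rewrite ltxx.
case: (boolP [exists j, c * `|p`_N| <= N.+1%:R * `|p.[z j]|]).
  by move=> /existsP.
rewrite negb_exists => /forallP nP.
have lt j : `|p.[z j]| / c < `|p`_N| / N.+1%:R.
  rewrite ltr_pdivrMr // mulrAC ltr_pdivlMr ?ltr0n // [_ * c]mulrC [_ * _%:R]mulrC.
  rewrite real_ltNge ?nP // ?realM ?normr_real // ?realn //.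
  by rewrite gtr0_real.
suff : `|p`_N| < `|p`_N| by rewrite ltxx.
have {2}-> : `|p`_N| = \sum_(j < N.+1) (`|p`_N| / N.+1%:R).
  by rewrite sumr_const card_ord -[RHS]mulr_natr mulfVK // pnatr_eq0.
rewrite {1}(lagrange_lead_coef zI sp).
apply: (le_lt_trans (ler_norm_sum _ _ _)).
have : [exists j : 'I_N.+1, true] by apply/existsP; exists ord0.
move=> /existsP[j0 _].
rewrite (bigD1 j0) //= [X in _ < X](bigD1 j0) //=.
have le j : `|p.[z j] / \prod_(i | i != j) (z j - z i)| <= `|p.[z j]| / c.
  rewrite normrM normfV normr_prod ler_wpM2l //.
  by rewrite lef_pV2 ?posrE // (lt_le_trans c0).
apply: ltr_leD; first exact: le_lt_trans (le _) (lt _).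
by apply: ler_sum => j _; apply: le_trans (le _) (ltW (lt _)).
Qed.

(* Conjugating A by the diagonal matrix with entries mu^i multiplies the (i, j)
   cofactor by mu^(j - i) and leaves absolute row sums bounded by a. *)
Lemma cofactor_band_bound (C : numFieldType) (n : nat) (A : 'M[C]_n)
    (mu a : C) (i j : 'I_n) :
  1 <= mu -> 1 <= a ->
  (forall k, \sum_l `|A k l| * mu ^+ `|k - l|%N <= a) ->
  `|cofactor A i j| * mu ^+ `|i - j|%N <= a ^+ n.
Proof.
move=> mu1 a1 rowA.
have mu0 : 0 < mu by apply: lt_le_trans mu1.
have a0 : 0 <= a by apply: le_trans a1.
(* The sign of the exponent follows the order of [i] and [j], so that [w i / w j] is [mu] to the
   power [|i - j|] in both cases. *)
pose w (k : nat) : C := if (i <= j)%N then mu ^- k else mu ^+ k.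
have w0 k : 0 < w k by rewrite /w; case: ifP => _; rewrite ?invr_gt0 exprn_gt0.
have wd (k l : nat) : w l / w k <= mu ^+ `|k - l|%N.
  have key (x y : nat) : mu ^+ x / mu ^+ y <= mu ^+ `|y - x|%N.
    rewrite ler_pdivrMr ?exprn_gt0 // -exprD ler_weXn2l //; lia.
  rewrite /w; case: ifP => _; last exact: key.
  by rewrite invrK mulrC distnC; apply: key.
have wij : mu ^+ `|i - j|%N * w j = w i.
  rewrite /w; case: leqP => ij.
    rewrite -[X in mu ^- X](subnK ij) exprD invfM mulrA distnEr // mulfV ?mul1r //.
    by rewrite expf_neq0 ?gt_eqF.
  by rewrite -exprD; congr (_ ^+ _); lia.
rewrite expand_cofactor.
have le1 : `|\sum_(s : 'S_n | s i == j) (-1) ^+ s * \prod_(k | i != k) A k (s k)|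
   <= \sum_(s : 'S_n | s i == j) \prod_(k | i != k) `|A k (s k)|.
  apply: le_trans (ler_norm_sum _ _ _) _; apply: ler_sum => s _.
  by rewrite normrMsign normr_prod.
apply: le_trans (ler_wpM2r _ le1) _; first by rewrite exprn_ge0 ?(ltW mu0).
rewrite mulr_suml.
have eq2 (s : 'S_n) : s i == j ->
   \prod_(k | i != k) `|A k (s k)| * mu ^+ `|i - j|%N
   = \prod_(k | i != k) (`|A k (s k)| * (w (s k) / w k)).
  move=> /eqP sij; rewrite big_split /=; congr (_ * _).
  rewrite prodf_div.
  have e1 : \prod_k w (s k) = w j * \prod_(k | i != k) w (s k).
    rewrite (bigD1 i) //= sij; congr (_ * _).
    by apply: eq_bigl => k; rewrite eq_sym.
  have e2 : \prod_(k : 'I_n) w k = w i * \prod_(k : 'I_n | i != k) w k.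
    rewrite (bigD1 i) //=; congr (_ * _).
    by apply: eq_bigl => k; rewrite eq_sym.
  have e3 : \prod_k w (s k) = \prod_(k : 'I_n) w k.
    by rewrite [RHS](reindex_inj (@perm_inj _ s)).
  have wn0 k : w k != 0 by rewrite gt_eqF.
  have : w j * \prod_(k | i != k) w (s k) = w i * \prod_(k : 'I_n | i != k) w k.
    by rewrite -e1 e3 e2.
  rewrite -wij => e4.
  have P0 : \prod_(k : 'I_n | i != k) w k != 0 by apply/prodf_neq0 => k _.
  apply: (mulIf P0); rewrite mulfVK //; apply: (mulfI (wn0 j)).
  by rewrite e4; ring.
rewrite (eq_bigr _ eq2).
pose B k l := `|A k l| * mu ^+ `|k - l|%N.
have B0 k l : 0 <= B k l by rewrite mulr_ge0 ?exprn_ge0 ?(ltW mu0).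
(* Row [i] becomes the indicator of column [j]: it enforces [s i = j] and sums to 1, hence to at
   most [a]. The terms being nonnegative, permutations may be enlarged to all maps, and the sum
   factors into row sums. *)
pose G k l : C := if i == k then (l == j)%:R else B k l.
have G0 k l : 0 <= G k l by rewrite /G; case: ifP => _; rewrite ?ler0n.
apply: (@le_trans _ _ (\sum_(s : 'S_n) \prod_k G k (s k))).
  rewrite [leRHS](bigID (fun s : 'S_n => s i == j)) /=.
  apply: ler_wpDr; first by apply: sumr_ge0 => s _; apply: prodr_ge0.
  apply: ler_sum => s /eqP sij; rewrite [leRHS](bigD1 i) //= {1}/G eqxx sij eqxx mul1r.
  rewrite [leRHS](eq_bigl (fun k => i != k)); last by move=> k; rewrite eq_sym.
  apply: ler_prod => k ik; rewrite /G (negbTE ik); apply/andP; split.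
    by rewrite mulr_ge0 // divr_ge0 ?ltW.
  by rewrite ler_wpM2l.
apply: (@le_trans _ _ (\sum_(g : {ffun 'I_n -> 'I_n}) \prod_k G k (g k))).
  pose h (s : 'S_n) : {ffun 'I_n -> 'I_n} := finfun s.
  have hI : {in setT &, injective h}.
    by move=> s t _ _ /ffunP e; apply/permP => k; have := e k; rewrite !ffunE.
  rewrite (eq_bigr (fun s => \prod_k G k (h s k))); last first.
    by move=> s _; apply: eq_bigr => k _; rewrite ffunE.
  rewrite (eq_bigl (mem [set: 'S_n]%SET)); last first.
    by move=> s /=; rewrite in_setT.
  rewrite -(big_imset (h := h) (A := [set: 'S_n]%SET)
             (fun g : {ffun 'I_n -> 'I_n} => \prod_k G k (g k))) //=.
  rewrite [leRHS](bigID (mem (h @: [set: 'S_n]%SET))) /=.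
  by apply: ler_wpDr => //; apply: sumr_ge0 => g _; apply: prodr_ge0.
rewrite -(bigA_distr_bigA (fun k l => G k l)).
have -> : a ^+ n = \prod_(k < n) a by rewrite prodr_const card_ord.
apply: ler_prod => k _; rewrite sumr_ge0 //= /G.
case: eqP => _; last exact: rowA.
rewrite (bigD1 j) //= eqxx big1 ?addr0 // => l /negbTE ->.
by [].
Qed.

(** * Least squares *)

Local Open Scope sesquilinear_scope.

Lemma unitmx_inj (F : fieldType) (n : nat) (A : 'M[F]_n) :
  (forall u : 'cV_n, A *m u = 0 -> u = 0) -> A \in unitmx.
Proof.
move=> Ai; rewrite -unitmx_tr -row_free_unit -kermx_eq0.
apply/eqP/row_matrixP => i; rewrite row0; apply: trmx_inj; rewrite trmx0.
by apply: Ai; apply: trmx_inj; rewrite trmx_mul trmxK -row_mul mulmx_ker row0 trmx0.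
Qed.

Definition nrm2 (C : numClosedFieldType) (n : nat) (u : 'cV[C]_n) : C :=
  \sum_i `|u i 0| ^+ 2.

Lemma nrm2E (C : numClosedFieldType) (n : nat) (u : 'cV[C]_n) :
  nrm2 u = ((u^t*) *m u) 0 0.
Proof. by rewrite mxE; apply: eq_bigr => i _; rewrite !mxE normCKC. Qed.

Lemma nrm2_eq0 (C : numClosedFieldType) (n : nat) (u : 'cV[C]_n) :
  nrm2 u = 0 -> u = 0.
Proof.
move=> /eqP; rewrite psumr_eq0 => [/allP u0|i _]; last by rewrite exprn_ge0.
apply/colP => i; have := u0 i (mem_index_enum _).
by rewrite /= expf_eq0 normr_eq0 mxE => /eqP.
Qed.

(** Normal equations: injectivity of [B] makes its Gram matrix invertible. What matters later is the
    orthogonality of the residual to the range of [B], which for a hermitian kernel says that the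
    residual solves the homogeneous equation. *)
Lemma least_squares (C : numClosedFieldType) (m n : nat) (B : 'M[C]_(m, n))
    (d : 'cV[C]_m) :
  (forall u : 'cV_n, B *m u = 0 -> u = 0) ->
  exists u : 'cV_n, (B^t*) *m (B *m u - d) = 0.
Proof.
move=> Bi; pose G := (B^t*) *m B.
have Gu : G \in unitmx.
  apply: unitmx_inj => u Gu0; apply/Bi/nrm2_eq0.
  rewrite nrm2E trmx_mul map_mxM.
  by rewrite -mulmxA [X in _ *m X]mulmxA -/G Gu0 mulmx0 mxE.
exists (invmx G *m ((B^t*) *m d)).
by rewrite mulmxBr !mulmxA -/G mulmxV // mul1mx subrr.
Qed.

(** Diagonalise over [R[i]], where the spectral theorem is available: a unitary change of basis
    preserves norms and turns [J - E] into multiplication by numbers of modulus at least [dl]. *)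
Lemma symmetric_resolvent_bound (R : rcfType) (n : nat) (J : 'M[R]_n)
    (E dl : R) (u : 'cV[R]_n) :
  J^T = J -> 0 <= dl ->
  (forall (e : R) (v : 'cV[R]_n), `|e - E| < dl -> J *m v = e *: v -> v = 0) ->
  dl ^+ 2 * (\sum_i u i 0 ^+ 2) <= \sum_i ((J *m u - E *: u) i 0) ^+ 2.
Proof.
move=> Js dl0 noeig.
pose rc := [the {rmorphism R -> R[i]} of real_complex R].
pose A : 'M[R[i]]_n := map_mx rc J.
have conj_rc x : (rc x)^* = rc x by apply/CrealP; rewrite complex_real.
have Aherm : A \is hermsymmx.
  apply/is_hermitianmxP; rewrite expr0 scale1r; apply/matrixP => i j.
  by rewrite !mxE conj_rc -[in RHS]Js mxE.
have Asp := orthomx_spectralP (hermitian_normalmx Aherm).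
have Ar := hermitian_spectral_diag_real Aherm.
set P := spectralmx A in Asp; set D := spectral_diag A in Asp Ar.
have PU : P \is unitarymx by apply: spectral_unitarymx.
have Pu := unitarymx_unit PU.
have PV : P^t* = invmx P := esym (invmx_unitary PU).
have nP (w : 'cV_n) : nrm2 (P *m w) = nrm2 w.
  rewrite !nrm2E trmx_mul map_mxM mulmxA -[_ *m _ *m P]mulmxA.
  by rewrite PV (mulVmx Pu) mulmx1.
have PA : P *m A = diag_mx D *m P.
  have conj (X Y Z : 'M[R[i]%C]_n) : X \in unitmx -> Z = invmx X *m Y *m X -> X *m Z = Y *m X.
    by move=> Xu ->; rewrite !mulmxA mulmxV // mul1mx.
  exact: conj Pu Asp.
pose ev i : R := complex.Re (D 0 i).
have evE i : D 0 i = rc (ev i).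
  by have /mxOverP/(_ 0 i)/RRe_real <- := Ar.
(* The hypothesis speaks of real eigenvectors only. Without any, [J - ev i] is invertible over the
   reals, hence over the complex numbers, which contradicts the complex eigenvector in row [i] of
   [P]. *)
have evd i : dl <= `|ev i - E|.
  rewrite leNgt; apply/negP => lt.
  have Ju : J - (ev i)%:M \in unitmx.
    apply: unitmx_inj => v; rewrite mulmxBl mul_scalar_mx => /subr0_eq.
    exact: noeig lt.
  have : map_mx rc (J - (ev i)%:M) \in unitmx by rewrite map_unitmx.
  rewrite map_mxB map_scalar_mx -/A -evE => Au.
  have : row i P *m (A - (D 0 i)%:M) = 0.
    rewrite mulmxBr -row_mul PA row_mul row_diag_mx -scalemxAl.
    by rewrite -rowE mul_mx_scalar subrr.
  move=> /(congr1 (mulmx^~ (invmx (A - (D 0 i)%:M)))); rewrite mulmxK // mul0mx.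
  move=> ri0; have /unitarymxP/matrixP/(_ i i) := PU.
  rewrite !mxE eqxx big1 => [/esym/eqP|j _]; first by rewrite oner_eq0.
  by have /rowP/(_ j) := ri0; rewrite !mxE => ->; rewrite mul0r.
pose U : 'cV[R[i]]_n := map_mx rc u.
have n1 (w : 'cV[R]_n) : nrm2 (map_mx rc w) = rc (\sum_i w i 0 ^+ 2).
  rewrite rmorph_sum; apply: eq_bigr => i _; rewrite mxE rmorphXn.
  by rewrite normCK conj_rc expr2.
have : rc (dl ^+ 2) * nrm2 U <= nrm2 (A *m U - rc E *: U).
  rewrite -nP -[leRHS]nP mulmxBr mulmxA PA -scalemxAr.
  rewrite mulr_sumr; apply: ler_sum => i _.
  rewrite -mulmxA mul_diag_mx !mxE evE -mulrBl normrM exprMn ler_wpM2r //.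
    by rewrite exprn_ge0.
  rewrite -rmorphB normCK conj_rc -rmorphM lecR -expr2 -[leRHS]real_normK ?num_real //.
  by rewrite lerXn2r ?nnegrE.
have -> : A *m U - rc E *: U = map_mx rc (J *m u - E *: u).
  by rewrite map_mxB map_mxM map_mxZ.
by rewrite !n1 -rmorphM lecR.
Qed.

(** * Determinants of banded boxes *)

Lemma coef_prod_top (F : comNzRingType) (I : Type) (s : seq I)
    (G : I -> {poly F}) (D : nat) :
  (forall i : I, (size (G i) <= D.+1)%N) ->
  (size (\prod_(i <- s) G i)%R <= (size s * D).+1)%N /\
  (\prod_(i <- s) G i)`_(size s * D) = \prod_(i <- s) (G i)`_D.
Proof.
move=> sG; elim: s => [|i s [IHs IHc]] /=.
  by rewrite !big_nil size_poly1 mul0n coef1.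
rewrite !big_cons; split.
  apply: leq_trans (size_polyMleq _ _) _.
  move: (sG i) IHs; rewrite mulSn; set a := size (G i); set b := size (\prod_(j <- s) G j)%R; set m := (size s * D)%N.
  lia.
have iD : (D < (D + size s * D).+1)%N by rewrite ltnS leq_addr.
rewrite mulSn coefM (bigD1 (Ordinal iD)) //= addKn IHc.
rewrite [X in _ + X]big1 ?addr0 // => k kD.
have := ltn_ord k; rewrite ltnS /= => kl.
case: (ltngtP k D) => kD'; last by move: kD; rewrite -val_eqE /= kD' eqxx.
- by rewrite [X in _ * X]nth_default ?mulr0 // (leq_trans IHs) //; move: kl; rewrite ?mulSn; lia.
- by rewrite nth_default ?mul0r // (leq_trans (sG i)).
Qed.

(** Each Leibniz term is a product of [n] entries of degree at most [D], so its coefficient in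
    degree [n * D] involves only the coefficients of degree [D]. *)
Lemma coef_det_top (F : comNzRingType) (n D : nat) (M : 'M[{poly F}]_n) :
  (forall i j, (size (M i j) <= D.+1)%N) ->
  (size (\det M) <= (n * D).+1)%N /\
  (\det M)`_(n * D) = \det (\matrix_(i, j) (M i j)`_D).
Proof.
move=> sM.
have key (s : 'S_n) := coef_prod_top (index_enum 'I_n) (fun i => sM i (s i)).
have sI : size (index_enum 'I_n) = n.
  by rewrite [index_enum 'I_n]unlock -enumT size_enum_ord.
rewrite sI in key.
have sgnE (s : 'S_n) : (-1) ^+ s = ((-1) ^+ s)%:P :> {poly F}.
  by rewrite polyC_exp polyCN.
split.
  apply: leq_trans (size_sum _ _ _) _; apply/bigmax_leqP => s _.
  rewrite sgnE mul_polyC (leq_trans (size_scale_leq _ _)) //.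
  by have [] := key s.
rewrite /determinant coef_sum; apply: eq_bigr => s _.
rewrite sgnE mul_polyC coefZ; congr (_ * _).
have [_ ->] := key s.
by apply: eq_bigr => i _; rewrite mxE.
Qed.

Section Band.
Variables (C : numFieldType) (c w0 om : C) (v : nat -> nat -> C).
Hypotheses (w1 : `|w0| = 1) (om1 : `|om| = 1).
Hypothesis vT : forall j i i', v (j + i) (j + i') = v i i'.

(** For [w0 = exp(2 i pi phi)] and [om = exp(2 i pi alpha)] the diagonal entry is
    [2 cos(2 pi (phi + i alpha)) + c]. An inverse stands for the complex conjugate, so that the
    entry is rational in [w0]. *)
Definition band_kernel (i j : nat) : C :=
  if i == j then w0 * om ^+ i + (w0 * om ^+ i)^-1 + c else v i j.

Definition box (k j : nat) : 'M[C]_k :=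
  \matrix_(i, i') band_kernel (j + i) (j + i').

(** Multiplying every row by [z = w0 * om ^+ j] does not change the modulus of the determinant and
    clears the inverses. The diagonal is then quadratic in [z] with unimodular leading coefficient,
    whereas the other entries are linear; hence the top coefficient does not depend on [v]. *)
Lemma box_det_poly (k : nat) :
  exists P : {poly C}, [/\ (size P <= (k * 2).+1)%N, `|P`_(k * 2)| = 1 &
    forall j, `|\det (box k j)| = `|P.[w0 * om ^+ j]|].
Proof.
pose M : 'M[{poly C}]_k := \matrix_(i, i')
  if i == i' then (om ^+ i) *: 'X^2 + c *: 'X + ((om ^+ i)^-1)%:P
  else (v i i') *: 'X.
have om0 : om != 0 by rewrite -normr_eq0 om1 oner_eq0.
have ww0 : w0 != 0 by rewrite -normr_eq0 w1 oner_eq0.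
have sM i j : (size (M i j) <= 3)%N.
  rewrite mxE; case: eqP => _; last first.
    by rewrite (leq_trans (size_scale_leq _ _)) // size_polyX.
  apply: leq_trans (size_polyD _ _) _; rewrite geq_max; apply/andP; split.
    apply: leq_trans (size_polyD _ _) _; rewrite geq_max; apply/andP; split.
      by rewrite (leq_trans (size_scale_leq _ _)) // size_polyXn.
    by rewrite (leq_trans (size_scale_leq _ _)) // size_polyX.
  by rewrite (leq_trans (size_polyC_leq1 _)).
have [s1 s2] := coef_det_top sM.
exists (\det M); split => //.
  have -> : (\det M)`_(k * 2) = \prod_(i < k) om ^+ i.
    rewrite s2.
    have -> : \matrix_(i, j) (M i j)`_2 = diag_mx (\row_(i < k) om ^+ i).
      apply/matrixP => i j; rewrite !mxE; case: eqP => [->|_].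
        by rewrite /= !coefD !coefZ coefXn coefX coefC /= mulr1 mulr0 !addr0 mulr1n.
      by rewrite coefZ coefX mulr0 mulr0n.
    by rewrite det_diag; apply: eq_bigr => i _; rewrite mxE.
  by rewrite normr_prod big1 // => i _; rewrite normrX om1 expr1n.
move=> j; set z := w0 * om ^+ j.
have z0 : z != 0 by rewrite mulf_neq0 ?expf_neq0.
have z1 : `|z| = 1 by rewrite normrM w1 normrX om1 expr1n mulr1.
rewrite -horner_evalE -det_map_mx.
have -> : map_mx (horner_eval z) M = z *: box k j.
  apply/matrixP => i i'; rewrite !mxE /band_kernel eqn_add2l val_eqE horner_evalE.
  case: eqP => _; rewrite !(hornerD, hornerZ, hornerX, hornerXn, hornerC).
    have oi : om ^+ i != 0 by rewrite expf_neq0.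
    have oj : om ^+ j != 0 by rewrite expf_neq0.
    rewrite /z (exprD om j i); move: oi oj; set A := om ^+ i; set B := om ^+ j => oi oj.
    field.
    by rewrite ww0 oi oj.
  by rewrite vT mulrC.
by rewrite detZ normrM normrX z1 expr1n mul1r.
Qed.

(** The indices on the left of [j] have distances [1..j], those on the right [1..N-j]. Since all
    factors are at most 1, each of the two products is at least the full one. *)
Lemma prod_dist_sq (N j : nat) (s : nat -> C) : (j <= N)%N ->
  (forall l, (0 < l <= N)%N -> 0 < s l <= 1) ->
  (\prod_(1 <= l < N.+1) s l) ^+ 2
    <= \prod_(0 <= i < N.+1 | i != j) s `|i - j|%N.
Proof.
move=> jN s01.
have part m : (m <= N)%N -> \prod_(1 <= l < N.+1) s l <= \prod_(1 <= l < m.+1) s l.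
  move=> mN; rewrite [leLHS](@big_cat_nat _ _ _ m.+1) //=.
  rewrite ler_piMr //.
    by rewrite big_nat_cond prodr_ge0 // => l; rewrite andbT => lm;
       have /andP[/ltW] : 0 < s l <= 1 by apply: s01; lia.
  rewrite big_nat_cond; apply: prodr_ile1 => l; rewrite andbT => lm.
  by have /andP[/ltW -> ->] : 0 < s l <= 1 by apply: s01; lia.
have P0 : 0 <= \prod_(1 <= l < N.+1) s l.
  rewrite big_nat_cond prodr_ge0 // => l; rewrite andbT => lm.
  by have /andP[/ltW] : 0 < s l <= 1 by apply: s01; lia.
rewrite [leRHS](@big_cat_nat _ _ _ j) //=; last exact: leqW.
rewrite [X in _ <= _ * X](@big_cat_nat _ _ _ j.+1 j) //=.
rewrite [X in _ * (X * _)]big_nat_cond [X in _ * (X * _)]big1 ?mul1r; last first.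
  by move=> i ij; exfalso; lia.
rewrite expr2; apply: ler_pM => //.
  have -> : \prod_(0 <= i < j | i != j) s `|i - j|%N = \prod_(1 <= l < j.+1) s l.
    rewrite big_add1 /= big_nat_rev /= big_nat_cond [RHS]big_nat_cond.
    by apply: eq_big => [i|i ij]; [lia|congr s; lia].
  exact: part.
have -> : \prod_(j.+1 <= i < N.+1 | i != j) s `|i - j|%N
        = \prod_(1 <= l < (N - j).+1) s l.
  rewrite -addn1 addnC big_addn subSn //.
  rewrite big_nat_cond [RHS]big_nat_cond.
  by apply: eq_big => [i|i ij]; [lia|congr s; lia].
by apply: part; lia.
Qed.

(** The [2k + 1] interpolation nodes are consecutive orbit points, and two nodes whose indices
    differ by [l] are exactly [|om ^+ l - 1|] apart. *)
Lemma box_det_lower (k j0 : nat) (s : nat -> C) :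
  (forall l, (0 < l <= k * 2)%N -> 0 < s l <= 1 /\ s l <= `|om ^+ l - 1|) ->
  exists2 j, (j0 <= j <= j0 + k * 2)%N &
    (\prod_(1 <= l < (k * 2).+1) s l) ^+ 2 <= (k * 2).+1%:R * `|\det (box k j)|.
Proof.
move=> sP; have [P [sP1 lP dP]] := box_det_poly k.
pose c0 := (\prod_(1 <= l < (k * 2).+1) s l) ^+ 2.
have c0P : 0 < c0.
  rewrite exprn_gt0 // big_nat_cond prodr_gt0 // => l; rewrite andbT => lm.
  by have [/andP[]] := sP l lm.
have := @lagrange_lower_bound _ (k * 2) P (fun i => w0 * om ^+ (j0 + i)) c0 sP1 c0P.
case.
  move=> j; apply: le_trans (@prod_dist_sq (k * 2) j s _ _) _.
  - by rewrite -ltnS.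
  - by move=> l /sP[].
  rewrite (big_mkord (fun i => i != j :> nat)) ler_prod // => i ij.
  have ij' : (0 < `|i - j| <= k * 2)%N.
    have := ltn_ord i; have := ltn_ord j; move: ij; lia.
  have [/andP[/ltW -> _] /le_trans -> //] := sP _ ij'.
  rewrite -mulrBr normrM w1 mul1r.
  wlog ji : i j {ij ij'} / (j <= i)%N.
    move=> W; case/orP: (leq_total j i) => ji; first exact: W.
    by rewrite distnC [leRHS]distrC; apply: W.
  have -> : om ^+ (j0 + i) = om ^+ (j0 + j) * om ^+ (i - j).
    by rewrite -exprD; congr (_ ^+ _); lia.
  rewrite -[X in _ <= `|X - _|]mulr1 -mulrBr normrM normrX om1 expr1n mul1r [leRHS]distrC.
  by rewrite distnEl.
move=> j; rewrite lP mulr1 -dP => h.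
by exists (j0 + j)%N => //; have := ltn_ord j; lia.
Qed.

End Band.

(** Restricted to the box, [r] solves [A r = - b], where [b] collects the couplings to the outside
    and lives within [d] of the two ends. By Cramer's rule [det A * r] is a sum of cofactors times
    [b]; a site [y] of the middle half is at distance at least [h - d] from these ends, so every
    such cofactor carries [mu ^- (h - d)]. *)
Lemma box_decay (C : numFieldType) (K : nat -> nat -> C) (r : nat -> C)
    (S d h j y : nat) (mu a : C) :
  (d <= h)%N -> (j + 4 * h <= S)%N -> (h <= y <= 3 * h)%N -> (y < 4 * h)%N ->
  1 <= mu -> 1 <= a ->
  (forall i i' : nat, (d < `|i - i'|)%N -> K i i' = 0) ->
  (forall i : nat, \sum_(i' < S) `|K i i'| * mu ^+ `|i - i'|%N <= a) ->
  (forall i, `|r i| <= 1) ->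
  (forall i, (j <= i < j + 4 * h)%N -> \sum_(i' < S) K i i' * r i' = 0) ->
  `|\det (\matrix_(i < 4 * h, i' < 4 * h) K (j + i)%N (j + i')%N)|
     * `|r (j + y)%N| * mu ^+ (h - d) <= (4 * h)%:R * a ^+ (4 * h).+1.
Proof.
move=> dh jS yh yk mu1 a1 Kd rowK r1 Kr0.
set k := (4 * h)%N in jS yk Kr0 *.
set A := \matrix_(i < k, i' < k) _.
have mu0 : 0 < mu by apply: lt_le_trans mu1.
have a0 : 0 <= a by apply: le_trans a1.
pose rho : 'cV[C]_k := \col_i r (j + i)%N.
pose b (i : 'I_k) : C := \sum_(i' < S | ~~ (j <= i' < j + k)%N) K (j + i)%N i' * r i'.
have Kmu i i' : `|K i i'| <= `|K i i'| * mu ^+ `|i - i'|%N.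
  by rewrite ler_peMr // exprn_ege1.
have box_sum (F : nat -> C) : \sum_(i' < S | (j <= i' < j + k)%N) F i'
   = \sum_(l < k) F (j + l)%N.
  rewrite -(big_mkord (fun i' => (j <= i' < j + k)%N)) -(big_mkord xpredT (fun l => F (j + l)%N)).
  rewrite (@big_cat_nat _ _ _ j) //=; last by lia.
  rewrite big_nat_cond big1 ?add0r; last by move=> i; lia.
  rewrite (@big_cat_nat _ _ _ (j + k)) //=; last by lia.
  rewrite [X in _ + X]big_nat_cond [X in _ + X]big1 ?addr0; last by move=> i; lia.
  rewrite -{1}[j]add0n big_addn addKn.
  rewrite big_nat_cond [RHS]big_nat_cond; apply: eq_big => [i|i _]; first by lia.
  by rewrite addnC.
have Ab i : (A *m rho) i 0 = - b i.
  have := Kr0 (j + i)%N; rewrite leq_addr ltn_add2l ltn_ord => /(_ isT).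
  rewrite (bigID (fun i' : 'I_S => (j <= i' < j + k)%N)) /=.
  rewrite (box_sum (fun i' => K (j + i)%N i' * r i')) -/(b i) => /eqP.
  rewrite addr_eq0 => /eqP <-; rewrite mxE; apply: eq_bigr => l _.
  by rewrite !mxE.
have ba i : `|b i| <= a.
  apply: le_trans (rowK (j + i)%N).
  apply: le_trans (ler_norm_sum _ _ _) _.
  rewrite [leRHS](bigID (fun i' : 'I_S => ~~ (j <= i' < j + k)%N)) /=.
  apply: ler_wpDr.
    by apply: sumr_ge0 => i' _; rewrite mulr_ge0 ?exprn_ge0 ?(ltW mu0).
  apply: ler_sum => i' _; rewrite normrM (le_trans _ (Kmu _ _)) //.
  by rewrite ler_piMr.
have b0 (i : 'I_k) : (d <= i < k - d)%N -> b i = 0.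
  move=> di; rewrite /b big1 // => i' out; rewrite Kd ?mul0r //.
  have := ltn_ord i; lia.
have rowA (i : 'I_k) : \sum_l `|A i l| * mu ^+ `|i - l|%N <= a.
  apply: le_trans (rowK (j + i)%N).
  rewrite [leRHS](bigID (fun i' : 'I_S => (j <= i' < j + k)%N)) /=.
  rewrite (box_sum (fun i' => `|K (j + i)%N i'| * mu ^+ `|(j + i)%N - i'|%N)).
  apply: ler_wpDr.
    by apply: sumr_ge0 => i' _; rewrite mulr_ge0 ?exprn_ge0 ?(ltW mu0).
  by apply: ler_sum => l _; rewrite mxE distnDl.
pose Y := Ordinal yk.
have -> : `|\det A| * `|r (j + y)%N| = `|\sum_i cofactor A i Y * b i|.
  rewrite -normrM.
  have : (\adj A *m (A *m rho)) Y 0 = \det A * r (j + y)%N.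
    by rewrite mulmxA mul_adj_mx mul_scalar_mx !mxE.
  move=> <-; rewrite mxE -[LHS]normrN -sumrN; congr `|_|.
  by apply: eq_bigr => i _; rewrite Ab mxE mulrN opprK.
apply: le_trans (ler_wpM2r _ (ler_norm_sum _ _ _)) _; first by rewrite exprn_ge0 ?(ltW mu0).
rewrite mulr_suml -[k in k%:R](card_ord k) -sum1_card natr_sum mulr_suml.
apply: ler_sum => i _; rewrite mul1r.
case: (boolP (d <= i < k - d)%N) => [di|ndi].
  by rewrite b0 // mulr0 normr0 mul0r exprn_ge0.
rewrite normrM mulrAC exprSr; apply: ler_pM => //.
  by rewrite mulr_ge0 ?exprn_ge0 ?(ltW mu0).
apply: le_trans (cofactor_band_bound i Y mu1 a1 rowA).
rewrite ler_wpM2l // ler_weXn2l //=.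
by have := ltn_ord i; move: ndi; rewrite /k; lia.
Qed.

From mathcomp Require Import all_classical all_reals all_analysis.
Import numFieldNormedType.Exports.
Local Open Scope classical_set_scope.
Local Open Scope ring_scope.

(** * Small denominators *)

Section Dist.
Variable R : realType.
Implicit Types x y : R.

Lemma dist_to_Z_le x (k : int) : dist_to_Z x <= `|x - k%:~R|.
Proof.
apply: ge_inf; last by exists k.
by exists 0 => _ [j _ <-]; apply: normr_ge0.
Qed.

Lemma dist_to_Z_lb x c : (forall k : int, c <= `|x - k%:~R|) -> c <= dist_to_Z x.
Proof.
move=> cP; apply: lb_le_inf; first by exists `|x - 0%:~R|, 0.
by move=> _ [k _ <-].
Qed.

Lemma dist_to_Z_ge0 x : 0 <= dist_to_Z x.
Proof. by apply: dist_to_Z_lb => k; apply: normr_ge0. Qed.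

Lemma dist_to_Z_attained x : exists k : int, dist_to_Z x = `|x - k%:~R|.
Proof.
pose n := Num.floor x.
have n1 : n%:~R <= x by apply: floor_le_tmp.
have n2 : x < (n + 1)%:~R by apply: floorD1_gt.
have key (k : int) : Num.min (x - n%:~R) ((n + 1)%:~R - x) <= `|x - k%:~R|.
  rewrite ge_min; have [kn|nk] := leP k n.
    have : k%:~R <= n%:~R :> R by rewrite ler_int.
    by move=> kn'; rewrite ger0_norm; [apply/orP; left|]; lra.
  have : (n + 1)%:~R <= k%:~R :> R by rewrite ler_int; lia.
  by move=> kn'; rewrite ler0_norm; [apply/orP; right|]; lra.
have [le|le] := leP (x - n%:~R) ((n + 1)%:~R - x).
  exists n; apply/le_anti; rewrite dist_to_Z_le /=; apply: dist_to_Z_lb => k.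
  by apply: le_trans (key k); rewrite ger0_norm ?subr_ge0 // le_min lexx le.
exists (n + 1); apply/le_anti; rewrite dist_to_Z_le /=; apply: dist_to_Z_lb => k.
apply: le_trans (key k); rewrite distrC ger0_norm ?subr_ge0 ?(ltW n2) //.
by rewrite le_min lexx (ltW le).
Qed.

Lemma dist_to_Z_le_half x : dist_to_Z x <= 2^-1.
Proof.
have n1 : (Num.floor x)%:~R <= x by apply: floor_le_tmp.
have n2 : x < (Num.floor x + 1)%:~R by apply: floorD1_gt.
have := dist_to_Z_le x (Num.floor x); rewrite ger0_norm ?subr_ge0 // => h1.
have := dist_to_Z_le x (Num.floor x + 1); rewrite ltr0_norm ?subr_lt0 // => h2.
by rewrite intrD in n2 h2; lra.
Qed.

Lemma dist_to_Z_irr x (l : nat) : irrational x -> (0 < l)%N ->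
  0 < dist_to_Z (l%:R * x).
Proof.
move=> xI l0; rewrite lt_neqAle dist_to_Z_ge0 andbT eq_sym.
have [k ->] := dist_to_Z_attained (l%:R * x).
apply/eqP => /eqP; rewrite normr_eq0 subr_eq0 => /eqP e; apply: xI.
apply/rationalP; exists k, l; rewrite -e mulrC mulKf //.
by rewrite pnatr_eq0 -lt0n.
Qed.

(** The limsup is below [b + 1]; the extra 1 makes the comparison strict, so that it holds on a
    whole tail. *)
Lemma beta_lower_bound (alpha b : R) : irrational alpha -> beta alpha = b%:E ->
  exists k1 : nat, forall k, (k1 <= k)%N ->
    expR (- ((b + 1) * k%:R)) <= dist_to_Z (k%:R * alpha).
Proof.
move=> aI aB.
have : (beta alpha < (b + 1)%:E)%E by rewrite aB lte_fin ltrDl.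
rewrite /beta /limn_esup /limf_esup => /ereal_inf_lt[_ [V [N _ NV] <-]] supV.
exists N.+1 => k Nk.
have k0 : (0 < k)%N by apply: leq_trans Nk.
have Vk : V k by apply: NV => /=; apply: ltnW.
have : ((- ln (dist_to_Z (k%:R * alpha)) / k%:R)%:E < (b + 1)%:E)%E.
  by apply: le_lt_trans supV; apply: ereal_sup_ubound; exists k.
rewrite lte_fin ltr_pdivrMr ?ltr0n // => lt.
have d0 := dist_to_Z_irr aI k0.
by rewrite -[leRHS]lnK ?posrE // ler_expR lerNl ltW.
Qed.

(** Pigeonhole principle for the [Q + 1] fractional parts of [i * alpha] in [Q] bins. *)
Lemma dirichlet (alpha : R) (Q : nat) : (0 < Q)%N ->
  exists2 q : nat, (0 < q <= Q)%N & dist_to_Z (q%:R * alpha) < Q%:R^-1.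
Proof.
move=> Q0; have Qr : 0 < Q%:R :> R by rewrite ltr0n.
pose fr (i : nat) : R := i%:R * alpha - (Num.floor (i%:R * alpha))%:~R.
have fr0 i : 0 <= fr i by rewrite subr_ge0 floor_le_tmp.
have fr1 i : fr i < 1.
  by have := floorD1_gt (i%:R * alpha); rewrite intrD /fr; lra.
pose bin (i : nat) : nat := `|Num.floor (Q%:R * fr i)|%N.
have binE i : (bin i)%:R <= Q%:R * fr i < (bin i)%:R + 1.
  have f0 : 0 <= Num.floor (Q%:R * fr i) by rewrite floor_ge_int mulr_ge0 // ltW.
  rewrite /bin natr_absz ger0_norm // floor_le_tmp /=.
  by have := floorD1_gt (Q%:R * fr i); rewrite intrD.
have binQ i : (bin i < Q)%N.
  rewrite -(ltr_nat R); have /andP[h _] := binE i; apply: le_lt_trans h _.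
  by rewrite -[ltRHS]mulr1 ltr_pM2l.
pose B (i : 'I_Q.+1) : 'I_Q := Ordinal (binQ i).
have /injectivePn[i [j ij Bij]] : ~~ injectiveb B.
  apply/negP => /injectiveP /leq_card; rewrite !card_ord.
  by rewrite ltnn.
wlog ltij : i j ij Bij / (i < j)%N.
  move=> W; have : (i < j)%N || (j < i)%N by rewrite -neq_ltn.
  by case/orP => h; [apply: (W i j)|apply: (W j i); rewrite 1?eq_sym].
have {}Bij : bin i = bin j by move: Bij => /(congr1 val).
exists (j - i)%N; first by have := ltn_ord j; lia.
have [/andP[h1 h2] /andP[h3 h4]] := (binE i, binE j).
rewrite Bij in h1 h2.
apply: le_lt_trans (dist_to_Z_le _ (Num.floor (j%:R * alpha) - Num.floor (i%:R * alpha))) _.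
have -> : (j - i)%:R * alpha - (Num.floor (j%:R * alpha) - Num.floor (i%:R * alpha))%:~R
        = fr j - fr i.
  by rewrite natrB ?(ltnW ltij) // intrB /fr; ring.
rewrite -(ltr_pM2l Qr) mulfV ?gt_eqF // -[X in X * _](gtr0_norm Qr) -normrM mulrBr.
move: h1 h2 h3 h4; move: (Q%:R * fr i) (Q%:R * fr j) (bin j)%:R => X Y B' h1 h2 h3 h4.
by rewrite ltr_norml; apply/andP; split; lra.
Qed.

(** The half of Stirling's formula needed here; the induction step is [(1 + 1/q)^q <= e]. *)
Lemma fact_ge_expR (q : nat) : q%:R ^+ q <= q`!%:R * expR q%:R :> R.
Proof.
elim: q => [|q IH]; first by rewrite expr0 expR0 mulr1.
rewrite factS natrM exprS -mulrA ler_pM2l ?ltr0n //.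
case: q IH => [|q] IH; first by rewrite expr0 mul1r -expR0 ler_expR.
apply: (@le_trans _ _ (q.+1%:R ^+ q.+1 * expR 1)); last first.
  by rewrite -[in expR q.+2%:R]natr1 expRD mulrA ler_pM2r ?expR_gt0.
have q0 : 0 < q.+1%:R :> R by rewrite ltr0n.
have -> : q.+2%:R = q.+1%:R * (1 + q.+1%:R^-1) :> R.
  by rewrite mulrDr mulr1 mulfV ?gt_eqF // natr1.
rewrite exprMn ler_pM2l ?exprn_gt0 //.
apply: (@le_trans _ _ (expR (q.+1%:R^-1) ^+ q.+1)).
  by rewrite lerXn2r ?nnegrE ?expR_ge0 ?addr_ge0 ?invr_ge0 ?(ltW q0) // expR_ge1Dx.
by rewrite -expRM_natl mulfV // gt_eqF.
Qed.

End Dist.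

Section SmallDenominators.
Variables (R : realType) (alpha b : R) (k1 : nat).
Hypotheses (aI : irrational alpha) (b0 : 0 <= b).
Hypothesis aB : forall k, (k1 <= k)%N ->
  expR (- ((b + 1) * k%:R)) <= dist_to_Z (k%:R * alpha).

Section FixedScale.
Variables (n q : nat) (p : int).
Hypotheses (n0 : (0 < n)%N) (q0 : (0 < q)%N) (qn : (q <= 2 * n)%N) (k1q : (k1 <= q)%N).
Hypothesis pq : dist_to_Z (q%:R * alpha) = `|q%:R * alpha - p%:~R|.
Hypothesis qd : dist_to_Z (q%:R * alpha) < (2 * n)%:R^-1.
Hypothesis qmin : forall q', (0 < q' < q)%N ->
  (2 * n)%:R^-1 <= dist_to_Z (q'%:R * alpha).

(** [q] is the first integer whose multiple of [alpha] comes within [1/(2n)] of an integer. Dividing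
    [q] and [p] by a common factor would divide the error as well, giving an earlier one. *)
Lemma convergent_coprime : coprimez q%:Z p.
Proof.
rewrite /coprimez; apply/negP => /negP g1.
set g := gcdz q p in g1.
have g0 : 0 < g by rewrite /g /gcdz ltz_nat gcdn_gt0 q0.
have [u qu] := dvdzP (dvdz_gcdl q p); have [v pv] := dvdzP (dvdz_gcdr q p).
rewrite -/g in qu pv.
have gr : 0 < g%:~R :> R by rewrite ltr0z.
have u0 : 0 < u by move: q0; nia.
have uq : (0 < `|u| < q)%N by nia.
have := qmin uq; apply/negP; rewrite -ltNge; apply: le_lt_trans qd.
apply: le_trans (dist_to_Z_le _ v) _.
have e : q%:R * alpha - p%:~R = g%:~R * (`|u|%N%:R * alpha - v%:~R).
  rewrite pv rmorphM /= -[q%:R]/(q%:Z%:~R) qu rmorphM /= natr_absz gtr0_norm //.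
  ring.
rewrite pq e normrM gtr0_norm // ler_peMl // ler1z.
lia.
Qed.

Definition residue (l : nat) : nat := `|((l%:Z * p) %% q%:Z)%Z|%N.

Lemma residueE (l : nat) : (residue l)%:Z = ((l%:Z * p) %% q%:Z)%Z.
Proof. by rewrite /residue gez0_abs // modz_ge0 //; lia. Qed.

Lemma residue_lt l : (residue l < q)%N.
Proof. by rewrite -ltz_nat residueE ltz_pmod //; lia. Qed.

(** A [q]-periodic lower bound for [dist_to_Z (l * alpha)], read off from [alpha] close to [p / q].
    The product [s (q - s) / (2 q^2)], although smaller than [min(s, q - s) / (2 q)], is preferred
    because over all nonzero residues it multiplies to a squared factorial. *)
Definition low (l : nat) : R :=
  if (q %| l)%N then expR (- ((b + 1) * q%:R))
  else (residue l)%:R * (q - residue l)%:R / (2 * q%:R ^+ 2).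

Lemma residue_eq0 l : (residue l == 0)%N = (q %| l)%N.
Proof.
rewrite -eqz_nat residueE.
have -> : ((l%:Z * p) %% q%:Z == 0)%Z = (q%:Z %| l%:Z * p)%Z.
  by apply/eqP/idP => [/dvdz_mod0P|/dvdz_mod0P].
by rewrite mulrC Gauss_dvdzr ?convergent_coprime.
Qed.

Lemma low_gt0 l : 0 < low l.
Proof.
rewrite /low; case: ifP => ql; first exact: expR_gt0.
by rewrite divr_gt0 ?mulr_gt0 ?exprn_gt0 ?ltr0n ?subn_gt0 ?residue_lt // lt0n residue_eq0 ql.
Qed.

Lemma low_le1 l : low l <= 1.
Proof.
rewrite /low; case: ifP => ql.
  by rewrite -expR0 ler_expR oppr_le0 mulr_ge0 ?addr_ge0.
rewrite ler_pdivrMr ?mulr_gt0 ?exprn_gt0 ?ltr0n // mul1r.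
have h1 : (residue l)%:R <= q%:R :> R by rewrite ler_nat ltnW // residue_lt.
have h2 : (q - residue l)%:R <= q%:R :> R by rewrite ler_nat leq_subr.
apply: (@le_trans _ _ (q%:R * q%:R)); first exact: ler_pM.
by rewrite -expr2 ler_peMl ?exprn_ge0 // ler1n.
Qed.

(** With [dl = q alpha - p] one has [l alpha = (l p + l dl) / q] and [l |dl| <= 1/2]. If [q] does
    not divide [l], the integer nearest part costs at most half of [min(s, q - s) >= 1]. If
    [l = i q], the distance is [i |dl| >= |dl|], which is where the hypothesis on [beta] enters. *)
Lemma dist_ge_low l : (0 < l <= n)%N -> low l <= dist_to_Z (l%:R * alpha).
Proof.
move=> ln.
have qr : 0 < q%:R :> R by rewrite ltr0n.
have nr : 0 < n%:R :> R by rewrite ltr0n.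
have lr : 0 < l%:R :> R by rewrite ltr0n; lia.
have lnr : l%:R <= n%:R :> R by rewrite ler_nat; lia.
pose dl := q%:R * alpha - p%:~R.
have dlE : alpha = (p%:~R + dl) / q%:R by rewrite /dl subrKC mulrAC mulfV ?mul1r ?gt_eqF.
have ldl : l%:R * `|dl| <= 2^-1.
  rewrite -pq; apply: (@le_trans _ _ (n%:R * (2 * n)%:R^-1)).
    by apply: ler_pM; rewrite ?dist_to_Z_ge0 ?(ltW qd) // ltW.
  by rewrite natrM invfM mulrCA mulfV ?mulr1 // gt_eqF.
rewrite /low; case: ifP => ql.
  apply: (le_trans (aB k1q)); rewrite pq; apply: dist_to_Z_lb => t.
  have [i li] := dvdnP ql.
  have i0n : (0 < i)%N by move: ln; rewrite li; case: (i).
  have i0 : 1 <= i%:R :> R by rewrite ler1n.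
  have q1 : 1 <= q%:R :> R by rewrite ler1n.
  have dhalf : i%:R * `|dl| <= 2^-1.
    by apply: le_trans ldl; rewrite ler_wpM2r // ler_nat li leq_pmulr.
  have e : l%:R * alpha - t%:~R = i%:R * dl + (i%:Z * p - t)%:~R.
    rewrite li natrM rmorphB rmorphM /= /dl -[i%:~R]/(i%:R : R); ring.
  rewrite e -/dl; have [z|nz] := eqVneq (i%:Z * p - t) 0.
    rewrite z addr0 normrM ger0_norm; last by lra.
    by rewrite ler_peMl.
  have z1 : 1 <= `|(i%:Z * p - t)%:~R| :> R.
    rewrite -intr_norm ler1z.
    by move: nz; move: (i%:Z * p - t) => z; clear; lia.
  have d1 : `|dl| <= i%:R * `|dl| by rewrite ler_peMl.
  have := ler_normB (i%:R * dl + (i%:Z * p - t)%:~R) (i%:R * dl).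
  rewrite addrAC subrr add0r [`|i%:R * dl|]normrM ger0_norm; last by lra.
  lra.
apply: dist_to_Z_lb => t.
set s := residue l.
have sq : (0 < s < q)%N by rewrite residue_lt lt0n residue_eq0 ql.
pose w := (l%:Z * p - t * q%:Z)%Z.
have e : l%:R * alpha - t%:~R = (w%:~R + l%:R * dl) / q%:R.
  rewrite /w rmorphB !rmorphM /= /dl -[l%:~R]/(l%:R : R) -[q%:~R]/(q%:R : R).
  by field; rewrite gt_eqF.
have ws : (w = s%:Z %[mod q])%Z.
  by rewrite /s residueE modz_mod /w addrC -mulNr modzMDl.
have wabs : (minn s (q - s) <= `|w|)%N.
  have [v wv] : exists v, w = s%:Z + v * q%:Z.
    exists ((w - s%:Z) %/ q%:Z)%Z; rewrite divzK ?subrKC //.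
    by rewrite -eqz_mod_dvd; apply/eqP.
  rewrite geq_min; apply/orP; have [v0|v0] : 0 <= v \/ v <= -1 by clear; lia.
    have vq : 0 <= v * q%:Z by rewrite mulr_ge0.
    by left; rewrite -lez_nat abszE wv ger0_norm ?lerDl // addr_ge0.
  have vq : v * q%:Z <= - q%:Z by rewrite -mulN1r ler_wpM2r.
  by right; rewrite -lez_nat abszE wv ler0_norm; move: vq sq; move: (v * q%:Z) => z; clear; lia.
rewrite e normrM normfV (gtr0_norm qr) ler_pdivlMr //.
apply: (@le_trans _ _ (`|w%:~R| - l%:R * `|dl|)); last first.
  have := ler_normB (w%:~R + l%:R * dl) (l%:R * dl).
  by rewrite addrK [`|l%:R * dl|]normrM (gtr0_norm lr); lra.
have m1 : 1 <= (minn s (q - s))%:R :> R by rewrite ler1n; move: sq; clear; lia.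
have wr : (minn s (q - s))%:R <= `|w%:~R| :> R.
  by rewrite -intr_norm -natr_absz ler_nat.
apply: (@le_trans _ _ ((minn s (q - s))%:R / 2)); last by lra.
have sm : s%:R * (q - s)%:R <= (minn s (q - s))%:R * q%:R :> R.
  rewrite -!natrM ler_nat /minn; case: ifP => _.
    by rewrite leq_mul2l leq_subr orbT.
  by rewrite mulnC leq_mul2l (ltnW _) ?orbT //; case/andP: sq.
have -> : s%:R * (q - s)%:R / (2 * q%:R ^+ 2) * q%:R
        = s%:R * (q - s)%:R / q%:R / 2 :> R by field; rewrite gt_eqF.
by rewrite ler_pM2r ?invr_gt0 // ler_pdivrMr.
Qed.

Lemma low_period l i : low (l + i * q) = low l.
Proof.
rewrite /low dvdn_addl ?dvdn_mull //; case: ifP => // _.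
have -> : residue (l + i * q) = residue l.
  apply/eqP; rewrite -eqz_nat !residueE PoszD PoszM mulrDl.
  by rewrite -mulrA [q%:Z * p]mulrC mulrA -modzDmr modzMl addr0.
by [].
Qed.

Lemma residue_inj : {in [pred l | (l < q)%N] &, injective residue}.
Proof.
move=> l l'; rewrite !inE => lq lq' /(congr1 Posz); rewrite !residueE => /eqP.
rewrite eqz_mod_dvd -mulrBl mulrC Gauss_dvdzr ?convergent_coprime //.
rewrite dvdzE /= => h; apply/eqP/negP => /negP ne.
have /dvdn_leq/(_ h) : (0 < `|(l%:Z - l'%:Z)%R|)%N by lia.
lia.
Qed.

(** Over a period the residues run once through [0..q-1], as [p] is prime to [q]. Residue 0 costs
    [b + 1] in the exponent; the others give [((q-1)!/q^(q-1))^2 / 2^(q-1)], where the two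
    factorials and the power of 2 cost 1 each: in total [b + 4]. *)
Lemma block_low : expR (- ((b + 4) * q%:R)) <= \prod_(0 <= l < q) low l.
Proof.
have qr : 0 < q%:R :> R by rewrite ltr0n.
have low0 : low 0 = expR (- ((b + 1) * q%:R)) by rewrite /low dvdn0.
pose F (s : nat) : R := if (s == 0)%N then expR (- ((b + 1) * q%:R))
  else s%:R * (q - s)%:R / (2 * q%:R ^+ 2).
have lowF l : low l = F (residue l) by rewrite /low /F residue_eq0.
have -> : \prod_(0 <= l < q) low l = \prod_(0 <= s < q) F s.
  rewrite !big_mkord.
  pose h (l : 'I_q) : 'I_q := Ordinal (residue_lt l).
  have hI : injective h.
    move=> l l' /(congr1 val) /= e; apply/val_inj.
    by apply: residue_inj; rewrite ?inE ?ltn_ord.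
  by rewrite [RHS](reindex_inj hI); apply: eq_bigr => l _; rewrite lowF.
rewrite /F {F lowF low0}; case: (q) qr q0 => // m qr _; rewrite big_nat_recl //=.
pose F (s : nat) : R := s%:R * (m.+1 - s)%:R / (2 * m.+1%:R ^+ 2).
rewrite (eq_bigr (fun i => F i.+1)) //.
have -> : \prod_(0 <= i < m) F i.+1
   = (m`!%:R / m.+1%:R ^+ m) ^+ 2 / 2 ^+ m.
  rewrite (eq_big_nat _ _ (F2 := fun i => i.+1%:R * (m - i)%:R / (2 * m.+1%:R ^+ 2))) //.
  rewrite big_split /= big_split /= prodr_const_nat subn0.
  have -> : \prod_(0 <= i < m) i.+1%:R = m`!%:R :> R.
    by rewrite fact_prod natr_prod big_add1.
  have -> : \prod_(0 <= i < m) (m - i)%:R = m`!%:R :> R.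
    rewrite fact_prod natr_prod big_add1 /= big_nat_rev /= big_nat_cond [RHS]big_nat_cond.
    by apply: eq_bigr => i im; congr _%:R; lia.
  rewrite exprVn exprMn -exprM mulnC exprM invfM expr_div_n; ring.
have h1 : expR (- m.+1%:R) <= m`!%:R / m.+1%:R ^+ m :> R.
  rewrite expRN ler_pdivlMr ?exprn_gt0 // mulrC ler_pdivrMr ?expR_gt0 //.
  rewrite -(ler_pM2l (x := m.+1%:R)) ?ltr0n // -exprS mulrA -natrM -factS.
  exact: fact_ge_expR.
have h2 : 2 ^+ m <= expR (m.+1%:R) :> R.
  apply: (@le_trans _ _ (2 ^+ m.+1)).
    by rewrite ler_weXn2l // ler1n.
  have -> : expR (m.+1%:R) = expR 1 ^+ m.+1 :> R by rewrite -expRM_natl mulr1.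
  rewrite lerXn2r ?nnegrE ?expR_ge0 //.
  by have := expR_ge1Dx (1 : R).
apply: (@le_trans _ _ (expR (- ((b + 1) * m.+1%:R)) *
   (expR (- m.+1%:R) ^+ 2 * expR (- m.+1%:R)))).
  rewrite -expRM_natl -!expRD ler_expR; lra.
rewrite ler_pM2l ?expR_gt0 //; apply: ler_pM.
- by rewrite exprn_ge0 // expR_ge0.
- exact: expR_ge0.
- by rewrite lerXn2r ?nnegrE ?expR_ge0 ?divr_ge0 ?exprn_ge0.
- by rewrite expRN lef_pV2 ?posrE ?expR_gt0 ?exprn_gt0.
Qed.

(** The factors [low l] are at most 1, so the product may be extended to [m = n / q + 1] full
    periods (integer division). As [q <= 2n], they contain [m q <= 3n] indices, hence the factor
    3. *)
Lemma prod_dist_scale :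
  expR (- (3 * (b + 4) * n%:R)) <= \prod_(1 <= l < n.+1) dist_to_Z (l%:R * alpha).
Proof.
pose m := (n %/ q).+1.
have nm : (n < m * q)%N by rewrite /m mulSn {1}(divn_eq n q) addnC ltn_add2r ltn_pmod.
have mq : (m * q <= 3 * n)%N.
  by rewrite /m mulSn; have := leq_divM n q; lia.
apply: (@le_trans _ _ (\prod_(1 <= l < n.+1) low l)); last first.
  rewrite big_nat_cond [leRHS]big_nat_cond; apply: ler_prod => l; rewrite andbT => ln.
  by rewrite dist_ge_low ?(ltW (low_gt0 _)).
apply: (@le_trans _ _ (\prod_(0 <= l < m * q) low l)); last first.
  rewrite [leLHS](@big_cat_nat _ _ _ 1) //=; last exact: leq_ltn_trans nm.
  rewrite [X in _ * X <= _](@big_cat_nat _ _ _ n.+1 1) //=.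
  have P0 i j : 0 <= \prod_(i <= l < j) low l.
    by apply: prodr_ge0 => *; apply/ltW/low_gt0.
  rewrite big_nat1 mulrCA ler_piMr // mulr_ile1 ?(ltW (low_gt0 _)) ?low_le1 //.
  by apply: prodr_ile1 => l _; rewrite low_le1 (ltW (low_gt0 _)).
have -> : \prod_(0 <= l < m * q) low l = (\prod_(0 <= l < q) low l) ^+ m.
  elim: (m) => [|i IH]; first by rewrite mul0n big_nil expr0.
  rewrite mulSn addnC (@big_cat_nat _ _ _ (i * q)) ?leq_addr //= IH exprSr; congr (_ * _).
  rewrite -{1}[(i * q)%N]add0n big_addn addnC addnK.
  by apply: eq_bigr => l _; rewrite low_period.
apply: (@le_trans _ _ (expR (- ((b + 4) * q%:R)) ^+ m)); last first.
  rewrite lerXn2r ?nnegrE ?expR_ge0 ?block_low //.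
  by apply: prodr_ge0 => *; apply/ltW/low_gt0.
rewrite -expRM_natl ler_expR mulrN lerN2.
have -> : m%:R * ((b + 4) * q%:R) = (b + 4) * (m * q)%:R by rewrite natrM; ring.
have -> : 3 * (b + 4) * n%:R = (b + 4) * (3 * n)%:R by rewrite natrM; ring.
by rewrite ler_wpM2l ?ler_nat // addr_ge0.
Qed.
End FixedScale.

(** At each scale [n] the denominator [q] is the minimal one that Dirichlet's theorem provides for
    [2n]. *)
Lemma prod_dist_lower_bound : exists n0 : nat, forall n, (n0 <= n)%N ->
  expR (- (3 * (b + 4) * n%:R)) <= \prod_(1 <= l < n.+1) dist_to_Z (l%:R * alpha).
Proof.
(* The bound from [beta] holds from [k1] on only. Smaller multiples of [alpha] stay at distance [c]
   from the integers, so once [1/(2n) < c] the minimal [q] cannot lie below [k1]. *)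
have [c c0 cP] : exists2 c : R, 0 < c & forall l, (0 < l < k1)%N -> c <= dist_to_Z (l%:R * alpha).
  elim: (k1) => [|k [c c0 cP]]; first by exists 1 => // l; lia.
  have [->|k0] := posnP k; first by exists 1 => // l; lia.
  exists (Num.min c (dist_to_Z (k%:R * alpha))).
    by rewrite lt_min c0 dist_to_Z_irr.
  move=> l lk; rewrite ge_min; have [->|lk'] := eqVneq l k.
    by rewrite lexx orbT.
  by rewrite cP //; lia.
exists (Num.bound c^-1).+1 => n nb.
have n0 : (0 < n)%N by lia.
have nc : (2 * n)%:R^-1 < c.
  rewrite -[ltRHS]invrK ltf_pV2 ?posrE ?invr_gt0 ?ltr0n ?muln_gt0 //.
  apply: lt_le_trans (archi_boundP _) _; first by rewrite invr_ge0 ltW.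
  by rewrite ler_nat; lia.
pose P q := (0 < q)%N && (dist_to_Z (q%:R * alpha) < (2 * n)%:R^-1).
have exP : exists q, P q.
  have [|q /andP[q0 _] qd] := dirichlet alpha (Q := 2 * n); first by lia.
  by exists q; rewrite /P q0.
case: (ex_minnP exP) => q /andP[q0 qd] qmin.
have qn : (q <= 2 * n)%N.
  have [|q' /andP[q'0 q'n] q'd] := dirichlet alpha (Q := 2 * n); first by lia.
  by apply: leq_trans q'n; apply: qmin; rewrite /P q'0.
have k1q : (k1 <= q)%N.
  rewrite leqNgt; apply/negP => qk.
  have := cP q; rewrite q0 qk => /(_ isT); apply/negP.
  by rewrite -ltNge (lt_trans qd).
have [p pE] := dist_to_Z_attained (q%:R * alpha).
apply: (prod_dist_scale n0 q0 qn k1q pE qd) => q' /andP[q'0 q'q].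
rewrite leNgt; apply/negP => lt.
by have := qmin q'; rewrite /P q'0 lt => /(_ isT); rewrite leqNgt q'q.
Qed.
End SmallDenominators.

(** * The circle in turns *)

Section Turns.
Variable R : realType.
Implicit Types x y : R.

Definition c2 y : R := cos (2 * pi * y).
Definition s2 y : R := sin (2 * pi * y).
Definition ex y : R[i]%C := (c2 y +i* s2 y)%C.

Lemma c2s2 y : c2 y ^+ 2 + s2 y ^+ 2 = 1.
Proof. exact: cos2Dsin2. Qed.

Lemma c2D x y : c2 (x + y) = c2 x * c2 y - s2 x * s2 y.
Proof. by rewrite /c2 mulrDr cosD. Qed.

Lemma s2D x y : s2 (x + y) = s2 x * c2 y + c2 x * s2 y.
Proof. by rewrite /s2 mulrDr sinD. Qed.

Lemma c2N y : c2 (- y) = c2 y.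
Proof. by rewrite /c2 mulrN cosN. Qed.

Lemma s2N y : s2 (- y) = - s2 y.
Proof. by rewrite /s2 mulrN sinN. Qed.

Lemma c2_0 : c2 0 = 1. Proof. by rewrite /c2 mulr0 cos0. Qed.
Lemma s2_0 : s2 0 = 0. Proof. by rewrite /s2 mulr0 sin0. Qed.

Lemma c2_half : c2 2^-1 = -1.
Proof. by rewrite /c2 mulrAC mulfV ?mul1r ?cospi ?pnatr_eq0. Qed.

Lemma s2_half : s2 2^-1 = 0.
Proof. by rewrite /s2 mulrAC mulfV ?mul1r ?sinpi ?pnatr_eq0. Qed.

Lemma c2_quarter : c2 4^-1 = 0.
Proof.
rewrite /c2; have -> : 2 * pi * 4^-1 = pi / 2 :> R by field.
exact: cos_pihalf.
Qed.

Lemma s2_quarter : s2 4^-1 = 1.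
Proof.
rewrite /s2; have -> : 2 * pi * 4^-1 = pi / 2 :> R by field.
exact: sin_pihalf.
Qed.

Lemma c2s2_nat (n : nat) : c2 n%:R = 1 /\ s2 n%:R = 0.
Proof.
elim: n => [|n [c s]]; first by rewrite c2_0 s2_0.
have c1 : c2 1 = 1 by rewrite /c2 mulr1 mulr_natl cos2pi.
have s1 : s2 1 = 0 by rewrite /s2 mulr1 mulr_natl sin2pi.
by rewrite -natr1 c2D s2D c s c1 s1; split; ring.
Qed.

Lemma c2s2_int (k : int) : c2 k%:~R = 1 /\ s2 k%:~R = 0.
Proof.
case: k => n; first exact: c2s2_nat.
rewrite NegzE rmorphN /= c2N s2N; have [-> ->] := c2s2_nat n.+1.
by rewrite oppr0.
Qed.

Lemma c2DZ y (k : int) : c2 (y + k%:~R) = c2 y.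
Proof. by have [c s] := c2s2_int k; rewrite c2D c s mulr1 mulr0 subr0. Qed.

Lemma s2DZ y (k : int) : s2 (y + k%:~R) = s2 y.
Proof. by have [c s] := c2s2_int k; rewrite s2D c s mulr1 mulr0 addr0. Qed.

Lemma c2_eq1 y : c2 y = 1 -> exists k : int, y = k%:~R.
Proof.
move=> cy; have [k yk] := dist_to_Z_attained y; exists k.
have h := dist_to_Z_le_half y; have h0 := dist_to_Z_ge0 y.
pose t := y - k%:~R.
have : c2 `|t| = 1.
  have ct : c2 t = 1 by rewrite /t -[- _]rmorphN c2DZ.
  by have [t0|t0] := leP 0 t; rewrite ?(ger0_norm t0) // ltr0_norm ?c2N.
rewrite /t -yk /c2 => ct; have p0 := pi_gt0 R.
have e : 2 * pi * dist_to_Z y = 0.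
  apply: cos_inj; rewrite ?in_itv /= ?lexx ?pi_ge0 ?cos0 //.
  by apply/andP; split; [rewrite !mulr_ge0 // ltW|nra].
move: e => /eqP; rewrite !mulf_eq0 pnatr_eq0 (gt_eqF p0) /= yk normr_eq0.
by rewrite subr_eq0 => /eqP.
Qed.

Lemma exD x y : ex (x + y) = ex x * ex y.
Proof. by rewrite /ex c2D s2D; congr (_ +i* _)%C; ring. Qed.

Lemma ex0 : ex 0 = 1.
Proof. by rewrite /ex c2_0 s2_0. Qed.

Lemma exN y : ex (- y) = (ex y)^-1.
Proof.
have h : ex y * ex (- y) = 1 by rewrite -exD subrr ex0.
have n0 : ex y != 0 by apply/eqP => e; move: h; rewrite e mul0r => /esym/eqP; rewrite oner_eq0.
by apply: (mulfI n0); rewrite h mulfV.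
Qed.

Lemma ex_conj y : (ex y)^* = ex (- y).
Proof.
have : ex (- y) = conjc (ex y) by rewrite /ex c2N s2N.
by move=> ->; rewrite /Num.conj /=.
Qed.

Lemma exX (n : nat) y : ex (n%:R * y) = ex y ^+ n.
Proof.
elim: n => [|n IH]; first by rewrite mul0r ex0 expr0.
by rewrite -natr1 mulrDl mul1r exD IH exprSr.
Qed.

Lemma exZ (k : int) : ex k%:~R = 1.
Proof. by rewrite /ex; have [-> ->] := c2s2_int k. Qed.

Lemma norm_ex y : `|ex y| = 1.
Proof. by rewrite normc_def /= c2s2 sqrtr1. Qed.

Lemma ex_neq0 y : ex y != 0.
Proof. by rewrite -normr_eq0 norm_ex oner_eq0. Qed.

Lemma sin_ge_xcos x : 0 <= x <= pi / 2 -> x * cos x <= sin x.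
Proof.
move=> /andP[x0 xp]; have [->|xn0] := eqVneq x 0; first by rewrite mul0r sin0.
have xp0 : 0 < x by rewrite lt_neqAle eq_sym xn0.
have [|c /andP[c0 cx]] := @MVT R sin cos 0 x xp0 (fun y _ => is_derive_sin y).
  by apply: continuous_subspaceT; apply: continuous_sin.
rewrite sin0 !subr0 => ->; rewrite mulrC ler_pM2r //.
move: c0 cx; rewrite !bnd_simp => c0 cx.
rewrite leNgt ltr_cos ?in_itv /=; last 2 first.
- by apply/andP; split; lra.
- by apply/andP; split; lra.
by rewrite -leNgt ltW.
Qed.

(** For [t = dist_to_Z y <= 1/2] and [u = pi t / 2], the double-angle formula gives
    [sin(2u) >= 2 u cos(u)^2 >= u >= t], since [u <= pi / 4] makes [cos(u)^2] at least [1/2]. *)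
Lemma sin_pi_dist y : dist_to_Z y <= `|sin (pi * y)|.
Proof.
have [k yk] := dist_to_Z_attained y.
have h := dist_to_Z_le_half y; have h0 := dist_to_Z_ge0 y.
have p2 := pi_ge2 R.
set t := dist_to_Z y in yk h h0 *.
have -> : `|sin (pi * y)| = sin (pi * t).
  have st : 0 <= sin (pi * t) by apply: sin_ge0_pi; apply/andP; split; nra.
  rewrite -[RHS](ger0_norm st); apply/eqP.
  rewrite -(eqrXn2 (n := 2)) // ?real_normK ?num_real //.
  have cosE z : sin (pi * z) ^+ 2 = (1 - c2 z) / 2.
    rewrite /c2 -mulrA mulr_natl cos_mulr2n.
    by have := cos2Dsin2 (pi * z); lra.
  rewrite !cosE; apply/eqP; congr ((1 - _) / 2).
  rewrite yk; have -> : c2 y = c2 (y - k%:~R) by rewrite -[- _]rmorphN c2DZ.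
  by have [t0|t0] := leP 0 (y - k%:~R); rewrite ?(ger0_norm t0) // ltr0_norm ?c2N.
have -> : pi * t = (pi * t / 2) *+ 2 by rewrite -mulr_natr; field.
set u := pi * t / 2.
have u0 : 0 <= u <= pi / 2 by rewrite /u; apply/andP; split; nra.
have su := sin_ge_xcos u0.
have cu : 0 <= cos u by apply: cos_ge0_pihalf; rewrite /u; apply/andP; split; nra.
have c2u : 2^-1 <= cos u ^+ 2.
  have : 0 <= cos (u *+ 2).
    by apply: cos_ge0_pihalf; rewrite -mulr_natr /u; apply/andP; split; nra.
  by rewrite cos_mulr2n -mulr_natr; lra.
rewrite sin_mulr2n -mulr_natr.
have tu : t <= u by rewrite /u; nra.
have : cos u * (u * cos u) <= cos u * sin u by rewrite ler_wpM2l.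
nra.
Qed.

Lemma ex_sub1 y : (dist_to_Z y)%:C%C <= `|ex y - 1|.
Proof.
have -> : `|ex y - 1| = (2 * `|sin (pi * y)|)%:C%C.
  rewrite normc_def /=; congr _%:C%C.
  have -> : (c2 y - 1) ^+ 2 + (s2 y - 0) ^+ 2 = (2 * `|sin (pi * y)|) ^+ 2.
    rewrite exprMn real_normK ?num_real //.
    have : sin (pi * y) ^+ 2 = (1 - c2 y) / 2.
      rewrite /c2 -mulrA mulr_natl cos_mulr2n.
      by have := cos2Dsin2 (pi * y); lra.
    move=> ->; rewrite subr0; have := c2s2 y; nra.
  by rewrite sqrtr_sqr ger0_norm // mulr_ge0.
rewrite lecR; have := sin_pi_dist y; have := normr_ge0 (sin (pi * y)); lra.
Qed.

Lemma ex_eq1 y : ex y = 1 -> exists k : int, y = k%:~R.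
Proof. by move=> [/c2_eq1]. Qed.

Lemma ex_inj_mod x y : ex x = ex y -> exists k : int, x = y + k%:~R.
Proof.
move=> e; have [|k xy] := @ex_eq1 (x - y).
  by rewrite exD exN e mulfV ?ex_neq0.
by exists k; rewrite -xy subrKC.
Qed.

End Turns.

(** * The dual operator *)

Lemma sum_band_split (V : nmodType) (G : nat -> V) (N i S : nat) :
  (N <= i)%N -> (i + N < S)%N ->
  (forall j : nat, (N < `|i - j|)%N -> G j = 0) ->
  \sum_(j < S) G j = G i + \sum_(1 <= l < N.+1) (G (i + l)%N + G (i - l)%N).
Proof.
move=> Ni iS G0; rewrite -(big_mkord xpredT G).
rewrite (@big_cat_nat _ _ _ (i - N)) //=; last by lia.
rewrite big_nat_cond big1 ?add0r; last by move=> j jN; apply: G0; lia.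
rewrite (@big_cat_nat _ _ _ (i + N).+1 (i - N)) //=; last by lia.
rewrite [X in _ + X]big_nat_cond [X in _ + X]big1 ?addr0; last by move=> j jN; apply: G0; lia.
rewrite (@big_cat_nat _ _ _ i (i - N)); [|lia|lia].

rewrite [X in _ + X = _]big_ltn; last by lia.
rewrite addrCA; congr (_ + _); rewrite big_split /= addrC; congr (_ + _).
  rewrite -[i.+1]add1n big_addn -addnS addKn.
  rewrite big_nat_cond [RHS]big_nat_cond.
  by apply: eq_bigr => j _; rewrite addnC.
rewrite -{1}[(i - N)%N]add0n big_addn big_add1 /= big_nat_rev /=.
have -> : (i - (i - N))%N = N by lia.
rewrite big_nat_cond [RHS]big_nat_cond.
by apply: eq_bigr => j jN; congr G; lia.
Qed.

Section TrigPoly.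
Variables (R : realType) (N : nat) (a b : nat -> R) (F : R -> R).
Local Notation C := R[i]%C.
Hypothesis FE : forall x, F x = \sum_(k < N.+1) (a k * cos (2 * pi * k%:R * x)
                           + b k * sin (2 * pi * k%:R * x)).

Definition weight : R := \sum_(k < N.+1) (`|a k| + `|b k|).

(* hatv i j is the Fourier coefficient of F of index i - j. *)
Definition hatv (i j : nat) : C :=
  if i == j then (a 0%N)%:C%C
  else if (j < i)%N then
    if (i - j <= N)%N then (a (i - j)%N / 2 -i* (b (i - j)%N / 2))%C else 0
  else if (j - i <= N)%N then (a (j - i)%N / 2 +i* (b (j - i)%N / 2))%C else 0.

Lemma hatv_shift k i j : hatv (k + i) (k + j) = hatv i j.
Proof. by rewrite /hatv eqn_add2l ltn_add2l !subnDl. Qed.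

Lemma hatv_band (i j : nat) : (N < `|i - j|)%N -> hatv i j = 0.
Proof.
rewrite /hatv; case: (ltngtP i j) => ij h; last by exfalso; lia.
- by rewrite ifN //; lia.
- by rewrite ifN //; lia.
Qed.

Lemma hatv_conj i j : (hatv i j)^* = hatv j i.
Proof.
have cE (z : C) : z^* = conjc z by rewrite /Num.conj /=.
rewrite /hatv cE; case: (ltngtP i j) => ij; try case: ifP => h;
  by rewrite /= ?oppr0 ?opprK.
Qed.

Let g (l : nat) : R := if (l <= N)%N then (if l == 0%N then `|a 0%N| else (`|a l| + `|b l|) / 2) else 0.

Lemma norm_hatv (i j : nat) : `|hatv i j| <= (g `|i - j|%N)%:C%C.
Proof.
have nC (x y : R) : `|(x / 2 +i* (y / 2))%C| <= ((`|x| + `|y|) / 2)%:C%C.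
  rewrite normc_def lecR /=.
  apply: (@le_trans _ _ (Num.sqrt (((`|x| + `|y|) / 2) ^+ 2))).
    rewrite ler_wsqrtr //; rewrite !exprMn -mulrDl ler_wpM2r ?exprn_ge0 ?invr_ge0 //.
    rewrite -(real_normK (num_real x)) -(real_normK (num_real y)) sqrrD.
    have : 0 <= `|x| * `|y| by rewrite mulr_ge0.
    lra.
  by rewrite sqrtr_sqr ger0_norm // divr_ge0 ?addr_ge0.
rewrite /hatv /g; case: (ltngtP i j) => ij.
- have -> : `|i - j|%N = (j - i)%N by lia.
  case: leqP => h; last by rewrite normr0 lecR.
  by rewrite ifN; [exact: nC|lia].
- have -> : `|i - j|%N = (i - j)%N by lia.
  case: leqP => h; last by rewrite normr0 lecR.
  rewrite ifN; last by lia.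
  by rewrite -(normrN (b _)) -mulNr; exact: nC.
by rewrite ij subrr /= normc_def /= expr0n addr0 sqrtr_sqr.
Qed.

(** On the band the factor [mu ^+ |i - j|] is at most [mu ^+ N], and an unweighted row sums to at
    most the total size of the coefficients of [F]. This is the only place where small coupling is
    converted into decay. *)
Lemma hatv_row (mu : R) (i S : nat) : 1 <= mu ->
  \sum_(j < S) `|hatv i j| * (mu%:C%C) ^+ `|i - j|%N <= (mu ^+ N * weight)%:C%C.
Proof.
move=> mu1; have mu0 : 0 <= mu by apply: le_trans mu1.
have g0 l : 0 <= g l.
  by rewrite /g; case: ifP => // _; case: ifP => // _; rewrite divr_ge0 ?addr_ge0.
apply: (@le_trans _ _ (\sum_(j < S) (g `|i - j|%N * mu ^+ N)%:C%C)).
  apply: ler_sum => j _; case: (leqP `|i - j|%N N) => h; last first.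
    by rewrite hatv_band // normr0 mul0r lecR mulr_ge0 ?exprn_ge0.
  rewrite -rmorphXn rmorphM; apply: ler_pM; rewrite ?norm_hatv //.
    by rewrite lecR exprn_ge0.
  by rewrite lecR ler_weXn2l.
rewrite -rmorph_sum lecR -mulr_suml mulrC ler_wpM2l ?exprn_ge0 //.
(* Row and columns are shifted by [N], and columns are added, so that the row contains its whole
   band. *)
apply: (@le_trans _ _ (\sum_(j < S + (i + N) + N + 1) g `|(i + N)%N - j|%N)).
  rewrite -(big_mkord xpredT (fun j => g `|i - j|%N)).
  rewrite -(big_mkord xpredT (fun j => g `|(i + N)%N - j|%N)).
  rewrite [leRHS](@big_cat_nat _ _ _ N) //=; last by lia.
  rewrite ler_wpDl ?sumr_ge0 // (@big_cat_nat _ _ _ (S + N) N) //=; [|by lia|by lia].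
  rewrite ler_wpDr ?sumr_ge0 //.
  rewrite -[X in _ <= \sum_(X <= _ < _) _]add0n big_addn addnK.
  by apply: ler_sum => j _; rewrite distnDr.
rewrite (@sum_band_split _ (fun j => g `|(i + N)%N - j|%N) N (i + N)); first last.
- by move=> j h; rewrite /g leqNgt h.
- by lia.
- by lia.
rewrite distnn /weight big_ord_recl /= lerD //; first by rewrite /g /= lerDl.
rewrite big_add1 /= big_mkord; apply: ler_sum => l _ /=.
have -> : `|(i + N)%N - (i + N + l.+1)%N|%N = l.+1 by lia.
have -> : `|(i + N)%N - (i + N - l.+1)%N|%N = l.+1 by have := ltn_ord l; lia.
rewrite /g ltn_ord /= /bump /= add1n; lra.
Qed.

Lemma trig_poly_conv x (j S : nat) : (N <= j)%N -> (j + N < S)%N ->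
  (F x)%:C%C * ex (j%:R * x) = \sum_(i < S) hatv i j * ex (i%:R * x).
Proof.
move=> Nj jS.
rewrite (@sum_band_split _ (fun i => hatv i j * ex (i%:R * x)) N j) //; last first.
  by move=> i h; rewrite hatv_band ?mul0r // distnC.
rewrite FE big_ord_recl /= rmorphD mulrDl [hatv j j]/hatv eqxx; congr (_ + _).
  by rewrite mulr0 mul0r cos0 sin0 mulr1 mulr0 addr0.
rewrite big_add1 /= big_mkord rmorph_sum mulr_suml; apply: eq_bigr => l _.
rewrite /bump /= add1n.
set k := l.+1.
have kN : (k <= N)%N by rewrite /k ltn_ord.
have jk : (j - k)%:R = j%:R - k%:R :> R by rewrite natrB //; lia.
have -> : hatv (j + k) j = (a k / 2 -i* (b k / 2))%C.
  rewrite /hatv ifN; last by lia.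
  by rewrite ifT; [rewrite addKn kN|lia].
have -> : hatv (j - k) j = (a k / 2 +i* (b k / 2))%C.
  rewrite /hatv ifN; last by lia.
  rewrite ifN; last by lia.
  by have -> : (j - (j - k))%N = k by [lia]; rewrite kN.
rewrite natrD jk (mulrDl j%:R) (mulrBl x j%:R) !exD.
have -> : cos (2 * pi * k%:R * x) = c2 (k%:R * x) by rewrite /c2 !mulrA.
have -> : sin (2 * pi * k%:R * x) = s2 (k%:R * x) by rewrite /s2 !mulrA.
rewrite /ex c2N s2N; apply/eqP; rewrite eq_complex /=.
apply/andP; split; apply/eqP; by field.
Qed.
End TrigPoly.

Section Norms.
Variable R : realType.
Local Notation C := R[i]%C.

Definition nsq (z : C) : R := complex.Re z ^+ 2 + complex.Im z ^+ 2.

Lemma nsqE z : (nsq z)%:C%C = `|z| ^+ 2.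
Proof. exact: add_Re2_Im2. Qed.

Lemma nsq_ge0 z : 0 <= nsq z.
Proof. by rewrite addr_ge0 ?sqr_ge0. Qed.

Lemma nsqM z w : nsq (z * w) = nsq z * nsq w.
Proof. by apply: (@complexI R); rewrite rmorphM /= !nsqE normrM exprMn. Qed.

Lemma nsq_ex x : nsq (ex x) = 1.
Proof. exact: c2s2. Qed.

Lemma Re_le_norm z (c : R) : `|z| <= c%:C%C -> `|complex.Re z| <= c.
Proof. by move=> /(le_trans (normc_ge_Re z)); rewrite lecR. Qed.

Lemma Im_le_norm z (c : R) : `|z| <= c%:C%C -> `|complex.Im z| <= c.
Proof.
rewrite normc_def lecR; apply: le_trans.
by rewrite -sqrtr_sqr ler_wsqrtr // lerDr sqr_ge0.
Qed.

Lemma norm_bound (z : C) : exists2 c : R, 0 <= c & `|z| <= c%:C%C.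
Proof. by exists (Num.sqrt (nsq z)); rewrite ?sqrtr_ge0 // normc_def. Qed.

Lemma norm_le_nsq (z : C) (c : R) : 0 <= c -> nsq z <= c ^+ 2 -> `|z| <= c%:C%C.
Proof.
move=> c0 h; rewrite normc_def lecR -/(nsq z) -[leRHS](ger0_norm c0) -sqrtr_sqr.
exact: ler_wsqrtr.
Qed.

Lemma nsq_le_norm (z : C) (c : R) : `|z| <= c%:C%C -> nsq z <= c ^+ 2.
Proof.
move=> h; rewrite -lecR nsqE rmorphXn lerXn2r ?nnegrE //.
exact: le_trans h.
Qed.
End Norms.

(* Lower bound dl for H_x - E on finitely supported sequences, uniformly in x. *)
Definition lower_bounded (R : realType) (F : R -> R) (alpha E dl : R) : Prop :=
  forall (x : R) (n : nat) (u : nat -> R), u 0%N = 0 ->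
    (forall i, (n <= i.+1)%N -> u i = 0) ->
    dl ^+ 2 * (\sum_(i < n) u i ^+ 2)
      <= \sum_(i < n) (u i.+1 + u i.-1 + (F (x + i%:R * alpha) - E) * u i) ^+ 2.

(** Cutting a bounded sequence to [1..M] disturbs its equation only at the sites 0, 1, [M] and
    [M + 1], at a cost independent of [M] that disappears in averages: [B^2] at each outer site and
    [4 B^2] for each inner one. *)
Lemma lower_bounded_cut (R : realType) (F : R -> R) (alpha E dl B : R)
    (y p : nat -> R) (M : nat) :
  lower_bounded F alpha E dl -> (0 < M)%N ->
  (forall n, y n.+2 + y n + (F (n.+1%:R * alpha) - E) * y n.+1 = p n.+1) ->
  (forall n, `|y n| <= B) -> (forall n, `|p n| <= B) ->
  dl ^+ 2 * (\sum_(n < M) y n.+1 ^+ 2)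
    <= \sum_(n < M) p n.+1 ^+ 2 + 10 * B ^+ 2.
Proof.
move=> lb M0 yp yB pB.
pose u n : R := if (0 < n <= M)%N then y n else 0.
have := lb 0 M.+2 u; rewrite {1}/u /= => /(_ erefl).
have uout i : (M.+2 <= i.+1)%N -> u i = 0.
  by move=> iM; rewrite /u ifN //; lia.
move=> /(_ uout).
have -> : \sum_(i < M.+2) u i ^+ 2 = \sum_(n < M) y n.+1 ^+ 2.
  rewrite -(big_mkord xpredT (fun i => u i ^+ 2)) big_nat_recl // big_nat_recr //=.
  rewrite (uout M.+1) // /u /= expr0n add0r addr0 big_mkord.
  by apply: eq_bigr => i _; rewrite ltn_ord.
move=> h; apply: le_trans h _.
pose G i := (u i.+1 + u i.-1 + (F (0 + i%:R * alpha) - E) * u i) ^+ 2.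
rewrite -(big_mkord xpredT G) big_nat_recl // big_nat_recr //= big_mkord.
have B0 : 0 <= B by apply: le_trans (yB 0%N).
have sqB z : `|z| <= B -> z ^+ 2 <= B ^+ 2.
  by move=> zB; rewrite -real_normK ?num_real // lerXn2r ?nnegrE.
have u0 : u 0%N = 0 by [].
have e0 : G 0%N <= B ^+ 2.
  rewrite /G /= u0 mulr0 !addr0; apply: sqB.
  by rewrite /u; case: ifP => _ //; rewrite normr0.
have e1 : G M.+1 <= B ^+ 2.
  rewrite /G /= [u M.+2]uout ?[u M.+1]uout // mulr0 addr0 add0r; apply: sqB.
  by rewrite /u; case: ifP => _ //; rewrite normr0.
have em : \sum_(i < M) G i.+1 <= \sum_(i < M) (p i.+1 ^+ 2 + 4 * B ^+ 2 * ((i == 0%N :> nat)%:R + (i.+1 == M)%:R)).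
  apply: ler_sum => i _; rewrite /G /= add0r.
  have iM := ltn_ord i.
  have -> : u i.+1 = y i.+1 by rewrite /u /= iM.
  have -> : u i.+2 = y i.+2 - (i.+1 == M)%:R * y i.+2.
    rewrite /u /=; case: eqP => [e|ne]; first by rewrite ifN ?mul1r ?subrr //; lia.
    by rewrite ifT ?mul0r ?subr0 //; lia.
  have -> : u i = y i - (i == 0%N :> nat)%:R * y i.
    rewrite /u; case: eqP => [->|ne]; first by rewrite /= mul1r subrr.
    by rewrite ifT ?mul0r ?subr0 //; lia.
  set s := (i.+1 == M); set t := (i == 0%N :> nat).
  have -> : y i.+2 - s%:R * y i.+2 + (y i - t%:R * y i) + (F (i.+1%:R * alpha) - E) * y i.+1
          = p i.+1 - s%:R * y i.+2 - t%:R * y i by rewrite -yp; ring.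
  have := yB i.+2; have := yB i; have := pB i.+1.
  rewrite !ler_norml => /andP[p1 p2] /andP[y1 y2] /andP[z1 z2].
  case: s; case: t => /=; rewrite ?mul1r ?mul0r ?subr0 ?addr0 ?add0r ?mulr1; nra.
have es : \sum_(i < M) (p i.+1 ^+ 2 + 4 * B ^+ 2 * ((i == 0%N :> nat)%:R + (i.+1 == M)%:R))
   = \sum_(n < M) p n.+1 ^+ 2 + 8 * B ^+ 2.
  rewrite big_split /=; congr (_ + _); rewrite -mulr_sumr big_split /=.
  case: (M) M0 => // m _.
  have -> : \sum_(i < m.+1) (i == 0%N :> nat)%:R = 1 :> R.
    by rewrite big_ord_recl /= big1 ?addr0.
  have -> : \sum_(i < m.+1) (i.+1 == m.+1)%:R = 1 :> R.
    rewrite big_ord_recr /= eqxx big1 ?add0r // => i _.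
    by rewrite eqSS ltn_eqF.
  ring.
rewrite es in em; lra.
Qed.

Lemma ex_irrational_neq (R : realType) (alpha : R) (i j : nat) :
  irrational alpha -> i != j -> ex (i%:R * alpha) != ex (j%:R * alpha).
Proof.
move=> aI; wlog ij : i j / (i < j)%N.
  move=> W ij; have : (i < j)%N || (j < i)%N by rewrite -neq_ltn.
  by case/orP => h; [exact: W|rewrite eq_sym; apply: W; rewrite // eq_sym].
move=> _; apply/eqP => e.
have := ex_sub1 ((j - i)%:R * alpha).
have -> : (j - i)%:R * alpha = j%:R * alpha - i%:R * alpha.
  by rewrite natrB ?(ltnW ij) // mulrBl.
rewrite exD exN e mulfV ?ex_neq0 // subrr normr0 lecR => h.
have := @dist_to_Z_irr _ alpha (j - i) aI; rewrite subn_gt0 ij => /(_ isT).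
rewrite natrB ?(ltnW ij) // mulrBl ltNge; apply/negP.
by rewrite negbK.
Qed.

Lemma norm_geometric_le (C : numFieldType) (z : C) (M : nat) : `|z| = 1 -> z != 1 ->
  `|\sum_(n < M) z ^+ n.+1| <= 2 / `|z - 1|.
Proof.
move=> z1 zn1; have z0 : 0 < `|z - 1| by rewrite normr_gt0 subr_eq0.
rewrite ler_pdivlMr // -normrM mulrC.
have -> : (z - 1) * (\sum_(n < M) z ^+ n.+1) = z ^+ M.+1 - z.
  rewrite (eq_bigr (fun n : 'I_M => z * z ^+ n)); last by move=> n _; rewrite exprS.
  by rewrite -mulr_sumr mulrCA -subrX1 mulrBr mulr1 exprS.
apply: le_trans (ler_normB _ _) _.
by rewrite normrX z1 expr1n.
Qed.

Definition fourier (R : realType) (S : nat) (u : nat -> R[i]%C) (x : R) : R[i]%C :=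
  \sum_(i < S) u i * ex (i%:R * x).

Lemma fourier_bound (R : realType) (S : nat) (u : nat -> R[i]%C) :
  exists2 B : R, 0 <= B & forall x, `|fourier S u x| <= B%:C%C.
Proof.
have [B B0 BP] := norm_bound (\sum_(i < S) `|u i|).
rewrite ger0_norm ?sumr_ge0 // in BP.
exists B => // x; apply: le_trans BP; rewrite /fourier.
apply: le_trans (ler_norm_sum _ _ _) _; apply: ler_sum => i _.
by rewrite normrM norm_ex mulr1.
Qed.

(** Parseval's identity along the orbit, with an error bounded in [M]: each off-diagonal term is a
    geometric sum whose ratio differs from 1 by irrationality. *)
Lemma fourier_orbit_mean (R : realType) (alpha : R) (S : nat) (u : nat -> R[i]%C) :
  irrational alpha ->
  exists c : R, forall M, `|\sum_(n < M) nsq (fourier S u (n.+1%:R * alpha))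
     - M%:R * (\sum_(i < S) nsq (u i))| <= c.
Proof.
move=> aI.
pose z i j : R[i]%C := ex (i%:R * alpha) * (ex (j%:R * alpha))^-1.
pose T := \sum_(i < S) \sum_(j < S | j != i) `|u i| * `|u j| * (2 / `|z i j - 1|).
have T0 : 0 <= T.
  by apply: sumr_ge0 => i _; apply: sumr_ge0 => j _; rewrite !mulr_ge0 ?divr_ge0.
have [c c0 cT] := norm_bound T; rewrite ger0_norm // in cT.
exists c => M.
have conjE (w : R[i]%C) : (nsq w)%:C%C = w * w^* by rewrite nsqE normCK.
have z1 i j : `|z i j| = 1 by rewrite normrM normfV !norm_ex invr1 mulr1.
have zn1 i j : i != j -> z i j != 1.
  move=> ij; apply: contraNN (ex_irrational_neq aI ij) => /eqP e; apply/eqP.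
  by rewrite -[LHS](mulfVK (ex_neq0 (j%:R * alpha))) -/(z i j) e mul1r.
have zn i j (n : nat) : ex (i%:R * (n%:R * alpha)) * (ex (j%:R * (n%:R * alpha)))^*
    = z i j ^+ n.
  by rewrite !(mulrCA _ n%:R) ex_conj exN !(exX n) exprMn exprVn.
suff h : `|(\sum_(n < M) nsq (fourier S u (n.+1%:R * alpha))
     - M%:R * (\sum_(i < S) nsq (u i)))%:C%C| <= c%:C%C.
  by have := @Re_le_norm R _ _ h.
apply: le_trans cT.
have -> : (\sum_(n < M) nsq (fourier S u (n.+1%:R * alpha))
     - M%:R * (\sum_(i < S) nsq (u i)))%:C%C =
   \sum_(i < S) \sum_(j < S | j != i) u i * (u j)^* * (\sum_(n < M) z i j ^+ n.+1).
  rewrite rmorphB rmorphM rmorph_nat !rmorph_sum /=.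
  have -> : \sum_(n < M) (nsq (fourier S u (n.+1%:R * alpha)))%:C%C
     = \sum_(i < S) \sum_(j < S) u i * (u j)^* * (\sum_(n < M) z i j ^+ n.+1).
    under [RHS]eq_bigr => i _ do under eq_bigr => j _ do rewrite mulr_sumr.
    under [RHS]eq_bigr => i _ do rewrite exchange_big /=.
    rewrite [RHS]exchange_big /=; apply: eq_bigr => n _.
    rewrite conjE /fourier rmorph_sum mulr_suml; apply: eq_bigr => i _.
    rewrite mulr_sumr; apply: eq_bigr => j _.
    by rewrite rmorphM -zn; ring.
  rewrite mulr_sumr -sumrB; apply: eq_bigr => i _.
  rewrite (bigD1 i) //= addrAC [X in X + _](_ : _ = 0) ?add0r //.
  rewrite conjE (eq_bigr (fun=> 1)); last first.
    by move=> n _; rewrite /z mulfV ?ex_neq0 // expr1n.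
  by rewrite sumr_const card_ord -[1 *+ M]/(M%:R) mulrC subrr.
apply: le_trans (ler_norm_sum _ _ _) _; apply: ler_sum => i _.
apply: le_trans (ler_norm_sum _ _ _) _; apply: ler_sum => j ji.
rewrite !normrM norm_conjC ler_wpM2l ?mulr_ge0 //.
by apply: norm_geometric_le => //; apply: zn1; rewrite eq_sym.
Qed.

Section Dual.
Variables (R : realType) (N : nat) (a b : nat -> R) (F : R -> R).
Local Notation C := R[i]%C.
Hypothesis FE : forall x, F x = \sum_(k < N.+1) (a k * cos (2 * pi * k%:R * x)
                           + b k * sin (2 * pi * k%:R * x)).
Variables (alpha E : R).

Definition dual (phi : R) : nat -> nat -> C :=
  band_kernel (a 0%N - E)%:C%C (ex phi) (ex alpha) (hatv N a b).

Lemma dual_sum phi (S i : nat) (u : nat -> C) : (i < S)%N ->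
  \sum_(j < S) dual phi i j * u j
  = (ex (phi + i%:R * alpha) + ex (- (phi + i%:R * alpha)) - E%:C%C) * u i
    + \sum_(j < S) hatv N a b i j * u j.
Proof.
move=> iS; rewrite (bigD1 (Ordinal iS)) //= [in RHS](bigD1 (Ordinal iS)) //= addrA.
congr (_ + _); last first.
  apply: eq_bigr => j; rewrite -val_eqE /= eq_sym => /negbTE ij.
  by rewrite /dual /band_kernel ij.
by rewrite /dual /band_kernel /hatv eqxx rmorphB exN exD exX; ring.
Qed.

(** Aubry duality: under Fourier series shifts become the cosine diagonal, and multiplication by [F]
    becomes the Toeplitz part. The support condition keeps a margin [N], so that no coefficient of
    the product leaves [0..S-1]. *)
Lemma dual_fourier phi (S : nat) (u : nat -> C) x :
  (forall i, ~~ ((N <= i) && (i + N < S))%N -> u i = 0) ->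
  ex phi * fourier S u (x + alpha) + ex (- phi) * fourier S u (x - alpha)
    + (F x - E)%:C%C * fourier S u x
  = fourier S (fun i => \sum_(j < S) dual phi i j * u j) x.
Proof.
move=> u0; rewrite /fourier.
under [RHS]eq_bigr => i _ do rewrite dual_sum ?ltn_ord // mulrDl.
rewrite [RHS]big_split /=.
have -> : \sum_(i < S) (\sum_(j < S) hatv N a b i j * u j) * ex (i%:R * x)
   = (F x)%:C%C * (\sum_(j < S) u j * ex (j%:R * x)).
  under eq_bigr => i _ do rewrite mulr_suml.
  rewrite exchange_big /= mulr_sumr; apply: eq_bigr => j _.
  have [/andP[jN jS]|/u0 ->] := boolP ((N <= j) && (j + N < S))%N; last first.
    by rewrite big1 ?mul0r ?mulr0 // => i _; rewrite mulr0 mul0r.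
  rewrite mulrCA (trig_poly_conv FE x jN jS) mulr_sumr.
  by apply: eq_bigr => i _; ring.
rewrite rmorphB mulrBl [_ - E%:C%C * _]addrC addrA; congr (_ + _).
rewrite !mulr_sumr -sumrN -!big_split /=; apply: eq_bigr => i _.
rewrite !mulrDr mulrN [ex (phi + _)]exD opprD [ex (- phi - _)]exD !exD; ring.
Qed.

(** Sampled at [n * alpha] and twisted by [ex (n * phi)], the Fourier series of [u] is a bounded
    sequence to which the bound for [H_0 - E] applies after cutting, in its real and imaginary
    parts. Dividing by the length of the orbit leaves the two sums of squares, by Parseval. *)
Lemma dual_lower_bound (dl : R) : irrational alpha ->
  lower_bounded F alpha E dl ->
  forall (phi : R) (S : nat) (u : nat -> C),
  (forall i, ~~ ((N <= i) && (i + N < S))%N -> u i = 0) ->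
  dl ^+ 2 * (\sum_(i < S) nsq (u i))
    <= \sum_(i < S) nsq (\sum_(j < S) dual phi i j * u j).
Proof.
move=> aI lb phi S u u0.
pose v i := \sum_(j < S) dual phi i j * u j.
have [B1 B10 B1P] := fourier_bound S u.
have [B2 B20 B2P] := fourier_bound S v.
pose B := B1 + B2.
pose U (n : nat) := ex (n%:R * phi) * fourier S u (n%:R * alpha).
pose P (n : nat) := ex (n%:R * phi) * fourier S v (n%:R * alpha).
have UP n : U n.+2 + U n + (F (n.+1%:R * alpha) - E)%:C%C * U n.+1 = P n.+1.
  rewrite /P -(dual_fourier phi (n.+1%:R * alpha) u0) /U.
  have -> : n.+2%:R * alpha = n.+1%:R * alpha + alpha by rewrite -natr1 mulrDl mul1r.
  have -> : n.+2%:R * phi = n.+1%:R * phi + phi by rewrite -natr1 mulrDl mul1r.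
  have -> : n%:R * alpha = n.+1%:R * alpha - alpha by rewrite -[in RHS]natr1; ring.
  have -> : n%:R * phi = n.+1%:R * phi - phi by rewrite -[in RHS]natr1; ring.
  rewrite !exD; ring.
have UB n : `|U n| <= B%:C%C.
  by rewrite normrM norm_ex mul1r (le_trans (B1P _)) // lecR lerDl.
have PB n : `|P n| <= B%:C%C.
  by rewrite normrM norm_ex mul1r (le_trans (B2P _)) // lecR lerDr.
have main M : (0 < M)%N ->
   dl ^+ 2 * (\sum_(n < M) nsq (U n.+1)) <= \sum_(n < M) nsq (P n.+1) + 20 * B ^+ 2.
  move=> M0.
  have rc (x : R) (w : C) : complex.Re (x%:C%C * w) = x * complex.Re w.
    by case: w => p q /=; rewrite mul0r subr0.
  have ic (x : R) (w : C) : complex.Im (x%:C%C * w) = x * complex.Im w.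
    by case: w => p q /=; rewrite mul0r addr0.
  have rd (w w' : C) : complex.Re (w + w') = complex.Re w + complex.Re w' by case: w; case: w'.
  have idd (w w' : C) : complex.Im (w + w') = complex.Im w + complex.Im w' by case: w; case: w'.
  have hr := @lower_bounded_cut R F alpha E dl B (fun n => complex.Re (U n))
     (fun n => complex.Re (P n)) M lb M0.
  have hi := @lower_bounded_cut R F alpha E dl B (fun n => complex.Im (U n))
     (fun n => complex.Im (P n)) M lb M0.
  have {}hr := hr (fun n => etrans (esym (etrans (rd _ _) (f_equal2 _ (rd _ _) (rc _ _)))) (f_equal (@complex.Re R) (UP n)))
     (fun n => Re_le_norm (UB n)) (fun n => Re_le_norm (PB n)).
  have {}hi := hi (fun n => etrans (esym (etrans (idd _ _) (f_equal2 _ (idd _ _) (ic _ _)))) (f_equal (@complex.Im R) (UP n)))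
     (fun n => Im_le_norm (UB n)) (fun n => Im_le_norm (PB n)).
  rewrite /nsq !big_split /= mulrDr; lra.
have [c1 c1P] := fourier_orbit_mean S u aI.
have [c2 c2P] := fourier_orbit_mean S v aI.
set X := \sum_(i < S) nsq (u i) in c1P *; set Y := \sum_(i < S) nsq _ in c2P *.
rewrite leNgt; apply/negP => lt.
pose gap := dl ^+ 2 * X - Y.
have gap0 : 0 < gap by rewrite subr_gt0.
(* All errors bounded in [M]: two cuts, for real and imaginary parts, and two Parseval errors. A
   violation [gap] would accumulate to [M * gap]. *)
pose K := 20 * B ^+ 2 + c2 + dl ^+ 2 * c1.
pose M := (Num.bound (`|K| / gap)).+1.
have := main M isT.
have eU : \sum_(n < M) nsq (U n.+1) = \sum_(n < M) nsq (fourier S u (n.+1%:R * alpha)).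
  by apply: eq_bigr => n _; rewrite nsqM nsq_ex mul1r.
have eP : \sum_(n < M) nsq (P n.+1) = \sum_(n < M) nsq (fourier S v (n.+1%:R * alpha)).
  by apply: eq_bigr => n _; rewrite nsqM nsq_ex mul1r.
rewrite eU eP => h.
have := c1P M; have := c2P M; rewrite -/v -/Y !ler_norml => /andP[_ h2] /andP[h1 _].
have KM : K < M%:R * gap.
  rewrite -ltr_pdivrMr // (le_lt_trans (y := `|K| / gap)) //.
    by rewrite ler_wpM2r ?invr_ge0 ?(ltW gap0) // ler_norm.
  apply: lt_le_trans (archi_boundP _) _; first by rewrite divr_ge0 // ltW.
  by rewrite ler_nat /M.
have d0 : 0 <= dl ^+ 2 by rewrite sqr_ge0.
have h1' : dl ^+ 2 * (M%:R * X - c1) <= dl ^+ 2 * \sum_(n < M) nsq (fourier S u (n.+1%:R * alpha)).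
  by rewrite ler_wpM2l //; lra.
move: KM h h1' h2; rewrite /K /gap; lra.
Qed.
End Dual.

(** * Approximate inverses of the dual operator *)

Section DualInverse.
Variables (R : realType) (N : nat) (a b : nat -> R) (F : R -> R).
Local Notation C := R[i]%C.
Hypothesis FE : forall x, F x = \sum_(k < N.+1) (a k * cos (2 * pi * k%:R * x)
                           + b k * sin (2 * pi * k%:R * x)).
Variables (alpha E dl mu : R).
Hypotheses (aI : irrational alpha) (dl0 : 0 < dl) (mu1 : 1 <= mu) (E3 : `|E| <= 3).
Hypothesis small : mu ^+ N * weight N a b <= 1.
Hypothesis lb : lower_bounded F alpha E dl.
Variable phi : R.

Local Notation K := (dual N a b alpha E phi).

Lemma dual_offdiag (i j : nat) : i != j -> K i j = hatv N a b i j.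
Proof. by rewrite /dual /band_kernel => /negbTE ->. Qed.

Lemma dual_diag (i : nat) :
  K i i = (ex (phi + i%:R * alpha) + ex (- (phi + i%:R * alpha)) - E%:C%C)
          + hatv N a b i i.
Proof. by rewrite /dual /band_kernel /hatv eqxx rmorphB exN exD exX; ring. Qed.

Lemma dual_band (i j : nat) : (N < `|i - j|)%N -> K i j = 0.
Proof.
move=> h; rewrite dual_offdiag ?hatv_band //.
by apply/eqP => e; move: h; rewrite e distnn.
Qed.

Lemma dual_hermitian (i j : nat) : (K i j)^* = K j i.
Proof.
have cE (z : C) : z^* = conjc z by rewrite /Num.conj /=.
have [<-|ij] := eqVneq i j; last by rewrite !dual_offdiag ?hatv_conj // eq_sym.
rewrite dual_diag !rmorphD rmorphN /= !ex_conj hatv_conj opprK.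
rewrite [ex (- _) + _]addrC; congr (_ + _ - _ + _).
by rewrite cE conjc_real.
Qed.

Lemma hatv_row1 (i S : nat) : \sum_(j < S) `|hatv N a b i j| * (mu%:C%C) ^+ `|i - j|%N <= 1.
Proof.
apply: le_trans (hatv_row N a b i S mu1) _.
by rewrite -[1]/((1 : R)%:C%C) lecR.
Qed.

Lemma muC1 : 1 <= mu%:C%C.
Proof. by rewrite -[1]/((1 : R)%:C%C) lecR. Qed.

Lemma hatv_sum1 (i S : nat) : \sum_(j < S) `|hatv N a b i j| <= 1.
Proof.
apply: le_trans (hatv_row1 i S); apply: ler_sum => j _.
by rewrite ler_peMr // exprn_ege1 // muC1.
Qed.

(** The 6 is 2 for the cosine, 3 for the energy and 1 for the whole potential part. *)
Lemma dual_row6 (i S : nat) : \sum_(j < S) `|K i j| * (mu%:C%C) ^+ `|i - j|%N <= 6.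
Proof.
have mu0 : 0 <= mu%:C%C by apply: le_trans muC1.
apply: (@le_trans _ _ (\sum_(j < S) ((i == j)%:R * 5 + `|hatv N a b i j| * (mu%:C%C) ^+ `|i - j|%N))).
  apply: ler_sum => j _; have [ij|ij] := eqVneq i j; last by rewrite mul0r add0r dual_offdiag.
  rewrite -ij distnn expr0 !mulr1 mul1r dual_diag.
  apply: le_trans (ler_normD _ _) _; rewrite lerD2r.
  apply: le_trans (ler_normB _ _) _.
  apply: (@le_trans _ _ (2 + 3)); last by rewrite -natrD ler_nat.
  apply: lerD.
    by apply: le_trans (ler_normD _ _) _; rewrite !norm_ex.
  rewrite normc_def /= expr0n addr0 sqrtr_sqr.
  by have -> : 3 = (3%:R : R)%:C%C by [rewrite rmorph_nat]; rewrite lecR.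
rewrite big_split /=; apply: (@le_trans _ _ (5 + 1)); last by rewrite natr1 lexx.
apply: lerD; last exact: hatv_row1.
rewrite -mulr_suml ler_piMl //.
have [iS|iS] := ltnP i S.
  rewrite (bigD1 (Ordinal iS)) //= eqxx big1 ?addr0 // => j.
  by rewrite -val_eqE /= eq_sym => /negbTE ->.
by rewrite big1 // => j _; rewrite gtn_eqF // (leq_trans (ltn_ord j)).
Qed.

Variable h : nat.
Hypotheses (h0 : (0 < h)%N) (Nh : (N <= h)%N).
Local Notation o := (12 * h + N)%N.
Local Notation S := (24 * h + 1 + 2 * N)%N.
Variable eps : R.
Hypothesis epsP : (4 * h)%:R * (4 * h * 2).+1%:R * 6 ^+ (4 * h).+1
  <= eps * (\prod_(1 <= l < (4 * h * 2).+1) dist_to_Z (l%:R * alpha)) ^+ 2 * mu ^+ (h - N).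

Let P := \prod_(1 <= l < (4 * h * 2).+1) dist_to_Z (l%:R * alpha).

Lemma P_gt0 : 0 < P.
Proof.
by rewrite /P big_nat_cond prodr_gt0 // => l /andP[/andP[l0 _] _]; rewrite dist_to_Z_irr.
Qed.

(** A stretch of [12h] equations holds the [8h + 1] translates of a box of [4h] sites that
    interpolation needs. One of them has a determinant that is not too small, and [r] then decays
    into its middle half; [epsP] is this comparison. *)
Lemma good_window (j0 : nat) (r : nat -> C) :
  (j0 + 12 * h <= S)%N ->
  (forall i, `|r i| <= 1) ->
  (forall i, (j0 <= i < j0 + 12 * h)%N -> \sum_(j < S) K i j * r j = 0) ->
  exists2 j, (j0 <= j <= j0 + 8 * h)%N &
    forall y, (h <= y <= 3 * h)%N -> `|r (j + y)%N| <= eps%:C%C.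
Proof.
move=> jS r1 Kr0.
have [|j jj det] := @box_det_lower C (a 0%N - E)%:C%C (ex phi) (ex alpha) (hatv N a b)
   (norm_ex _) (norm_ex _) (hatv_shift N a b) (4 * h) j0
   (fun l => (dist_to_Z (l%:R * alpha))%:C%C).
  move=> l /andP[l0 _]; rewrite -exX ex_sub1; split => //; apply/andP; split.
    have : (0 : R)%:C%C < (dist_to_Z (l%:R * alpha))%:C%C by rewrite ltcR dist_to_Z_irr.
    by [].
  have : (dist_to_Z (l%:R * alpha))%:C%C <= (1 : R)%:C%C.
    by rewrite lecR; apply: le_trans (dist_to_Z_le_half _) _; lra.
  by [].
exists j; first by move: jj; clear; lia.
move=> y yh.
have yk : (y < 4 * h)%N by move: yh h0; clear; lia.
have jk : (j + 4 * h <= S)%N by lia.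
have a1 : (1 : C) <= 6 by rewrite (ler_nat _ 1).
have dec := @box_decay C K r S N h j y mu%:C%C 6 Nh jk yh yk muC1 a1 dual_band
   (fun i => dual_row6 i S) r1.
have {}dec := dec (fun i ij => Kr0 i ltac:(move: ij jj; clear; lia)).
rewrite -rmorph_prod -/P in det.
set D := `|\det _| in det dec.
have P0 := P_gt0.
have m0 : 0 < mu ^+ (h - N) by rewrite exprn_gt0 // (lt_le_trans _ mu1).
have [c c0 rc] : exists2 c : R, 0 <= c & `|r (j + y)%N| = c%:C%C.
  by exists (Num.sqrt (nsq (r (j + y)%N))); rewrite ?sqrtr_ge0 // normc_def.
have [d d0 Dd] : exists2 d : R, 0 <= d & D = d%:C%C.
  by exists (Num.sqrt (nsq (\det (box (a 0%N - E)%:C%C (ex phi) (ex alpha) (hatv N a b) (4 * h) j))));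
    rewrite ?sqrtr_ge0 // /D normc_def.
have {}dec : d * c * mu ^+ (h - N) <= (4 * h)%:R * 6 ^+ (4 * h).+1.
  by move: dec; rewrite -lecR !rmorphM !rmorphXn !rmorph_nat rc Dd.
have {}det : P ^+ 2 <= (4 * h * 2).+1%:R * d.
  by move: det; rewrite -lecR rmorphXn rmorphM rmorph_nat Dd.
rewrite rc lecR.
have kp : 0 < (4 * h * 2).+1%:R :> R by rewrite ltr0n.
rewrite -(ler_pM2r (x := P ^+ 2 * mu ^+ (h - N))); last by rewrite mulr_gt0 // exprn_gt0.
rewrite [leRHS]mulrA; apply: le_trans epsP.
apply: (@le_trans _ _ ((4 * h * 2).+1%:R * (d * c * mu ^+ (h - N)))).
  have -> : c * (P ^+ 2 * mu ^+ (h - N)) = P ^+ 2 * (c * mu ^+ (h - N)) by ring.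
  have -> : (4 * h * 2).+1%:R * (d * c * mu ^+ (h - N)) = ((4 * h * 2).+1%:R * d) * (c * mu ^+ (h - N)) by ring.
  by rewrite ler_wpM2r // mulr_ge0 // ltW.
have -> : (4 * h)%:R * (4 * h * 2).+1%:R * 6 ^+ (4 * h).+1 = (4 * h * 2).+1%:R * ((4 * h)%:R * 6 ^+ (4 * h).+1) :> R by ring.
by rewrite ler_wpM2l // ltW.
Qed.

(** There is a good window on each side of the centre [o]. The vector [r], cut in the middle of
    both, is a test vector for the lower bound: cutting creates errors only within [N <= h] of the
    cuts, where [r] is at most [eps]. *)
Lemma homogeneous_center_small (r : nat -> C) :
  (forall i, `|r i| <= 1) ->
  (forall i, (N <= i < S - N)%N -> \sum_(j < S) K i j * r j = 0) ->
  dl ^+ 2 * nsq (r o) <= S%:R * eps ^+ 2.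
Proof.
move=> r1 Kr0.
have [||jl jlP rl] := @good_window N r _ r1; first by lia.
  by move=> i ij; apply: Kr0; lia.
have [||jr jrP rr] := @good_window o.+1 r _ r1; first by lia.
  by move=> i ij; apply: Kr0; lia.
(* The windows are [h..3h] from [jl] and [jr], so each cut keeps a margin [h] inside its window; [o]
   lies between the cuts since [jl <= N + 8h] and [o < jr]. *)
pose inn (i : nat) := (jl + 2 * h <= i < jr + 2 * h)%N.
pose r' i : C := if inn i then r i else 0.
have eps0 : 0 <= eps%:C%C by apply: le_trans (rl h _); rewrite ?leqnn //; lia.
have offsmall (Q : pred nat) (i : nat) :
   (forall j : nat, Q j -> (`|i - j| <= N)%N -> i != j /\ `|r j| <= eps%:C%C) ->
   `|\sum_(j < S | Q j) K i j * r j| <= eps%:C%C.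
  move=> QP; apply: le_trans (ler_norm_sum _ _ _) _.
  apply: (@le_trans _ _ (\sum_(j < S) `|hatv N a b i j| * eps%:C%C)); last first.
    by rewrite -mulr_suml ler_piMl // hatv_sum1.
  rewrite [leRHS](bigID (fun j : 'I_S => Q j)) /= ler_wpDr //.
    by apply: sumr_ge0 => j _; rewrite mulr_ge0.
  apply: ler_sum => j Qj; rewrite normrM.
  case: (leqP `|i - j|%N N) => d; last by rewrite dual_band // normr0 mul0r mulr_ge0.
  by have [ij rj] := QP j Qj d; rewrite dual_offdiag // ler_wpM2l.
have win (i : nat) : (jl + h <= i <= jl + 3 * h)%N || (jr + h <= i <= jr + 3 * h)%N -> `|r i| <= eps%:C%C.
  case/orP => ii.
    by have := rl (i - jl)%N ltac:(move: ii; clear; lia); rewrite subnKC //; move: ii; clear; lia.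
  by have := rr (i - jr)%N ltac:(move: ii; clear; lia); rewrite subnKC //; move: ii; clear; lia.
have Kr' (i : nat) : `|\sum_(j < S) K i j * r' j| <= eps%:C%C.
  have -> : \sum_(j < S) K i j * r' j = \sum_(j < S | inn j) K i j * r j.
    rewrite [RHS]big_mkcond; apply: eq_bigr => j _.
    by rewrite /r'; case: ifP => // _; rewrite mulr0.
  case: (boolP (inn i)) => ii; last first.
    apply: (offsmall inn) => j jj dij; split; first by apply: contraNneq ii => ->.
    by apply: win; move: ii jj; rewrite /inn; lia.
  have := Kr0 i; rewrite (bigID (fun j : 'I_S => inn j)) /= => e.
  have {}e := e ltac:(move: ii; rewrite /inn; lia).
  move/eqP: e; rewrite addr_eq0 => /eqP ->; rewrite normrN.
  apply: (offsmall (fun j => ~~ inn j)) => j jj dij; split.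
    by apply: contraNneq jj => <-.
  by apply: win; move: ii jj; rewrite /inn; lia.
have r'0 i : ~~ ((N <= i) && (i + N < S))%N -> r' i = 0.
  by move=> ni; rewrite /r' ifN // /inn; lia.
have := dual_lower_bound FE aI lb phi r'0 => H.
apply: (@le_trans _ _ (dl ^+ 2 * \sum_(i < S) nsq (r' i))).
  rewrite ler_wpM2l ?sqr_ge0 //.
  have oS : (o < S)%N by clear; lia.
  rewrite (bigD1 (Ordinal oS)) //= {1}/r' ifT; last by rewrite /inn; lia.
  by rewrite lerDl sumr_ge0 // => i _; apply: nsq_ge0.
apply: le_trans H _.
apply: (@le_trans _ _ (\sum_(i < S) eps ^+ 2)).
  by apply: ler_sum => i _; apply: nsq_le_norm; apply: Kr'.
by rewrite sumr_const card_ord mulr_natl.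
Qed.

(** The solution is sought on the inner sites and tested on all [S] sites, so that the lower bound
    gives injectivity. The residual is orthogonal to the columns, hence in the kernel of the inner
    rows by hermitian symmetry, and the previous lemma bounds it at the source. *)
Lemma dual_approx_inverse (tau : R) : 0 <= tau -> S%:R * eps ^+ 2 <= dl ^+ 2 * tau ^+ 4 ->
  exists w : nat -> C,
  [/\ forall i, ~~ ((N <= i) && (i + N < S))%N -> w i = 0,
      forall i, nsq (w i) <= (2 / dl) ^+ 2 &
      \sum_(i < S) nsq (\sum_(j < S) K i j * w j - (i == o :> nat)%:R) <= tau ^+ 2].
Proof.
move=> tau0 tauP.
pose n := (24 * h + 1)%N.
pose B : 'M[C]_(S, n) := \matrix_(i, j) K i (N + j)%N.
have oS : (o < S)%N by clear; lia.
pose O := Ordinal oS.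
pose delta : 'cV[C]_S := \col_i (i == O)%:R.
pose ext (u : 'cV[C]_n) (i : nat) : C :=
  if insub (i - N)%N is Some j then if (N <= i)%N then u j 0 else 0 else 0.
have ext0 u i : ~~ ((N <= i) && (i + N < S))%N -> ext u i = 0.
  rewrite /ext; case: insubP => // j _ ji; case: ifP => // Ni.
  by have := ltn_ord j; rewrite /n ji; lia.
have extE u (j : 'I_n) : ext u (N + j)%N = u j 0.
  rewrite /ext addKn leq_addr; case: insubP => [j' _ e|].
    by congr (u _ 0); apply: val_inj.
  by rewrite ltn_ord.
have Bext u i : \sum_(j < S) K i j * ext u j = \sum_(j < n) K i (N + j)%N * u j 0.
  rewrite -(big_mkord xpredT (fun j => K i j * ext u j)).
  rewrite (@big_cat_nat _ _ _ N) //=; last by lia.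
  rewrite big_nat_cond big1 ?add0r; last first.
    by move=> j jN; rewrite ext0 ?mulr0 //; lia.
  rewrite (@big_cat_nat _ _ _ (n + N) N) //=; [|lia|rewrite /n; lia].
  rewrite [X in _ + X]big_nat_cond [X in _ + X]big1 ?addr0; last first.
    by move=> j jN; rewrite ext0 ?mulr0 //; move: jN; rewrite /n; lia.
  rewrite -{1}[N]add0n big_addn addnK big_mkord.
  by apply: eq_bigr => j _; rewrite addnC extE.
have LB u := dual_lower_bound FE aI lb phi (ext0 u).
have Binj (u : 'cV_n) : B *m u = 0 -> u = 0.
  move=> Bu0; have := LB u.
  rewrite [leRHS]big1 => [H|i _]; last first.
    rewrite Bext; have /colP/(_ i) := Bu0; rewrite !mxE => e.
    rewrite (eq_bigr (fun j => B i j * u j 0)) ?e; first by rewrite /nsq /= expr0n addr0.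
    by move=> j _; rewrite mxE.
  have s0 : 0 <= \sum_(i < S) nsq (ext u i) by apply: sumr_ge0 => i _; apply: nsq_ge0.
  have d2 : 0 < dl ^+ 2 by rewrite exprn_gt0.
  have sz : \sum_(i < S) nsq (ext u i) = 0.
    by apply/le_anti; rewrite s0 andbT -(ler_pM2l d2) mulr0.
  apply/colP => j; rewrite mxE -extE.
  have jS : (N + j < S)%N by case: (j) => i /= ; rewrite /n; clear; lia.
  have : nsq (ext u (N + j)%N) = 0.
    move/eqP: sz; rewrite psumr_eq0; last by move=> i _; apply: nsq_ge0.
    by move=> /allP/(_ (Ordinal jS))/(_ (mem_index_enum _))/eqP.
  move=> e; have := nsqE (ext u (N + j)%N); rewrite e => /esym/eqP.
  by rewrite expf_eq0 /= normr_eq0 => /eqP.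
have [u uP] := least_squares delta Binj.
set r := B *m u - delta in uP.
pose rs : nat -> C := fun i => if insub i is Some j then r j 0 else 0.
have rsE (i : 'I_S) : rs i = r i 0.
  by rewrite /rs; case: insubP => [j _ e|]; [congr (r _ 0); apply: val_inj|rewrite ltn_ord].
pose rr := \sum_(i < S) nsq (rs i).
have rr0 : 0 <= rr by apply: sumr_ge0 => i _; apply: nsq_ge0.
have rrE : rr%:C%C = nrm2 r.
  by rewrite rmorph_sum; apply: eq_bigr => i _; rewrite -rsE; apply: nsqE.
(* As [r] is orthogonal to the range of [B] and [r = B u - delta], its squared norm is
   [- <r, delta>]. Smallness at the single site [o] thus bounds the whole residual. *)
have nr : nrm2 r = - (r O 0)^*.
  rewrite nrm2E {2}/r mulmxBr mulmxA.
  have -> : r^t* *m B = 0.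
    have := congr1 (fun M : 'cV[C]_n => M^t*) uP.
    rewrite trmx_mul map_mxM trmxCK trmx0 => ->.
    by apply/matrixP => i j; rewrite !mxE conjC0.
  rewrite mul0mx sub0r !mxE (bigD1 O) //= big1 ?addr0; last first.
    by move=> i iO; rewrite !mxE (negbTE iO) mulr0.
  by rewrite !mxE eqxx mulr1.
have rO : nsq (rs o) = rr ^+ 2.
  have r0 : 0 <= nrm2 r by rewrite -rrE ler0c.
  have rOE : `|r O 0| = nrm2 r by rewrite -norm_conjC -normrN -nr ger0_norm.
  by apply: (@complexI R); rewrite nsqE rmorphXn /= rrE -rOE -rsE.
have rle i : nsq (rs i) <= rr.
  case: (ltnP i S) => iS; last first.
    rewrite /rs insubF ?ltnNge ?iS //.
    by rewrite /nsq /= expr0n addr0.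
  by rewrite /rr (bigD1 (Ordinal iS)) //= lerDl sumr_ge0 // => j _; apply: nsq_ge0.
have rr1 : rr <= 1.
  have := rle o; rewrite rO expr2 => H.
  have [->|rn] := eqVneq rr 0; first exact: ler01.
  by rewrite -(ler_pM2l (x := rr)) ?mulr1 // lt_neqAle eq_sym rn.
have rs1 i : `|rs i| <= 1.
  by rewrite -[1]/((1 : R)%:C%C); apply: norm_le_nsq => //; rewrite expr1n (le_trans (rle i)).
have Kr0 i : (N <= i < S - N)%N -> \sum_(j < S) K i j * rs j = 0.
  move=> iN; have jn : (i - N < n)%N by rewrite /n; move: iN; clear; lia.
  have /colP/(_ (Ordinal jn)) := uP; rewrite !mxE => e.
  rewrite -[RHS]e; apply: eq_bigr => j _; rewrite !mxE /= rsE dual_hermitian.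
  by rewrite subnKC ?mxE //; case/andP: iN.
have cen := homogeneous_center_small rs1 Kr0.
have rrt : rr <= tau ^+ 2.
  have : rr ^+ 2 <= (tau ^+ 2) ^+ 2.
    rewrite -(ler_pM2l (x := dl ^+ 2)) ?exprn_gt0 // -exprM -rO.
    exact: le_trans cen tauP.
  by rewrite ler_sqr ?nnegrE ?sqr_ge0.
exists (ext u); split; first exact: ext0.
  move=> i.
  have H : dl ^+ 2 * (\sum_(i < S) nsq (ext u i)) <= 4.
    apply: le_trans (LB u) _.
    apply: (@le_trans _ _ (\sum_(i < S) (2 * nsq (rs i) + 2 * (i == O)%:R))); last first.
      rewrite big_split /= -!mulr_sumr -/rr.
      have -> : \sum_(i < S) (i == O)%:R = 1 :> R.
        by rewrite (bigD1 O) //= eqxx big1 ?addr0 // => i' /negbTE ->.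
      lra.
    apply: ler_sum => i' _.
    have -> : \sum_(j < S) K i' j * ext u j = rs i' + (i' == O)%:R.
      rewrite rsE /r Bext !mxE subrK; apply: eq_bigr => j _; by rewrite mxE.
    have two (z z' : C) : nsq (z + z') <= 2 * nsq z + 2 * nsq z'.
      case: z => p q; case: z' => p' q'; rewrite /nsq /=.
      by have := sqr_ge0 (p - p'); have := sqr_ge0 (q - q'); rewrite !expr2; lra.
    apply: le_trans (two _ _) _; rewrite lerD2l ler_wpM2l //.
    by case: eqP => _; rewrite /nsq /= ?expr0n ?expr1n ?addr0.
  have ui : nsq (ext u i) <= \sum_(i < S) nsq (ext u i).
    case: (boolP ((N <= i) && (i + N < S))%N) => [iN|/(ext0 u) ->]; last first.
      by rewrite {1}/nsq /= expr0n addr0 sumr_ge0 // => j _; apply: nsq_ge0.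
    have iS : (i < S)%N by case/andP: iN => _; apply: leq_ltn_trans; apply: leq_addr.
    by rewrite (bigD1 (Ordinal iS)) //= lerDl sumr_ge0 // => j _; apply: nsq_ge0.
  rewrite expr_div_n ler_pdivlMr ?exprn_gt0 // mulrC.
  apply: (@le_trans _ _ 4); last by rewrite -natrX ler_nat.
  by apply: le_trans H; rewrite ler_pM2l ?exprn_gt0.
apply: le_trans rrt; rewrite /rr; apply: ler_sum => i _.
rewrite rsE /r !mxE Bext; rewrite le_eqVlt; apply/orP; left; apply/eqP; congr (nsq (_ - _)).
by apply: eq_bigr => j _; rewrite mxE.
Qed.
End DualInverse.

(** * The projective action *)

Section ProjectiveAction.
Variable R : realType.
Implicit Types t y z D X n : R.

Lemma cos_sin_atan_sq z : cos (atan z) ^+ 2 = (1 + z ^+ 2)^-1 /\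
  cos (atan z) * sin (atan z) = z / (1 + z ^+ 2).
Proof.
have p : 0 < 1 + z ^+ 2 by rewrite ltr_wpDr ?sqr_ge0.
have c : cos (atan z) ^+ 2 = (1 + z ^+ 2)^-1.
  by rewrite cos_atan exprVn sqr_sqrtr // ltW.
split=> //.
have c0 : cos (atan z) != 0.
  by rewrite -sqrf_eq0 c invr_eq0 gt_eqF.
have -> : sin (atan z) = z * cos (atan z).
  by rewrite -{2}[z]atanK /tan mulfVK.
by rewrite mulrCA -expr2 c.
Qed.

(* Half-angle formula: atan (X / (n + D)) / pi is the angle, in turns, of (D, X). *)
Lemma half_angle D X n : n ^+ 2 = D ^+ 2 + X ^+ 2 -> 0 < n + D -> 0 < n ->
  c2 (atan (X / (n + D)) / pi) = D / n /\ s2 (atan (X / (n + D)) / pi) = X / n.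
Proof.
move=> nE nD n0; set z := X / (n + D).
have p0 : (pi : R) != 0 by rewrite gt_eqF // pi_gt0.
have e : 2 * pi * (atan z / pi) = atan z *+ 2 by rewrite mulrC -mulrA [2 * pi]mulrC mulKf // mulr_natr.
have [c s] := cos_sin_atan_sq z.
have z1 : 1 + z ^+ 2 = 2 * n / (n + D).
  rewrite /z; apply: (mulIf (x := (n + D) ^+ 2)); first by rewrite expf_neq0 // gt_eqF.
  have -> : (1 + (X / (n + D)) ^+ 2) * (n + D) ^+ 2 = (n + D) ^+ 2 + X ^+ 2.
    by field; rewrite gt_eqF.
  have -> : 2 * n / (n + D) * (n + D) ^+ 2 = 2 * n * (n + D) by field; rewrite gt_eqF.
  rewrite sqrrD; move: nE; rewrite !expr2; lra.
rewrite /c2 /s2 e cos_mulr2n sin_mulr2n c s z1 !mulr2n; split.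
  by field; rewrite !gt_eqF.
by rewrite /z; field; rewrite !gt_eqF.
Qed.

Definition img_norm t y : R := Num.sqrt ((t * c2 y - s2 y) ^+ 2 + c2 y ^+ 2).

(** The vector of angle [y] is first turned by a quarter, to [(- s2 y, c2 y)]. The image
    [(t c2 y - s2 y, c2 y)] has scalar product [1 - t c2 y s2 y] and wedge [- t c2 y ^ 2] with it,
    and the half-angle formula gives the remaining angle. *)
Definition angle_step t y : R :=
  4^-1 + atan (- (t * c2 y ^+ 2) / (img_norm t y + (1 - t * c2 y * s2 y))) / pi.

Definition angle_map t y : R := y + angle_step t y.

Lemma img_normE t y :
  img_norm t y ^+ 2 = (1 - t * c2 y * s2 y) ^+ 2 + (- (t * c2 y ^+ 2)) ^+ 2.
Proof.
rewrite sqr_sqrtr ?addr_ge0 ?sqr_ge0 //.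
have := c2s2 y; set c := c2 y; set s := s2 y => h.
have -> : 1 - t * c * s = (c ^+ 2 + s ^+ 2) - t * c * s by rewrite h.
have {1}-> : (t * c - s) ^+ 2 + c ^+ 2 = ((t * c - s) ^+ 2 + c ^+ 2) * (c ^+ 2 + s ^+ 2).
  by rewrite h mulr1.
ring.
Qed.

Lemma img_norm_gt0 t y : 0 < img_norm t y.
Proof.
rewrite sqrtr_gt0 lt_neqAle addr_ge0 ?sqr_ge0 // andbT eq_sym.
rewrite paddr_eq0 ?sqr_ge0 // !sqrf_eq0; apply/negP => /andP[/eqP h /eqP c].
have := c2s2 y; move: h; rewrite c mulr0 sub0r => /eqP; rewrite oppr_eq0 => /eqP ->.
by rewrite !expr0n addr0 => /eqP; rewrite eq_sym oner_eq0.
Qed.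

(** The remaining angle is never a half turn: a zero wedge forces [t * c2 y = 0], and the scalar
    product is then 1. Hence the step is continuous everywhere and needs no choice of branch. *)
Lemma img_denom_gt0 t y : 0 < img_norm t y + (1 - t * c2 y * s2 y).
Proof.
have n0 := img_norm_gt0 t y; have nE := img_normE t y.
set D := 1 - _ in nE *; set X := - _ in nE *.
have [D0|D0] := leP 0 D; first lra.
have X0 : X != 0.
  apply/eqP => X0; have : t * c2 y = 0.
    move: X0 => /eqP; rewrite /X oppr_eq0 mulf_eq0 sqrf_eq0 => /orP[] /eqP ->.
      by rewrite mul0r.
    by rewrite mulr0.
  by move=> tc; move: D0; rewrite /D tc mul0r; lra.
have : (- D) ^+ 2 < img_norm t y ^+ 2.
  by rewrite nE sqrrN ltrDl exprn_even_gt0.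
rewrite ltr_sqr ?nnegrE ?(ltW n0) //; last by rewrite oppr_ge0 ltW.
lra.
Qed.

Lemma angle_mapE t y : c2 (angle_map t y) * img_norm t y = t * c2 y - s2 y /\
  s2 (angle_map t y) * img_norm t y = c2 y.
Proof.
have n0 := img_norm_gt0 t y.
have [c s] := half_angle (img_normE t y) (img_denom_gt0 t y) n0.
have e : angle_map t y = (y + 4^-1) + atan (- (t * c2 y ^+ 2) / (img_norm t y + (1 - t * c2 y * s2 y))) / pi.
  by rewrite /angle_map /angle_step addrA.
rewrite e (c2D (y + 4^-1)) (s2D (y + 4^-1)) c s.
have -> : c2 (y + 4^-1) = - s2 y by rewrite c2D c2_quarter s2_quarter; ring.
have -> : s2 (y + 4^-1) = c2 y by rewrite s2D c2_quarter s2_quarter; ring.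
have h := c2s2 y; split.
  rewrite mulrBl -[X in X - _]mulrA -[X in _ - X]mulrA !mulfVK ?gt_eqF //.
  have -> : s2 y = s2 y * (c2 y ^+ 2 + s2 y ^+ 2) by rewrite h mulr1.
  have {2}-> : t * c2 y = t * c2 y * (c2 y ^+ 2 + s2 y ^+ 2) by rewrite h mulr1.
  rewrite h; have : s2 y ^+ 2 = 1 - c2 y ^+ 2 by rewrite -h; ring.
  by move=> sE; rewrite mulr1 mulr1; ring: sE.
rewrite mulrDl -[X in X + _]mulrA -[X in _ + X]mulrA !mulfVK ?gt_eqF //.
have sE : s2 y ^+ 2 = 1 - c2 y ^+ 2 by rewrite -h; ring.
by ring: sE.
Qed.

Lemma angle_step_bounds t y : - 4^-1 < angle_step t y < 3 / 4.
Proof.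
rewrite /angle_step; set z := _ / (img_norm t y + _).
have p0 := pi_gt0 R.
have h1 : - 2^-1 < atan z / pi by rewrite ltr_pdivlMr //; have := atan_gtNpi2 z; lra.
have h2 : atan z / pi < 2^-1 by rewrite ltr_pdivrMr //; have := atan_ltpi2 z; lra.
by move: h1 h2; move: (atan z / pi) => A h1 h2; apply/andP; split; lra.
Qed.

Lemma angle_step_half t y : angle_step t (y + 2^-1) = angle_step t y.
Proof.
have c : c2 (y + 2^-1) = - c2 y by rewrite c2D c2_half s2_half; ring.
have s : s2 (y + 2^-1) = - s2 y by rewrite s2D c2_half s2_half; ring.
have n : img_norm t (y + 2^-1) = img_norm t y.
  by rewrite /img_norm c s; congr (Num.sqrt _); ring.
by rewrite /angle_step n c s sqrrN (_ : t * - c2 y * - s2 y = t * c2 y * s2 y) //; ring.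
Qed.

Lemma angle_map_halfZ t y (k : int) :
  angle_map t (y + k%:~R / 2) = angle_map t y + k%:~R / 2.
Proof.
have half z : angle_step t (z - 2^-1) = angle_step t z.
  by rewrite -{2}[z](subrK 2^-1) angle_step_half.
suff key : forall m : int, angle_step t (y + m%:~R / 2) = angle_step t y.
  by rewrite /angle_map key addrAC.
elim=> [|m IH|m IH]; first by rewrite mul0r addr0.
  by rewrite -IH -[RHS]angle_step_half; congr angle_step; rewrite -addn1 PoszD intrD; field.
by rewrite -IH -[RHS]half; congr angle_step; rewrite -addn1 PoszD opprD intrD; field.
Qed.

Lemma angle_step_c0 t y : c2 y = 0 -> angle_step t y = 4^-1.
Proof. by move=> c; rewrite /angle_step c expr0n /= mulr0 oppr0 !mul0r atan0 mul0r addr0. Qed.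

Lemma c2_gt0 y : - 4^-1 < y < 4^-1 -> 0 < c2 y.
Proof.
move=> /andP[h1 h2]; apply: cos_gt0_pihalf; have := pi_gt0 R => p0.
by apply/andP; split; nra.
Qed.

(** In the projective coordinate the matrix acts as [t - tan], which makes monotonicity in [t] and
    in [y] visible. Both sides represent the same point of the circle, and they are too close to
    differ by a nonzero integer. *)
Lemma angle_map_tan t y : - 4^-1 < y < 4^-1 ->
  angle_map t y = 4^-1 - atan (t - s2 y / c2 y) / (2 * pi).
Proof.
move=> yb; have c0 := c2_gt0 yb; have p0 := pi_gt0 R.
have /andP[y1 y2] := yb.
set k := t - _; set g := RHS.
have n0 := img_norm_gt0 t y.
have cA0 : 0 < cos (atan k).
  by rewrite cos_atan invr_gt0 sqrtr_gt0 ltr_wpDr ?sqr_ge0.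
have kE : k * c2 y = t * c2 y - s2 y by rewrite /k mulrBl mulfVK // gt_eqF.
have cA : cos (atan k) * img_norm t y = c2 y.
  rewrite cos_atan; have -> : img_norm t y = Num.sqrt (1 + k ^+ 2) * c2 y.
    rewrite /img_norm -kE exprMn -[X in _ + X]mul1r -mulrDl addrC sqrtrM; last first.
      by rewrite addr_ge0 ?sqr_ge0.
    by rewrite sqrtr_sqr gtr0_norm.
  by rewrite mulKf // gt_eqF // sqrtr_gt0 ltr_wpDr ?sqr_ge0.
have sA : sin (atan k) = k * cos (atan k).
  by rewrite -{2}[k]atanK /tan mulfVK // gt_eqF.
have e : 2 * pi * g = pi / 2 - atan k.
  have q : 2 * pi * (atan k / (2 * pi)) = atan k.
    by rewrite mulrCA mulfV ?mulr1 // mulf_neq0 ?pnatr_eq0 // gt_eqF.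
  rewrite /g mulrBr q; lra.
have cg : c2 g = sin (atan k) by rewrite /c2 e cosB cos_pihalf sin_pihalf; ring.
have sg : s2 g = cos (atan k) by rewrite /s2 e sinB cos_pihalf sin_pihalf; ring.
have [cT sT] := angle_mapE t y.
have : ex (angle_map t y) = ex g.
  rewrite /ex; congr (_ +i* _)%C; apply: (mulIf (x := img_norm t y)); rewrite ?gt_eqF //.
    by rewrite cT cg sA -mulrA cA kE.
  by rewrite sT sg cA.
move=> /ex_inj_mod[m mE]; rewrite mE.
have /andP[b1 b2] := angle_step_bounds t y.
have g1 : 0 < g < 2^-1.
  have h1 : - 4^-1 < atan k / (2 * pi).
    by rewrite ltr_pdivlMr ?mulr_gt0 //; have := atan_gtNpi2 k; lra.
  have h2 : atan k / (2 * pi) < 4^-1.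
    by rewrite ltr_pdivrMr ?mulr_gt0 //; have := atan_ltpi2 k; lra.
  by rewrite /g; apply/andP; split; lra.
have mb : `|m%:~R : R| < 1.
  move: mE; rewrite /angle_map => mE; case/andP: g1 => g1 g2.
  by rewrite ltr_norml; apply/andP; split; lra.
have -> : m = 0 by move: mb; rewrite -intr_norm ltrz1; clear; lia.
by rewrite addr0.
Qed.

Lemma angle_map_range t y : - 4^-1 < y < 4^-1 -> 0 < angle_map t y < 2^-1.
Proof.
move=> yb; rewrite angle_map_tan //; set k := t - _; have p0 := pi_gt0 R.
have h1 : - 4^-1 < atan k / (2 * pi).
  by rewrite ltr_pdivlMr ?mulr_gt0 //; have := atan_gtNpi2 k; lra.
have h2 : atan k / (2 * pi) < 4^-1.
  by rewrite ltr_pdivrMr ?mulr_gt0 //; have := atan_ltpi2 k; lra.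
by apply/andP; split; lra.
Qed.

Lemma angle_map_quarter t : angle_map t (- 4^-1) = 0.
Proof. by rewrite /angle_map angle_step_c0 ?c2N ?c2_quarter // addNr. Qed.

Lemma half_turn_decomp y :
  exists k : int, exists y0, [/\ y = y0 + k%:~R / 2 & - 4^-1 <= y0 < 4^-1].
Proof.
exists (Num.floor (2 * y + 2^-1)), (y - (Num.floor (2 * y + 2^-1))%:~R / 2).
split; first by rewrite subrK.
have := floor_le_tmp (2 * y + 2^-1); have := floorD1_gt (2 * y + 2^-1).
by rewrite intrD => h1 h2; apply/andP; split; lra.
Qed.

Lemma angle_map_antitone t t' y : t <= t' -> angle_map t' y <= angle_map t y.
Proof.
move=> tt'; have [k [y0 [-> yb]]] := half_turn_decomp y.
rewrite !angle_map_halfZ lerD2r.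
have [->|y0n] := eqVneq y0 (- 4^-1); first by rewrite !angle_map_quarter.
have yb' : - 4^-1 < y0 < 4^-1 by case/andP: yb => h1 ->; rewrite lt_neqAle eq_sym y0n h1.
have p0 := pi_gt0 R.
rewrite !angle_map_tan // lerD2l lerN2 ler_pM2r ?invr_gt0 ?mulr_gt0 //.
by rewrite le_atan // lerD2r.
Qed.

(** After reduction to [[-1/4, 1/4)] the values lie in [[0, 1/2)]. Different half-turn numbers are
    therefore ordered by range alone, and equal ones by the tangent formula. *)
Lemma angle_map_mono t y y' : y <= y' -> angle_map t y <= angle_map t y'.
Proof.
have [k [y0 [-> yb]]] := half_turn_decomp y.
have [k' [y0' [-> yb']]] := half_turn_decomp y'.
move=> le; rewrite !angle_map_halfZ.
have p0 := pi_gt0 R.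
have range z : - 4^-1 <= z < 4^-1 -> 0 <= angle_map t z < 2^-1.
  move=> /andP[z1 z2]; have [->|zn] := eqVneq z (- 4^-1).
    by rewrite angle_map_quarter lexx invr_gt0 ltr0n.
  have /andP[h1 ->] := @angle_map_range t z ltac:(by rewrite z2 lt_neqAle eq_sym zn z1).
  by rewrite ltW.
have [/andP[r1 r2] /andP[r1' r2']] := (range _ yb, range _ yb').
case/andP: yb => b1 b2; case/andP: yb' => b1' b2'.
case: (ltgtP k k') => kk.
- have : (k + 1)%:~R <= k'%:~R :> R by rewrite ler_int; move: kk; clear; lia.
  by rewrite intrD; lra.
- have : (k' + 1)%:~R <= k%:~R :> R by rewrite ler_int; move: kk; clear; lia.
  by rewrite intrD; lra.
rewrite kk lerD2r; have yy : y0 <= y0' by move: le; rewrite kk lerD2r.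
have [->|y0n] := eqVneq y0 (- 4^-1); first by rewrite angle_map_quarter.
have o1 : - 4^-1 < y0 < 4^-1 by rewrite b2 lt_neqAle eq_sym y0n b1.
have o2 : - 4^-1 < y0' < 4^-1 by rewrite b2' andbT; lra.
rewrite !angle_map_tan // lerD2l lerN2 ler_pM2r ?invr_gt0 ?mulr_gt0 //.
rewrite le_atan // lerD2l lerN2.
have tanE z : s2 z / c2 z = tan (2 * pi * z) by [].
rewrite !tanE; have [->//|yn] := eqVneq y0 y0'.
have ylt : y0 < y0' by rewrite lt_neqAle yn.
apply: ltW; rewrite ltr_tan ?in_itv /=.
- by rewrite ltr_pM2l // mulr_gt0.
- by case/andP: o1 => ? ?; apply/andP; split; nra.
- by case/andP: o2 => ? ?; apply/andP; split; nra.
Qed.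

Lemma continuous_c2 : continuous (@c2 R).
Proof.
move=> y; apply: (@continuous_comp _ _ _ (fun z => 2 * pi * z) (@cos R)).
  by apply: mulrl_continuous.
exact: continuous_cos.
Qed.

Lemma continuous_s2 : continuous (@s2 R).
Proof.
move=> y; apply: (@continuous_comp _ _ _ (fun z => 2 * pi * z) (@sin R)).
  by apply: mulrl_continuous.
exact: continuous_sin.
Qed.

Lemma continuous_angle_step (T : topologicalType) (u v : T -> R) :
  continuous u -> continuous v -> continuous (fun x => angle_step (u x) (v x)).
Proof.
move=> uc vc x.
have cc : {for x, continuous (fun x => c2 (v x))}.
  by apply: (@continuous_comp _ _ _ v (@c2 R)); [exact: vc|exact: continuous_c2].
have sc : {for x, continuous (fun x => s2 (v x))}.
  by apply: (@continuous_comp _ _ _ v (@s2 R)); [exact: vc|exact: continuous_s2].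
have ux : {for x, continuous u} := uc x.
have kc (k : R) : {for x, continuous (fun _ : T => k)} by apply: cst_continuous.
have ucc := continuousM ux cc.
have wc := continuousB ucc sc.
have nc : {for x, continuous (fun x => img_norm (u x) (v x))}.
  apply: (@continuous_comp _ _ _ (fun x => (u x * c2 (v x) - s2 (v x)) ^+ 2 + c2 (v x) ^+ 2) (@Num.sqrt R)).
    exact: continuousD (continuousM wc wc) (continuousM cc cc).
  exact: sqrt_continuous.
pose w x := img_norm (u x) (v x) + (1 - u x * c2 (v x) * s2 (v x)).
have dc : {for x, continuous w} := continuousD nc (continuousB (kc 1) (continuousM ucc sc)).
pose n x := - (u x * c2 (v x) ^+ 2).
have xc : {for x, continuous n} := continuousN (continuousM ux (continuousM cc cc)).
have dn : w x != 0.
  by rewrite gt_eqF // img_denom_gt0.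
pose z x : R := n x / w x.
have zc : {for x, continuous z} := continuousM xc (continuousV dn dc).
have ac : {for x, continuous (fun x => atan (z x))}.
  exact: (@continuous_comp _ _ _ z (@atan R) x zc (@continuous_atan R (z x))).
exact: continuousD (kc 4^-1) (continuousM ac (kc pi^-1)).
Qed.

End ProjectiveAction.

Section Orbits.
Variables (R : realType) (F : R -> R) (alpha : R).
Implicit Types E x y : R.

Fixpoint orbit_angle E x y (n : nat) : R :=
  if n is n'.+1 then angle_map (E - F (x + n'%:R * alpha)) (orbit_angle E x y n')
  else y.

Lemma orbit_angle_mono E x y y' n : y <= y' ->
  orbit_angle E x y n <= orbit_angle E x y' n.
Proof. by move=> yy; elim: n => //= n; apply: angle_map_mono. Qed.

Lemma orbit_angle_anti E E' x y n : E <= E' ->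
  orbit_angle E' x y n <= orbit_angle E x y n.
Proof.
move=> EE; elim: n => //= n IH; apply: le_trans (angle_map_mono _ IH).
by apply: angle_map_antitone; rewrite lerD2r.
Qed.

Lemma orbit_angle_halfZ E x y n (k : int) :
  orbit_angle E x (y + k%:~R / 2) n = orbit_angle E x y n + k%:~R / 2.
Proof. by elim: n => //= n ->; rewrite angle_map_halfZ. Qed.

Lemma orbit_angleD E x y m n :
  orbit_angle E x y (m + n) = orbit_angle E (x + m%:R * alpha) (orbit_angle E x y m) n.
Proof.
elim: n => [|n IH]; first by rewrite addn0.
by rewrite addnS /= IH natrD mulrDl addrA.
Qed.

Lemma orbit_angle_continuous E x n : continuous (fun y => orbit_angle E x y n).
Proof.
elim: n => [|n IH] y /=; first exact: cvg_id.
apply: cvgD; first exact: IH.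
exact: (continuous_angle_step (u := fun=> E - F (x + n%:R * alpha)) (fun z => @cst_continuous _ _ _ _) IH).
Qed.

(* A real solution of H_x psi = E psi stays proportional to the unit vector of
   angle orbit_angle. *)
Lemma solution_angle E x y (p : nat -> R) (q k : R) (n : nat) :
  p 0%N = k * c2 y -> q = k * s2 y ->
  (forall i, (i < n)%N ->
     p i.+1 = (E - F (x + i%:R * alpha)) * p i - (if i is j.+1 then p j else q)) ->
  exists2 r, 0 < r & p n = k * r * c2 (orbit_angle E x y n) /\
     (if n is j.+1 then p j else q) = k * r * s2 (orbit_angle E x y n).
Proof.
move=> p0 qE; elim: n => [|n IH] pS; first by exists 1; rewrite ?ltr01 // mulr1 /=.
have [i iN|r r0 [pn qn]] := IH; first by apply: pS; apply: ltnW.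
set t := E - F (x + n%:R * alpha); set z := orbit_angle E x y n in pn qn.
exists (r * img_norm t z); first by rewrite mulr_gt0 ?img_norm_gt0.
rewrite /= -/t -/z; have [c s] := angle_mapE t z.
rewrite pS // -/t qn pn; split.
  have -> : k * (r * img_norm t z) * c2 (angle_map t z) = k * r * (c2 (angle_map t z) * img_norm t z) by ring.
  by rewrite c; ring.
have -> : k * (r * img_norm t z) * s2 (angle_map t z) = k * r * (s2 (angle_map t z) * img_norm t z) by ring.
by rewrite s.
Qed.

Lemma s2_gt0 y : 0 < y < 2^-1 -> 0 < s2 y.
Proof.
move=> /andP[h1 h2]; apply: sin_gt0_pi; have := pi_gt0 R => p0.
by apply/andP; split; nra.
Qed.

(** Avoids the one boundary condition at the right end that no finite boundary term expresses. *)
Lemma generic_angle (u v : R) : u < v -> exists2 z, u < z < v & s2 z != 0.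
Proof.
move=> uv; pose e := Num.min ((v - u) / 3) 8^-1.
have e0 : 0 < e by rewrite lt_min divr_gt0 ?subr_gt0 //= invr_gt0.
have e1 : e <= (v - u) / 3 by rewrite ge_min lexx.
have e2 : e <= 8^-1 by rewrite ge_min lexx orbT.
have [s|s] := eqVneq (s2 (u + e)) 0; last by exists (u + e) => //; apply/andP; split; lra.
exists (u + e + e); first by apply/andP; split; lra.
rewrite s2D s mul0r add0r mulf_neq0 //.
  by apply/eqP => c; have := c2s2 (u + e); rewrite s c expr0n addr0 => /eqP; rewrite eq_sym oner_eq0.
by rewrite gt_eqF // s2_gt0 // e0 /=; lra.
Qed.

Section Window.
Variables (E1 E2 x : R) (n : nat) (u : nat -> R).
Hypothesis E12 : E1 < E2.
Hypothesis u0 : u 0%N = 0.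
Hypothesis uout : forall i, (n <= i.+1)%N -> u i = 0.
Let E := (E1 + E2) / 2.
Let dl := (E2 - E1) / 2.
Hypothesis usmall : \sum_(i < n) (u i.+1 + u i.-1 + (F (x + i%:R * alpha) - E) * u i) ^+ 2
  < dl ^+ 2 * (\sum_(i < n) u i ^+ 2).

Let V (i : nat) := F (x + i%:R * alpha).

(** The restriction of [H_x] to [n] sites. The corner terms encode boundary conditions: [t] is the
    ratio of the value before the first site to the value at it, and [s] the ratio of the value
    after the last site to the value at it. *)
Definition jacobi (s t : R) : 'M[R]_n := \matrix_(i, j)
  ((V i + t * (i == 0%N :> nat)%:R + s * (i.+1 == n)%:R) * (j == i :> nat)%:R
   + (j == i.+1 :> nat)%:R + (j.+1 == i)%:R).

Lemma jacobi_mul s t (w : nat -> R) (i : 'I_n) : (forall j, (n <= j)%N -> w j = 0) ->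
  (jacobi s t *m (\col_j w j)) i 0
  = (V i + t * (i == 0%N :> nat)%:R + s * (i.+1 == n)%:R) * w i + w i.+1
    + (if (i : nat) is j.+1 then w j else 0).
Proof.
move=> w0; rewrite mxE.
have ind (k : nat) : \sum_(j < n) (j == k :> nat)%:R * w j = w k.
  case: (ltnP k n) => kn; last first.
    rewrite w0 // big1 // => j _; rewrite ltn_eqF ?mul0r //.
    exact: leq_trans (ltn_ord j) kn.
  rewrite (bigD1 (Ordinal kn)) //= eqxx mul1r big1 ?addr0 // => j.
  by rewrite -val_eqE /= => /negbTE ->; rewrite mul0r.
set d := _ + s * _.
rewrite (eq_bigr (fun j : 'I_n => d * ((j == i :> nat)%:R * w j)
   + (j == i.+1 :> nat)%:R * w j + (j.+1 == i)%:R * w j)); last first.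
  by move=> j _; rewrite !mxE -/d; ring.
rewrite !big_split /= -mulr_sumr !ind; congr (_ + _).
case: (nat_of_ord i) => [|k].
  by rewrite big1 // => j _; rewrite mul0r.
rewrite -(ind k); apply: eq_bigr => j _; by rewrite eqSS.
Qed.

Lemma jacobi_tr s t : (jacobi s t)^T = jacobi s t.
Proof.
apply/matrixP => i j; rewrite !mxE [(j == i.+1 :> nat)]eq_sym [(j.+1 == i)]eq_sym.
rewrite [(i == j :> nat)]eq_sym -addrA [X in _ + X]addrC addrA.
by case: (eqVneq (j : nat) i) => [->|_] //; rewrite !mulr0.
Qed.

Lemma n_gt0 : (0 < n)%N.
Proof.
rewrite lt0n; apply/eqP => nE; move: usmall; rewrite nE !big_ord0 mulr0.
by rewrite ltxx.
Qed.

(** Sturm oscillation. If the two final angles differ by less than a half turn, some boundary angle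
    [z] is missed, modulo half turns, by all energies of the open interval, since the final angle is
    monotone in the energy. The Jacobi matrix with boundary angles [y] and [z] then has no
    eigenvalue there, and its resolvent bound contradicts [usmall]. *)
Lemma window_gain_generic y : c2 y != 0 ->
  orbit_angle E2 x y n + 2^-1 <= orbit_angle E1 x y n.
Proof.
move=> cy; rewrite leNgt; apply/negP => lt.
have [z /andP[z1 z2] sz] := generic_angle lt.
pose t := s2 y / c2 y; pose s := c2 z / s2 z.
have dl0 : 0 <= dl by rewrite /dl divr_ge0 // subr_ge0 ltW.
have noeig (e : R) (v : 'cV[R]_n) : `|e - E| < dl -> jacobi s t *m v = e *: v -> v = 0.
  rewrite /E /dl => ee Jv.
  have /andP[e1 e2] : (E1 < e < E2) by move: ee; rewrite ltr_norml => /andP[? ?]; apply/andP; split; lra.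
  pose w (i : nat) : R := if insub i is Some j then v j 0 else 0.
  have w0 j : (n <= j)%N -> w j = 0 by move=> nj; rewrite /w insubF // ltnNge nj.
  have wE (j : 'I_n) : w j = v j 0.
    by rewrite /w; case: insubP => [j' _ ej|]; [congr (v _ 0); apply: val_inj|rewrite ltn_ord].
  have vE : v = \col_j w j by apply/colP => j; rewrite mxE wE.
  have row (i : nat) : (i < n)%N -> w i.+1 = (e - V i - t * (i == 0%N)%:R - s * (i.+1 == n)%:R) * w i
       - (if i is j.+1 then w j else 0).
    move=> iN; have := congr1 (fun M : 'cV[R]_n => M (Ordinal iN) 0) Jv.
    rewrite /= {1}vE jacobi_mul //= mxE -wE /= => h.
    set rest := (if i is j.+1 then w j else 0) in h *.
    have hw : w i.+1 = e * w i - (V i + t * (i == 0%N)%:R + s * (i.+1 == n)%:R) * w i - rest.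
      by rewrite -h; ring.
    by rewrite hw; ring.
  (* The eigenvector is zero beyond the last site; the value that the right boundary condition
     prescribes at [n] makes it a solution up to there. *)
  pose p (i : nat) : R := if i == n then s * w n.-1 else w i.
  have pw i : (i < n)%N -> p i = w i by move=> iN; rewrite /p ltn_eqF.
  have pS i : (i < n)%N -> p i.+1 = (e - F (x + i%:R * alpha)) * p i
      - (if i is j.+1 then p j else t * w 0%N).
    move=> iN; rewrite (pw i) // -/(V i).
    have -> : (if i is j.+1 then p j else t * w 0%N)
            = (if i is j.+1 then w j else 0) + t * (i == 0%N)%:R * w i.
      case: i iN => [|j] jN /=; first by rewrite add0r mulr1n mulr1.
      by rewrite pw ?(ltnW jN) // mulr0n mulr0 mul0r addr0.
    have := row i iN; rewrite /p; case: (eqVneq i.+1 n) => [en|ne].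
      have -> : n.-1 = i by rewrite -en.
      rewrite w0 ?en // mulr1; set rest := (if i is j.+1 then w j else 0) => h.
      have -> : (e - V i) * w i - (rest + t * (i == 0%N)%:R * w i)
        = s * w i + ((e - V i - t * (i == 0%N)%:R - s) * w i - rest) by ring.
      by rewrite -h addr0.
    move=> ->; set rest := (if i is j.+1 then w j else 0); rewrite mulr0 subr0; ring.
  pose k := w 0%N / c2 y.
  have p0 : p 0%N = k * c2 y by rewrite pw ?n_gt0 // /k mulfVK.
  have qE : t * w 0%N = k * s2 y by rewrite /t /k; ring.
  have [r r0 [pn qn]] := solution_angle p0 qE pS.
  have [k0|k0] := eqVneq k 0.
    have w00 : w 0%N = 0 by move: p0; rewrite pw ?n_gt0 // k0 mul0r.
    have wz i : w i = 0 /\ w i.+1 = 0.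
      elim: i => [|i [IH1 IH2]].
        by split=> //; rewrite (row 0%N) ?n_gt0 // w00 mulr0 subr0.
      split=> //; case: (ltnP i.+1 n) => h; last by rewrite w0 // (leq_trans h).
      by rewrite row // IH2 IH1 mulr0 subr0.
    by rewrite vE; apply/colP => j; rewrite !mxE; have [-> _] := wz j.
  set Z := orbit_angle e x y n in pn qn.
  have n1 : n = n.-1.+1 by rewrite prednK // n_gt0.
  have kr : k * r != 0 by rewrite mulf_neq0 // gt_eqF.
  have qn' : w n.-1 = k * r * s2 Z.
    by move: qn; rewrite {1}n1 pw // -n1.
  have cs : c2 Z = s * s2 Z.
    apply: (mulfI kr); rewrite -pn /p eqxx qn'; ring.
  have Z1 : Z <= orbit_angle E1 x y n by apply: orbit_angle_anti; apply: ltW.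
  have Z2 : orbit_angle E2 x y n <= Z by apply: orbit_angle_anti; apply: ltW.
  have : 0 < s2 (z - Z) by apply: s2_gt0; apply/andP; split; lra.
  rewrite s2D s2N c2N cs /s.
  have -> : s2 z * (c2 z / s2 z * s2 Z) + c2 z * - s2 Z = 0.
    by rewrite mulrN mulrA [s2 z * _]mulrC mulfVK // subrr.
  by rewrite ltxx.
have := symmetric_resolvent_bound (\col_j u j) (jacobi_tr s t) dl0 noeig.
apply/negP; rewrite -ltNge.
have -> : \sum_i (\col_j u j : 'cV[R]_n) i 0 ^+ 2 = \sum_(i < n) u i ^+ 2.
  by apply: eq_bigr => i _; rewrite mxE.
apply: le_lt_trans usmall; apply: ler_sum => i _.
rewrite mxE jacobi_mul; last by move=> j nj; apply: uout; apply: leqW.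
rewrite !mxE le_eqVlt; apply/orP; left; apply/eqP; congr (_ ^+ 2).
(* The test sequence vanishes at the first and the last site, so it does not see the boundary
   terms. *)
have ends : t * (i == 0%N :> nat)%:R * u i = 0 /\ s * (i.+1 == n)%:R * u i = 0.
  split.
    by case: eqP => [->|_]; rewrite ?u0 !(mulr0, mul0r).
  by case: eqP => [e|_]; [rewrite uout ?e // mulr0|rewrite mulr0 mul0r].
have -> : (if nat_of_ord i is j.+1 then u j else 0) = u i.-1.
  by case: (nat_of_ord i) => //=.
rewrite !mulrDl ends.1 ends.2 /V; ring.
Qed.

(** A vertical initial direction is approached from below: monotonicity handles the angle at [E1],
    and continuity is needed at [E2] only. *)
Lemma window_gain y : orbit_angle E2 x y n + 2^-1 <= orbit_angle E1 x y n.
Proof.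
have [cy|] := eqVneq (c2 y) 0; last exact: window_gain_generic.
rewrite leNgt; apply/negP => lt.
have := orbit_angle_continuous (E := E2) (x := x) (n := n) (x0 := y).
have e0 : 0 < orbit_angle E2 x y n + 2^-1 - orbit_angle E1 x y n by rewrite subr_gt0.
move=> /cvgr_dist_lt /(_ _ e0) [d /= d0 dP].
pose e := Num.min (d / 2) 8^-1.
have e0' : 0 < e by rewrite lt_min divr_gt0 //= invr_gt0.
have ed : e <= d / 2 by rewrite ge_min lexx.
have e8 : e <= 8^-1 by rewrite ge_min lexx orbT.
have := dP (y - e); rewrite /ball_ /= subKr gtr0_norm // => /(_ ltac:(lra)).
have ce : c2 (y - e) != 0.
  rewrite c2D c2N s2N cy mul0r sub0r mulrN opprK mulf_neq0 //.
    by apply/eqP => s; have := c2s2 y; rewrite s cy expr0n addr0 => /eqP; rewrite eq_sym oner_eq0.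
  by rewrite gt_eqF // s2_gt0 // e0' /=; lra.
have := window_gain_generic ce.
have : orbit_angle E1 x (y - e) n <= orbit_angle E1 x y n.
  by apply: orbit_angle_mono; lra.
rewrite ltr_norml => h1 h2 /andP[h3 h4]; lra.
Qed.

End Window.
End Orbits.

(** * Energies with equal rotation numbers *)

Lemma continuous_sum_ord (R : realType) (n : nat) (g : nat -> R -> R) :
  (forall i, continuous (g i)) -> continuous (fun x => \sum_(i < n) g i x).
Proof.
move=> gc; elim: n => [|n IH].
  have -> : (fun x => \sum_(i < 0) g i x) = fun=> 0 by apply/funext => x; rewrite big_ord0.
  exact: cst_continuous.
have -> : (fun x => \sum_(i < n.+1) g i x) = fun x => \sum_(i < n) g i x + g n x.
  by apply/funext => x; rewrite big_ord_recr.
by move=> x; apply: cvgD; [exact: IH|exact: gc].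
Qed.

(** Some multiple [q * alpha] is a nonzero step shorter than [tau] modulo integers. Repeating it
    walks around the circle in a number of steps independent of [x]. *)
Lemma irrational_returns (R : realType) (alpha tau : R) :
  irrational alpha -> 0 < tau ->
  exists N0 : nat, forall x : R, exists2 n, (n < N0)%N &
    exists k : int, `|x + n%:R * alpha - k%:~R| < tau.
Proof.
move=> aI t0.
pose Q := (Num.bound tau^-1).+1.
have [q /andP[q0 _] qd] := dirichlet alpha (Q := Q) isT.
have qt : dist_to_Z (q%:R * alpha) < tau.
  apply: lt_trans qd _; rewrite -[ltRHS]invrK ltf_pV2 ?posrE ?invr_gt0 ?ltr0n //.
  apply: lt_le_trans (archi_boundP _) _; first by rewrite invr_ge0 ltW.
  by rewrite ler_nat.
have dp := dist_to_Z_irr aI q0.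
have [p pE] := dist_to_Z_attained (q%:R * alpha).
pose dl := q%:R * alpha - p%:~R.
pose ad := `|dl|.
have ad0 : 0 < ad by rewrite /ad /dl -pE.
have adt : ad < tau by rewrite /ad /dl -pE.
pose M := (Num.bound ad^-1).+1.
have adM : ad^-1 < M%:R.
  apply: lt_le_trans (archi_boundP _) _; first by rewrite invr_ge0 ltW.
  by rewrite ler_nat.
exists (M * q).+1 => x.
(* The multiples of dl carry x up (dl > 0) or down (dl <= 0) to the next integer. *)
pose s := if 0 < dl then - x else x.
pose fr := s - (Num.floor s)%:~R.
have fr0 : 0 <= fr by rewrite subr_ge0 floor_le_tmp.
have fr1 : fr < 1 by have := floorD1_gt s; rewrite intrD /fr; lra.
pose j := `|Num.floor (fr / ad)|%N.
have jE : j%:R <= fr / ad < j%:R + 1.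
  have f0 : 0 <= Num.floor (fr / ad) by rewrite floor_ge_int divr_ge0 // ltW.
  rewrite /j natr_absz ger0_norm // floor_le_tmp /=.
  by have := floorD1_gt (fr / ad); rewrite intrD.
have /andP[j1 j2] := jE.
have jad : 0 <= fr - j%:R * ad < ad.
  rewrite ler_pdivlMr // in j1; rewrite ltr_pdivrMr // in j2.
  by apply/andP; split; lra.
have jM : (j < M)%N.
  rewrite -(ltr_nat R); apply: le_lt_trans j1 _; apply: le_lt_trans adM.
  by rewrite -[leRHS]mul1r ler_pM2r ?invr_gt0 // ltW.
exists (j * q)%N; first by rewrite ltnS leq_mul2r (ltnW jM) orbT.
exists ((if 0 < dl then - Num.floor s else Num.floor s) + j%:Z * p).
have -> : x + (j * q)%:R * alpha - ((if 0 < dl then - Num.floor s else Num.floor s) + j%:Z * p)%:~R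
   = (if 0 < dl then -1 else 1) * (fr - j%:R * ad).
  rewrite natrM rmorphD rmorphM /= -[j%:~R]/(j%:R : R) /fr /ad /s.
  case: (ltP 0 dl) => d0.
    by rewrite gtr0_norm // rmorphN /dl; ring.
  by rewrite ler0_norm // /dl; ring.
rewrite normrM; have -> : `|(if 0 < dl then -1 else 1 : R)| = 1.
  by case: ifP => _; rewrite ?normrN normr1.
by case/andP: jad => h1 h2; rewrite mul1r ger0_norm // (lt_trans h2).
Qed.

Section Rotation.
Variables (R : realType) (F : R -> R) (alpha : R).
Hypotheses (aI : irrational alpha) (Fc : continuous F) (Fper : forall x, F (x + 1) = F x).
Implicit Types E x y : R.

Local Notation ang := (orbit_angle F alpha).

Lemma potential_shiftZ x (k : int) : F (x + k%:~R) = F x.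
Proof.
have back z : F (z - 1) = F z by rewrite -{2}[z](subrK 1) Fper.
elim: k => [|k IH|k IH]; first by rewrite addr0.
  by rewrite -addn1 PoszD intrD addrA Fper.
by rewrite -addn1 PoszD opprD intrD addrA back.
Qed.

Lemma orbit_angle_shiftZ E x y n (k : int) : ang E (x + k%:~R) y n = ang E x y n.
Proof.
elim: n => //= n ->; congr (angle_map (E - _) _).
by rewrite addrAC potential_shiftZ.
Qed.

(** A test sequence violating the bound at [x0] still violates it near [x0], where every orbit
    returns within [N0] steps. Each return wins a half turn at [E1] over [E2], and monotonicity
    loses nothing in between, so the rotation numbers would differ by at least [1 / (2L)]. *)
Lemma equal_rotation_lower_bounded E1 E2 (r : R) : E1 < E2 ->
  (n%:R^-1 * ang E1 0 0 n @[n --> \oo] --> r) ->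
  (n%:R^-1 * ang E2 0 0 n @[n --> \oo] --> r) ->
  lower_bounded F alpha ((E1 + E2) / 2) ((E2 - E1) / 2).
Proof.
move=> E12 r1 r2 x0 n u u0 uout; rewrite leNgt; apply/negP => small.
set E := (E1 + E2) / 2 in small; set dl := (E2 - E1) / 2 in small.
pose G x := \sum_(i < n) (u i.+1 + u i.-1 + (F (x + i%:R * alpha) - E) * u i) ^+ 2.
have Gc : continuous G.
  apply: (continuous_sum_ord (g := fun i z => (u i.+1 + u i.-1 + (F (z + i%:R * alpha) - E) * u i) ^+ 2)) => i x.
  have Fi : {for x, continuous (fun z => F (z + i%:R * alpha))}.
    apply: (@continuous_comp _ _ _ (fun z => z + i%:R * alpha) F); last exact: Fc.
    by apply: cvgD; [exact: cvg_id|exact: cvg_cst].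
  have lin : {for x, continuous (fun z => u i.+1 + u i.-1 + (F (z + i%:R * alpha) - E) * u i)}.
    apply: cvgD; first exact: cvg_cst.
    apply: cvgM; last exact: cvg_cst.
    by apply: cvgB; [exact: Fi|exact: cvg_cst].
  exact: (continuousM lin lin).
have [tau tau0 tauP] : exists2 tau, 0 < tau & forall x, `|x0 - x| < tau ->
    G x < dl ^+ 2 * (\sum_(i < n) u i ^+ 2).
  have e0 : 0 < dl ^+ 2 * (\sum_(i < n) u i ^+ 2) - G x0 by rewrite subr_gt0.
  have := Gc x0; move=> /cvgr_dist_lt /(_ _ e0) [d /= d0 dP].
  exists d => // x xd; have := dP x xd.
  by rewrite ltr_norml => /andP[h1 h2]; lra.
have [N0 N0P] := irrational_returns aI tau0.
pose L := (N0 + n)%N.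
have half z : z + 2^-1 = z + 1%:~R / 2 by rewrite mul1r.
have gain x y : ang E2 x y L + 2^-1 <= ang E1 x y L.
  have [j jN [k kP]] := N0P (x - x0).
  have -> : L = (j + n + (N0 - j))%N by rewrite /L; lia.
  rewrite !orbit_angleD.
  set x1 := x + j%:R * alpha; set x2 := x + (j + n)%:R * alpha.
  have near : `|x0 - (x1 - k%:~R)| < tau.
    by rewrite distrC; apply: le_lt_trans kP; rewrite le_eqVlt; apply/orP; left;
       apply/eqP; congr `|_|; rewrite /x1; ring.
  have win y' : ang E2 x1 y' n + 2^-1 <= ang E1 x1 y' n.
    rewrite -[x1](subrK k%:~R) !orbit_angle_shiftZ.
    exact: (window_gain E12 u0 uout (tauP _ near)).
  rewrite half -orbit_angle_halfZ -half.
  apply: le_trans (orbit_angle_anti F alpha x2 _ _ (ltW E12)) _.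
  apply: orbit_angle_mono; apply: le_trans (win _).
  rewrite lerD2r; apply: orbit_angle_mono.
  exact: orbit_angle_anti (ltW E12).
have n0 : (0 < n)%N.
  rewrite lt0n; apply/eqP => nE; move: small; rewrite nE !big_ord0 mulr0.
  by rewrite ltxx.
have L0n : (0 < L)%N by rewrite /L addn_gt0 n0 orbT.
clearbody L.
have gains j : ang E2 0 0 (L * j) + j%:R / 2 <= ang E1 0 0 (L * j).
  elim: j => [|j IH]; first by rewrite muln0 mul0r addr0.
  rewrite mulnS addnC !orbit_angleD.
  set x := 0 + _; apply: le_trans (gain _ _).
  have -> : j.+1%:R / 2 = j%:R / 2 + 2^-1 :> R by rewrite -natr1 mulrDl mul1r.
  rewrite addrA lerD2r -[j%:R]/(j%:~R) -orbit_angle_halfZ.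
  exact: orbit_angle_mono.
have L0 : 0 < L%:R :> R by rewrite ltr0n.
pose e := (8 * L%:R)^-1 : R.
have e0 : 0 < e by rewrite invr_gt0 mulr_gt0.
move: r1 => /cvgr_dist_lt /(_ _ e0) [n1 _ n1P].
move: r2 => /cvgr_dist_lt /(_ _ e0) [n2 _ n2P].
pose j := (n1 + n2).+1.
have jn : (n1 + n2 < L * j)%N by rewrite /j leq_pmull.
have := n1P (L * j)%N; move=> /(_ (leq_trans (leq_addr n2 n1) (ltnW jn))).
have := n2P (L * j)%N; move=> /(_ (leq_trans (leq_addl n1 n2) (ltnW jn))).
have gj := gains j.
have j0 : 0 < j%:R :> R by rewrite ltr0n.
have Lj0 : 0 < (L * j)%:R :> R by rewrite natrM mulr_gt0.
have : (L * j)%:R^-1 * ang E2 0 0 (L * j) + 4 * e <= (L * j)%:R^-1 * ang E1 0 0 (L * j).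
  have -> : 4 * e = (L * j)%:R^-1 * (j%:R / 2).
    by rewrite /e natrM; field; rewrite !gt_eqF.
  by rewrite -mulrDr ler_pM2l ?invr_gt0.
rewrite !ltr_norml => h1 /andP[h2 h3] /andP[h4 h5]; lra.
Qed.

End Rotation.

(** * Fibered rotation number *)

Lemma continuous_int_cst (R : realType) (g : R -> R) :
  continuous g -> (forall x, exists k : int, g x = k%:~R) ->
  forall x y, g x = g y.
Proof.
move=> gc gZ.
suff key x y : x <= y -> g x = g y.
  by move=> x y; have [/key//|/ltW/key] := leP x y.
move=> xy; have [kx kxE] := gZ x; have [ky kyE] := gZ y.
rewrite kxE kyE; case: (ltgtP kx ky) => [lt|lt|-> //].
  have lt1 : (kx + 1)%:~R <= ky%:~R :> R by rewrite ler_int; lia.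
  have [||c _] := @IVT R g x y (kx%:~R + 2^-1) xy.
  - exact: continuous_subspaceT.
  - by rewrite intrD in lt1; rewrite kxE kyE ge_min le_max; apply/andP; split; apply/orP; [left|right]; lra.
  have [k ->] := gZ c => e.
  have h1 : kx%:~R < k%:~R :> R by rewrite e; lra.
  have h2 : k%:~R < (kx + 1)%:~R :> R by rewrite e intrD; lra.
  by move: h1 h2; rewrite !ltr_int; lia.
have lt1 : (ky + 1)%:~R <= kx%:~R :> R by rewrite ler_int; lia.
have [||c _] := @IVT R g x y (ky%:~R + 2^-1) xy.
- exact: continuous_subspaceT.
- by rewrite intrD in lt1; rewrite kxE kyE ge_min le_max; apply/andP; split; apply/orP; [right|left]; lra.
have [k ->] := gZ c => e.
have h1 : ky%:~R < k%:~R :> R by rewrite e; lra.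
have h2 : k%:~R < (ky + 1)%:~R :> R by rewrite e intrD; lra.
by move: h1 h2; rewrite !ltr_int; lia.
Qed.

Section Cocycle.
Variables (R : realType) (f : R -> R) (lam alpha : R).
Hypothesis fc : continuous f.
Implicit Types E x y r : R.
Local Notation F := (fun x => lam * f x).
Local Notation ang := (orbit_angle F alpha).

Lemma scaled_continuous : continuous F.
Proof. by move=> x; apply: cvgM; [exact: cvg_cst|exact: fc]. Qed.

Lemma col_mx11E (a b : R) (w : 'cV[R]_2) :
  w = (col_mx a%:M b%:M : 'cV_(1 + 1)) -> w 0 0 = a /\ w 1 0 = b.
Proof.
move=> ->; split.
  have e : (0 : 'I_2) = lshift 1 (0 : 'I_1) by apply: val_inj.
  by rewrite e; apply: etrans (col_mxEu _ _ _ _) _; rewrite mxE eqxx mulr1n.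
have e : (1 : 'I_2) = rshift 1 (0 : 'I_1) by apply: val_inj.
by rewrite e; apply: etrans (col_mxEd _ _ _ _) _; rewrite mxE eqxx mulr1n.
Qed.

Lemma circle_ptE y : (circle_pt y) 0 0 = c2 y /\ (circle_pt y) 1 0 = s2 y.
Proof. exact: col_mx11E. Qed.

Lemma cocycle_mulE E x y :
  let w := schrodinger_cocycle lam f E x *m circle_pt y in
  w 0 0 = (E - F x) * c2 y - s2 y /\ w 1 0 = c2 y.
Proof.
apply: col_mx11E.
have := @mul_block_col R 1 1 1 1 1 (E - lam * f x)%:M (-1)%:M 1%:M 0%:M
  (c2 y)%:M (s2 y)%:M.
by rewrite -!scalar_mxM mulN1r mul1r mul0r -!raddfD /= addr0.
Qed.

(** Two continuous lifts differ by a continuous integer-valued function, which is constant along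
    segments from the origin. The explicit lift can thus replace the arbitrary one of the
    definition. *)
Lemma lift_eq E (psi : R * R -> R) :
  projective_lift (schrodinger_cocycle lam f E) psi ->
  exists k : int, forall x y, psi (x, y) = angle_step (E - F x) y + k%:~R.
Proof.
move=> [pc _ pE].
pose D (p : R * R) := psi p - angle_step (E - F p.1) p.2.
have DZ p : exists k : int, D p = k%:~R.
  case: p => x y; have := pE x y; set w := _ *m _ => /= e.
  have [w0 w1] := cocycle_mulE E x y; rewrite -/w in w0 w1.
  have [c0 c1] := circle_ptE (y + psi (x, y)).
  have nE : euclid_norm w = img_norm (E - F x) y.
    rewrite /euclid_norm /img_norm !big_ord_recl big_ord0 addr0.
    have e1 : lift ord0 ord0 = 1 :> 'I_2 by apply: val_inj.
    congr (Num.sqrt (_ ^+ 2 + _ ^+ 2)); first exact: w0.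
    by rewrite e1; exact: w1.
  have n0 := img_norm_gt0 (E - F x) y.
  have [cT sT] := angle_mapE (E - F x) y.
  have : ex (y + psi (x, y)) = ex (angle_map (E - F x) y).
    have sE (k : R) (v : 'cV[R]_2) i : (k *: v) i 0 = k * v i 0 by rewrite mxE.
    rewrite /ex -c0 -c1 e !sE w0 w1 nE; congr (_ +i* _)%C.
      by rewrite -cT mulrC mulfK // gt_eqF.
    by rewrite -sT mulrC mulfK // gt_eqF.
  move=> /ex_inj_mod[k kE]; exists k.
  by rewrite /D /=; move: kE; rewrite /angle_map; lra.
have Dc : continuous D.
  move=> p; apply: cvgB; first exact: pc.
  apply: (continuous_angle_step (u := fun p : R * R => E - F p.1) (v := snd)).
    move=> q; apply: cvgB; first exact: cvg_cst.
    apply: (@continuous_comp _ _ _ fst F); first exact: cvg_fst.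
    exact: scaled_continuous.
  by move=> q; apply: cvg_snd.
have [k kE] := DZ (0, 0); exists k => x y.
have : D (x, y) = D (0, 0).
  have := @continuous_int_cst R (fun s => D (s * x, s * y)) _ _ 1 0.
  rewrite !mul1r !mul0r; apply.
    have hc : continuous (fun s : R => (s * x, s * y) : R * R).
      have mc (z : R) : continuous (fun s : R => s * z).
        by move=> s; apply: cvgM; [exact: cvg_id|exact: cvg_cst].
      move=> s; apply: (@cvg_pair _ _ _ _ (nbhs (s * x)) (nbhs (s * y))); exact: mc.
    by move=> s; exact: (@continuous_comp _ _ _ (fun s : R => (s * x, s * y) : R * R) D s (hc s) (Dc _)).
  by move=> s; apply: DZ.
by rewrite kE /D /= => <-; rewrite subrKC.
Qed.

Lemma rotation_orbit_angle E r :
  fibered_rotation_number alpha (schrodinger_cocycle lam f E) r ->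
  exists j : int, forall x y,
    n%:R^-1 * (ang E x y n - y) @[n --> \oo] --> r + j%:~R.
Proof.
move=> [psi [j [pl lim]]]; have [k kE] := lift_eq pl.
exists (j - k) => x y.
have step n : iter n (skew_product alpha psi) (x, y) = (x + n%:R * alpha, ang E x y n + n%:R * k%:~R).
  elim: n => [|n IH]; first by rewrite /= !mul0r !addr0.
  rewrite iterS IH /skew_product /= kE -natr1 !mulrDl !mul1r.
  have -> : angle_step (E - lam * f (x + n%:R * alpha)) (ang E x y n + n%:R * k%:~R)
          = angle_step (E - lam * f (x + n%:R * alpha)) (ang E x y n).
    apply: (addrI (ang E x y n + n%:R * k%:~R)).
    rewrite -/(angle_map _ _).
    have -> : ang E x y n + n%:R * k%:~R = ang E x y n + (2 * n%:Z * k)%:~R / 2.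
      by rewrite !rmorphM /= -[n%:~R]/(n%:R : R); congr (_ + _); field.
    by rewrite angle_map_halfZ /angle_map addrAC.
  congr (_, _); first by rewrite addrA.
  by rewrite /angle_map; ring.
have sumE n : \sum_(i < n) psi (iter i (skew_product alpha psi) (x, y)) = ang E x y n - y + n%:R * k%:~R.
  elim: n => [|n IH]; first by rewrite big_ord0 /= subrr mul0r addr0.
  rewrite big_ord_recr /= IH.
  have := congr1 snd (step n.+1); rewrite iterS /skew_product /= step /= => e.
  move: e; rewrite -step => e.
  have {}e : psi (iter n (skew_product alpha psi) (x, y)) = ang E x y n.+1 + n.+1%:R * k%:~R - (ang E x y n + n%:R * k%:~R).
    by rewrite -e addrC addKr.
  by rewrite e /=; ring.
have h : (n%:R^-1 * (\sum_(i < n) psi (iter i (skew_product alpha psi) (x, y))) - k%:~R) @[n --> \oo] --> r + j%:~R - k%:~R.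
  by apply: cvgB; [exact: (lim (x, y))|exact: cvg_cst].
rewrite intrB addrA; apply: cvg_trans h; apply: near_eq_cvg.
exists 1%N => // n /= n1; rewrite sumE mulrDr mulKf ?addrK //.
by rewrite pnatr_eq0 -lt0n.
Qed.

Lemma orbit_angle_range E n x : 0 <= ang E x 0 n <= n%:R / 2.
Proof.
have lo (t : R) : 0 <= angle_map t 0.
  by rewrite -{1}(angle_map_quarter t); apply: angle_map_mono; lra.
have hi (t : R) : angle_map t 0 <= 2^-1.
  have -> : 2^-1 = angle_map t (- 4^-1 + 1%:~R / 2).
    by rewrite angle_map_halfZ angle_map_quarter add0r mul1r.
  by apply: angle_map_mono; lra.
elim: n => [|n /andP[h1 h2]] /=; first by rewrite mul0r lexx.
set t := E - _; apply/andP; split.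
  by apply: le_trans (lo t) _; apply: angle_map_mono.
apply: (@le_trans _ _ (angle_map t (n%:R / 2))); first exact: angle_map_mono.
rewrite -[n%:R / 2]add0r -[n%:R]/(n%:~R) angle_map_halfZ.
have -> : n.+1%:R / 2 = 2^-1 + n%:R / 2 :> R by rewrite -[n.+1%:R]natr1 mulrDl mul1r addrC.
by rewrite lerD2r.
Qed.

Lemma canonical_rotation_range E r :
  (n%:R^-1 * (ang E 0 0 n - 0) @[n --> \oo] --> r) -> 0 <= r <= 2^-1.
Proof.
move=> h; apply/andP; split.
  apply: (ler_cvg_to (cvg_cst 0) h); near=> n.
  by rewrite subr0 mulr_ge0 ?invr_ge0 //; have /andP[] := orbit_angle_range E n 0.
have h2 : (2^-1 : R) @[_ --> \oo] --> (2^-1 : R) by apply: cvg_cst.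
apply: (ler_cvg_to h h2); near=> n.
have n0 : 0 < n%:R :> R by rewrite ltr0n; near: n; exists 1%N.
rewrite subr0 mulrC ler_pdivrMr // mulrC.
by have /andP[] := orbit_angle_range E n 0.
Unshelve. all: by end_near. Qed.

(** Since [2 rho] is not an integer, [rho] is strictly inside [[0, 1/2]]. The explicit lift has its
    mean in [[0, 1/2]] too, so no integer remains between the two. *)
Lemma rho_gap E (m j : int) : irrational alpha -> m != 0 ->
  2 * rho lam f alpha E = m%:~R * alpha + j%:~R ->
  [/\ 0 < rho lam f alpha E < 2^-1 & forall x y,
     n%:R^-1 * (ang E x y n - y) @[n --> \oo] --> rho lam f alpha E].
Proof.
move=> aI m0 rE.
have noint (i : int) : 2 * rho lam f alpha E <> i%:~R.
  rewrite rE => e; apply: aI; apply/rationalP.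
  have mr : m%:~R != 0 :> R by rewrite intr_eq0.
  have aE : alpha = (i - j)%:~R / m%:~R.
    by apply: (mulIf mr); rewrite mulfVK // intrB -e addrK mulrC.
  case: m m0 aE {rE e mr} => n n0 aE; first by exists (i - j), n.
  exists (j - i), n.+1; rewrite aE NegzE rmorphN /= invrN mulrN -mulNr -rmorphN opprB.
  by [].
have rP : [set r | 0 <= r <= 2^-1 /\ fibered_rotation_number alpha (schrodinger_cocycle lam f E) r] (rho lam f alpha E).
  (* If no rotation number existed, [rho] would be the default 0, and [2 rho] an integer. *)
  rewrite /rho; case: xgetP => [r -> //|no].
  exfalso; apply: (noint 0); rewrite /rho; case: xgetP => [r rE' rP|_]; last by rewrite mulr0.
  by have := no r.
case: rP => /andP[r0 r1] /rotation_orbit_angle[i lim].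
have rn : 0 < rho lam f alpha E < 2^-1.
  apply/andP; split; rewrite lt_neqAle ?r0 ?r1 andbT; apply/eqP => e.
    by apply: (noint 0); rewrite -e mulr0.
  by apply: (noint 1); rewrite e mulfV // pnatr_eq0.
have /andP[h1 h2] := canonical_rotation_range (lim 0 0).
have i0 : i = 0.
  case/andP: rn => rn1 rn2.
  have : `|i%:~R : R| < 1 by rewrite ltr_norml; apply/andP; split; lra.
  by rewrite -intr_norm ltrz1; lia.
split=> // x y; have := lim x y; by rewrite i0 addr0.
Qed.

End Cocycle.

(** * Decaying solutions *)

Lemma unit_angle (R : realType) (a b : R) : a ^+ 2 + b ^+ 2 = 1 ->
  exists2 y, 0 <= y <= 1 & c2 y = a /\ s2 y = b.
Proof.
move=> ab.
have a1 : -1 <= a <= 1.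
  rewrite -ler_norml -(ler_pXn2r (n := 2)) ?nnegrE // expr1n real_normK ?num_real //.
  by rewrite -ab lerDl sqr_ge0.
have p0 := pi_gt0 R.
have pn : 2 * pi != 0 :> R by rewrite mulf_neq0 ?pnatr_eq0 // gt_eqF.
have ca := acosK a1; have sa := sin_acos a1.
have /andP[A0 Api] : 0 <= acos a <= pi by rewrite acos_ge0 // acos_lepi.
have sb : Num.sqrt (1 - a ^+ 2) = `|b| by rewrite -ab addrAC subrr add0r sqrtr_sqr.
rewrite sb in sa.
pose z := acos a / (2 * pi).
have ze : 2 * pi * z = acos a by rewrite /z mulrCA mulfV ?mulr1.
have z0 : 0 <= z by rewrite divr_ge0 // mulr_ge0 // ltW.
have z1 : z <= 1 by rewrite ler_pdivrMr ?mulr_gt0 //; lra.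
have cz : c2 z = a by rewrite /c2 ze.
have sz : s2 z = `|b| by rewrite /s2 ze.
have [b0|b0] := leP 0 b.
  by exists z; [rewrite z0|rewrite cz sz ger0_norm].
exists (1 - z); first by apply/andP; split; lra.
have -> : 1 - z = - z + 1%:~R by rewrite addrC.
by rewrite c2DZ s2DZ c2N s2N cz sz ltr0_norm ?opprK.
Qed.

Section HalfLine.
Variables (R : realType).
Implicit Types V p g u : nat -> R.

Fixpoint solution_pair V (a b : R) (n : nat) : R * R :=
  if n is k.+1 then
    let q := solution_pair V a b k in (q.2, - q.1 - V k.+1 * q.2)
  else (a, b).

Definition solution V a b n : R := (solution_pair V a b n).1.

Lemma solution0 V a b : solution V a b 0 = a. Proof. by []. Qed.
Lemma solution1 V a b : solution V a b 1 = b. Proof. by []. Qed.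

Lemma solutionSS V a b n :
  solution V a b n.+2 + solution V a b n + V n.+1 * solution V a b n.+1 = 0.
Proof. by rewrite /solution /=; ring. Qed.

Lemma solution_lin V a b n :
  solution V a b n = a * solution V 1 0 n + b * solution V 0 1 n.
Proof.
suff : solution V a b n = a * solution V 1 0 n + b * solution V 0 1 n /\
   solution V a b n.+1 = a * solution V 1 0 n.+1 + b * solution V 0 1 n.+1 by case.
elim: n => [|n [IH1 IH2]]; first by rewrite /solution /=; split; ring.
split=> //.
have e a' b' : solution V a' b' n.+2 = - solution V a' b' n - V n.+1 * solution V a' b' n.+1.
  by [].
by rewrite !e IH1 IH2; ring.
Qed.

Lemma solution_wronskian V n :
  solution V 1 0 n * solution V 0 1 n.+1 - solution V 1 0 n.+1 * solution V 0 1 n = 1.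
Proof.
elim: n => [|n IH]; first by rewrite /solution /=; ring.
have e a' b' : solution V a' b' n.+2 = - solution V a' b' n - V n.+1 * solution V a' b' n.+1.
  by [].
by rewrite !e -[RHS]IH; ring.
Qed.

(* A unimodular 2 x 2 matrix cannot expand every unit vector. *)
Lemma nonexpanding_solution V n : exists a b : R, a ^+ 2 + b ^+ 2 = 1 /\
  solution V a b n ^+ 2 + solution V a b n.+1 ^+ 2 <= 1.
Proof.
set A := solution V 1 0 n; set B := solution V 0 1 n.
set A' := solution V 1 0 n.+1; set B' := solution V 0 1 n.+1.
have W : A * B' - A' * B = 1 by exact: solution_wronskian.
pose P := A ^+ 2 + A' ^+ 2; pose Q := A * B + A' * B'; pose S := B ^+ 2 + B' ^+ 2.
have PQS : P * S - Q ^+ 2 = 1.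
  by rewrite /P /Q /S -[RHS](expr1n _ 2) -W; ring.
have P0 : 0 <= P by rewrite addr_ge0 ?sqr_ge0.
have S0 : 0 <= S by rewrite addr_ge0 ?sqr_ge0.
have val a b : solution V a b n ^+ 2 + solution V a b n.+1 ^+ 2 = P * a ^+ 2 + 2 * Q * a * b + S * b ^+ 2.
  by rewrite !(solution_lin V a b) -/A -/B -/A' -/B' /P /Q /S; ring.
have [P1|P1] := leP P 1.
  by exists 1, 0; rewrite val !expr0n !expr1n /=; split; [ring|lra].
(* At the vector [(-Q, P - 1)] the Gram form minus the squared norm equals [(P - 1) ((P - 1)(S - 1)
   - Q^2) = (P - 1)(2 - P - S)], because the form has determinant 1; its trace [P + S] is then at
   least 2. *)
pose m := Q ^+ 2 + (P - 1) ^+ 2.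
have m0 : 0 < m by rewrite ltr_wpDl ?sqr_ge0 // exprn_gt0 // subr_gt0.
pose k := Num.sqrt m.
have k2 : k ^+ 2 = m by rewrite sqr_sqrtr // ltW.
have k0 : k != 0 by rewrite -sqrf_eq0 k2 gt_eqF.
exists (- Q / k), ((P - 1) / k); split.
  by rewrite !expr_div_n k2 -mulrDl sqrrN mulfV // gt_eqF.
rewrite val.
have -> : P * (- Q / k) ^+ 2 + 2 * Q * (- Q / k) * ((P - 1) / k) + S * ((P - 1) / k) ^+ 2
  = (P * Q ^+ 2 - 2 * Q ^+ 2 * (P - 1) + S * (P - 1) ^+ 2) / m.
  by rewrite -k2; field.
rewrite ler_pdivrMr // mul1r /m.
have PS2 : 2 <= P + S.
  have : 1 <= P * S by rewrite -PQS lerBlDr lerDl sqr_ge0.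
  have := sqr_ge0 (P - S); nra.
have : (P - 1) * (2 - P - S) <= 0 by apply: mulr_ge0_le0; lra.
have -> : 2 - P - S = (P - 1) * (S - 1) - Q ^+ 2.
  have -> : 2 = 1 + 1 :> R by ring.
  by rewrite -{1}PQS; ring.
nra.
Qed.

Definition half_line_bounded V (dl : R) : Prop :=
  forall n u, u 0%N = 0 -> (forall i, (n <= i.+1)%N -> u i = 0) ->
    dl ^+ 2 * (\sum_(i < n) u i ^+ 2)
      <= \sum_(i < n) (u i.+1 + u i.-1 + V i * u i) ^+ 2.

(** For an exact solution cut to [1..N] the errors at 0, 1, [N], [N + 1] are, up to sign, [b], [a]
    and the solution at [N + 1] and [N]; [1 < N] keeps these sites distinct. *)
Lemma half_line_cut V dl a b N : half_line_bounded V dl -> (1 < N)%N ->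
  dl ^+ 2 * (\sum_(i < N) solution V a b i.+1 ^+ 2)
   <= a ^+ 2 + b ^+ 2 + solution V a b N ^+ 2 + solution V a b N.+1 ^+ 2.
Proof.
move=> lb N1; pose p := solution V a b.
pose u n : R := if (0 < n <= N)%N then p n else 0.
have u0 : u 0%N = 0 by [].
have uout i : (N.+2 <= i.+1)%N -> u i = 0.
  by move=> iM; rewrite /u ifN //; lia.
have := lb N.+2 u u0 uout.
have -> : \sum_(i < N.+2) u i ^+ 2 = \sum_(n < N) p n.+1 ^+ 2.
  rewrite -(big_mkord xpredT (fun i => u i ^+ 2)) big_nat_recl // big_nat_recr //=.
  rewrite (uout N.+1) // u0 expr0n add0r addr0 big_mkord.
  by apply: eq_bigr => i _; rewrite /u /= ltn_ord.
move=> h; apply: le_trans h _.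
pose G i := (u i.+1 + u i.-1 + V i * u i) ^+ 2.
rewrite -(big_mkord xpredT G) big_nat_recl // big_nat_recr //=.
have e0 : G 0%N = b ^+ 2.
  by rewrite /G u0 mulr0 !addr0 /u ifT ?(ltnW N1).
have eN1 : G N.+1 = p N ^+ 2.
  rewrite /G /= (uout N.+1) // (uout N.+2) // mulr0 addr0 add0r /u ifT //.
  by rewrite leqnn andbT; lia.
have mid i : (1 < i < N)%N -> G i = 0.
  move=> iN; have [j ij] : exists j, i = j.+2 by exists i.-2; lia.
  rewrite /G ij /= {1}/u ifT; last by lia.
  rewrite /u ifT; last by lia.
  rewrite ifT; last by lia.
  by rewrite (solutionSS V a b j.+1) expr0n.
have e1 : G 1%N = a ^+ 2.
  rewrite /G /= u0 addr0 /u ifT; last by lia.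
  rewrite ifT; last by lia.
  have := solutionSS V a b 0; rewrite -/p -[p 0%N]/a => e.
  have -> : p 2%N + V 1%N * p 1%N = - a by rewrite -[RHS]add0r -e; ring.
  by rewrite sqrrN.
have eN : G N = p N.+1 ^+ 2.
  have [j Nj] : exists j, N = j.+2 by exists N.-2; lia.
  rewrite /G (uout N.+1) // add0r Nj /= /u ifT; last by lia.
  rewrite ifT; last by lia.
  have := solutionSS V a b j.+1; rewrite -/p => e.
  have -> : p j.+1 + V j.+2 * p j.+2 = - p j.+3 by rewrite -[RHS]add0r -e; ring.
  by rewrite sqrrN.
have -> : \sum_(0 <= i < N) G i.+1 = a ^+ 2 + p N.+1 ^+ 2.
  case: (N) N1 eN mid => [|[|k]] // _ eN mid.
  rewrite big_nat_recl // big_nat_recr //= eN e1 big_nat_cond big1 ?add0r // => i ik.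
  by apply: mid; lia.
rewrite e0 eN1 -/p; lra.
Qed.

Lemma continuous_solution V n :
  continuous (fun y => solution V (s2 y) (c2 y) n).
Proof.
have -> : (fun y => solution V (s2 y) (c2 y) n)
  = (fun y => s2 y * solution V 1 0 n + c2 y * solution V 0 1 n).
  by apply/funext => y; rewrite solution_lin.
move=> y; apply: cvgD; apply: cvgM; first exact: continuous_s2; first exact: cvg_cst.
  exact: continuous_c2.
exact: cvg_cst.
Qed.

(** For each length take a unit initial vector that is not expanded: the four boundary terms sum to
    at most 2, uniformly in the length. A cluster point of the initial angles serves all lengths at
    once. *)
Lemma decaying_solution V dl : 0 < dl -> half_line_bounded V dl ->
  exists y, forall n, \sum_(i < n) solution V (s2 y) (c2 y) i.+1 ^+ 2 <= (2 / dl) ^+ 2.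
Proof.
move=> dl0 lb.
pose S n y := \sum_(i < n) solution V (s2 y) (c2 y) i.+1 ^+ 2.
have S_mono n m y : (n <= m)%N -> S n y <= S m y.
  move=> nm; rewrite /S -!(big_mkord xpredT (fun i => solution V (s2 y) (c2 y) i.+1 ^+ 2)).
  rewrite [leRHS](@big_cat_nat _ _ _ n) //= lerDl sumr_ge0 // => i _.
  exact: sqr_ge0.
have ex N : exists y, 0 <= y <= 1 /\ S N.+2 y <= (2 / dl) ^+ 2.
  have [a [b [ab le1]]] := nonexpanding_solution V N.+2.
  have [|y y01 [cy sy]] := @unit_angle R b a; first by rewrite addrC.
  exists y; split=> //; have := @half_line_cut V dl a b N.+2 lb isT.
  rewrite -{1}sy -{1}cy -/(S _ y) => h.
  rewrite expr_div_n ler_pdivlMr ?exprn_gt0 // mulrC; move: h le1.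
  rewrite ab; lra.
have [ys yP] := choice ex.
have cpt : compact (`[0, 1]%classic : set R) by apply: segment_compact.
have := cpt (ys @ \oo); case.
  by exists 0%N => // n _ /=; have [] := yP n; rewrite in_itv.
move=> y [_ cl]; exists y => n; rewrite -/(S n y) leNgt; apply/negP => lt.
have Sc : continuous (S n).
  apply: (continuous_sum_ord (g := fun i y => solution V (s2 y) (c2 y) i.+1 ^+ 2)) => i z.
  exact: (continuousM (@continuous_solution V i.+1 z) (@continuous_solution V i.+1 z)).
have nb : nbhs y [set z | (2 / dl) ^+ 2 < S n z].
  exact: (cvgr_gt _ (Sc y) _ lt).
have ev : (ys @ \oo) [set z | S n z <= (2 / dl) ^+ 2].
  exists n => // k /= nk; have [_ h] := yP k.
  apply: le_trans h; apply: S_mono; exact: leq_trans nk (leqW (leqnSn _)).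
have [z [/= h1 h2]] := cl _ _ ev nb.
by move: h1; rewrite leNgt h2.
Qed.

(* The Wronskian of an l2 solution with a bounded approximate solution telescopes
   to its value at a place where the solution is small. *)
Lemma wronskian_bound V (a b s B eps : R) g (nu : nat) :
  (forall n, \sum_(i < n) solution V a b i.+1 ^+ 2 <= s ^+ 2) -> 0 <= s ->
  (0 < nu)%N -> 0 <= eps ->
  (forall i, (i <= (nu ^ 2).+1)%N -> `|g i| <= B) ->
  (forall i, (i < nu ^ 2)%N -> `|g i.+2 + g i + V i.+1 * g i.+1| <= eps) ->
  `|g 1%N * a - g 0%N * b| <= 2 * B * s / nu%:R + eps * (nu ^ 2)%:R * s.
Proof.
move=> sl s0 nu0 eps0 gB geps; set p := solution V a b in sl.
have nur : 0 < nu%:R :> R by rewrite ltr0n.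
have B0 : 0 <= B by apply: le_trans (gB 0%N _).
set M := (nu ^ 2)%N in gB geps *.
have M0 : (0 < M)%N by rewrite expn_gt0 nu0.
have MR : M%:R = nu%:R ^+ 2 :> R by rewrite natrX.
(* Pigeonhole on [nu ^ 2] consecutive pairs; the square makes the resulting amplitude of order
   [s / nu]. *)
have [n nM small] : exists2 n, (n < M)%N & p n.+1 ^+ 2 + p n.+2 ^+ 2 <= 2 * s ^+ 2 / M%:R.
  case: (boolP [exists n : 'I_M, p n.+1 ^+ 2 + p n.+2 ^+ 2 <= 2 * s ^+ 2 / M%:R]).
    by move=> /existsP[n h]; exists n.
  rewrite negb_exists => /forallP no; exfalso.
  have : \sum_(n < M) (2 * s ^+ 2 / M%:R) < \sum_(n < M) (p n.+1 ^+ 2 + p n.+2 ^+ 2).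
    apply: ltr_sum => [|n _]; last by rewrite ltNge no.
    by apply/hasP; exists (Ordinal M0); rewrite ?mem_index_enum.
  rewrite sumr_const card_ord -[_ *+ M]mulr_natr mulfVK ?pnatr_eq0 -?lt0n //.
  rewrite big_split /= => h.
  have h1 := sl M.
  have h2 : \sum_(i < M) p i.+2 ^+ 2 <= s ^+ 2.
    apply: le_trans (sl M.+1); rewrite big_ord_recl lerDr; exact: sqr_ge0.
  by lra.
have ps i : `|p i.+1| <= s.
  rewrite -(ler_pXn2r (n := 2)) ?nnegrE // real_normK ?num_real //.
  by apply: le_trans (sl i.+1); rewrite big_ord_recr /= lerDr sumr_ge0 // => j _; apply: sqr_ge0.
pose W i := g i.+1 * p i - g i * p i.+1.
have WS i : W i.+1 - W i = p i.+1 * (g i.+2 + g i + V i.+1 * g i.+1).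
  have e := solutionSS V a b i; rewrite -/p in e.
  have -> : p i.+1 * (g i.+2 + g i + V i.+1 * g i.+1) = p i.+1 * (g i.+2 + g i + V i.+1 * g i.+1)
     - g i.+1 * (p i.+2 + p i + V i.+1 * p i.+1) by rewrite e mulr0 subr0.
  by rewrite /W; ring.
have Wdiff k : (k <= M)%N -> `|W k - W 0%N| <= k%:R * (eps * s).
  elim: k => [|k IH] kM; first by rewrite subrr normr0 mul0r.
  have -> : W k.+1 - W 0%N = (W k.+1 - W k) + (W k - W 0%N) by ring.
  have -> : k.+1%:R * (eps * s) = eps * s + k%:R * (eps * s) by rewrite -natr1; ring.
  apply: le_trans (ler_normD _ _) _; apply: lerD; last exact: IH (ltnW kM).
  by rewrite WS normrM mulrC; apply: ler_pM => //; apply: geps.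
have Wn : `|W n.+1| <= 2 * B * s / nu%:R.
  have psum : `|p n.+1| + `|p n.+2| <= 2 * s / nu%:R.
    rewrite -(ler_pXn2r (n := 2)) ?nnegrE ?addr_ge0 ?divr_ge0 ?mulr_ge0 //.
    rewrite expr_div_n -MR exprMn.
    have e : (2 ^+ 2 * s ^+ 2) / M%:R = 2 * (2 * s ^+ 2 / M%:R) by ring.
    rewrite e; have := sqr_ge0 (`|p n.+1| - `|p n.+2|).
    have e1 := real_normK (num_real (p n.+1)); have e2 := real_normK (num_real (p n.+2)).
    move: small; rewrite -e1 -e2; move: (2 * s ^+ 2 / M%:R) => X; rewrite !expr2; lra.
  apply: le_trans (ler_normB _ _) _; rewrite !normrM.
  apply: (@le_trans _ _ (B * (`|p n.+1| + `|p n.+2|))).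
    rewrite mulrDr; apply: lerD; apply: ler_wpM2r => //; apply: gB; lia.
  have -> : 2 * B * s / nu%:R = B * (2 * s / nu%:R) by ring.
  by rewrite ler_wpM2l.
have -> : g 1%N * a - g 0%N * b = W n.+1 - (W n.+1 - W 0%N) by rewrite subKr.
apply: le_trans (ler_normB _ _) _; apply: lerD => //.
apply: le_trans (Wdiff _ nM) _.
have -> : eps * M%:R * s = M%:R * (eps * s) by ring.
by rewrite ler_wpM2r ?mulr_ge0 // ler_nat.
Qed.

End HalfLine.

Section StableDirection.
Variables (R : realType) (F : R -> R) (alpha E dl : R).

Definition pot (x : R) (i : nat) : R := F (x + i%:R * alpha) - E.

Lemma forward_half_line x : lower_bounded F alpha E dl -> half_line_bounded (pot x) dl.
Proof. by move=> lb n u u0 uN; apply: lb. Qed.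

Lemma backward_half_line x : lower_bounded F alpha E dl ->
  half_line_bounded (fun i => F (x - i%:R * alpha) - E) dl.
Proof.
move=> lb [|m] u u0 uN; first by rewrite !big_ord0 mulr0.
have rev (H : nat -> R) : \sum_(i < m.+1) H i = \sum_(i < m.+1) H (m - i)%N.
  by rewrite (reindex_inj rev_ord_inj) /=; apply: eq_bigr => i _; rewrite subSS.
have := lb (x - m%:R * alpha) m.+1 (fun i => u (m - i)%N).
rewrite subn0 => h; have {h} := h (uN _ (leqnn _)).
have vN i : (m.+1 <= i.+1)%N -> u (m - i)%N = 0.
  by rewrite ltnS -subn_eq0 => /eqP->.
move=> /(_ vN); rewrite -(rev (fun i => u i ^+ 2)) => /le_trans; apply.
rewrite (rev (fun i => (u i.+1 + u i.-1 + (F (x - i%:R * alpha) - E) * u i) ^+ 2)).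
rewrite le_eqVlt; apply/orP; left; apply/eqP; apply: eq_bigr => i _.
have im : (i <= m)%N by rewrite -ltnS.
rewrite -subnS natrB //.
have -> : x - m%:R * alpha + i%:R * alpha = x - (m%:R - i%:R) * alpha by ring.
have -> : u (m - i.-1)%N = u (m - i).+1.
  case: (nat_of_ord i) im => [|j] jm; last by congr u; rewrite subnS prednK // subn_gt0.
  by rewrite subn0 !uN.
by rewrite subnS; ring.
Qed.

Definition square_summable (V : nat -> R) (y : R) (s : R) : Prop :=
  forall n, \sum_(i < n) solution V (s2 y) (c2 y) i.+1 ^+ 2 <= s ^+ 2.

Lemma solution_half_turn (V : nat -> R) (y : R) (k : int) n :
  solution V (s2 (y + k%:~R / 2)) (c2 (y + k%:~R / 2)) n ^+ 2
  = solution V (s2 y) (c2 y) n ^+ 2.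
Proof.
have [[ck sk]] : (c2 (k%:~R / 2) ^+ 2 = 1 :> R) * (s2 (k%:~R / 2) = 0 :> R).
  have := c2s2 (k%:~R / 2 : R).
  have := s2D (k%:~R / 2 : R) (k%:~R / 2); have := c2D (k%:~R / 2 : R) (k%:~R / 2).
  rewrite -splitr; have [-> ->] := c2s2_int R k => e1 e2 e3.
  have e : c2 (k%:~R / 2 : R) ^+ 2 = 1 by rewrite !expr2 in e3 *; lra.
  split=> //; apply/eqP; rewrite -sqrf_eq0 expr2; apply/eqP.
  by move: e1; rewrite -expr2 e; lra.
rewrite s2D c2D sk !mulr0 addr0 subr0 solution_lin [in RHS]solution_lin.
set A := solution V 1 0 n; set B := solution V 0 1 n.
have -> : s2 y * c2 (k%:~R / 2) * A + c2 y * c2 (k%:~R / 2) * B =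
   c2 (k%:~R / 2) * (s2 y * A + c2 y * B) by ring.
by rewrite exprMn ck mul1r.
Qed.

Lemma square_summable_bound (V : nat -> R) (y s : R) : square_summable V y s -> 0 <= s ->
  forall i, `|solution V (s2 y) (c2 y) i| <= 1 + s.
Proof.
move=> ss s0 [|i].
  apply: (@le_trans _ _ 1); last by rewrite lerDl.
  rewrite solution0 -(ler_pXn2r (n := 2)) ?nnegrE // expr1n real_normK ?num_real //.
  by rewrite -(c2s2 y) lerDr sqr_ge0.
apply: (@le_trans _ _ s); last by rewrite lerDr.
rewrite -(ler_pXn2r (n := 2)) ?nnegrE // real_normK ?num_real //.
by apply: le_trans (ss i.+1); rewrite big_ord_recr /= lerDr sumr_ge0 // => j _; apply: sqr_ge0.
Qed.

Lemma dist_small (d e : R) : dist_to_Z (2 * d) <= e -> `|d| <= 1 / 3 -> e < 1 / 3 ->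
  `|d| <= e.
Proof.
move=> de d3 e3; have [k kP] := dist_to_Z_attained (2 * d).
rewrite kP in de.
have [k0|k0] := eqVneq k 0.
  move: de; rewrite k0 subr0 normrM ger0_norm // => de.
  by have := normr_ge0 d; lra.
have k1 : 1 <= `|k%:~R| :> R.
  by rewrite -intr_norm -[1]/(1%:~R) ler_int; move: k0; lia.
have : `|k%:~R| <= `|2 * d| + `|2 * d - k%:~R| :> R.
  by rewrite -[X in `|X| <= _](subKr (2 * d)); apply: ler_normB.
by rewrite normrM ger0_norm //; lra.
Qed.

(** The decaying solution at [x'] is a bounded approximate solution at [x], so its Wronskian with
    the decaying solution at [x] is small. This gives continuity of the decaying direction and, for
    [x = x'], its uniqueness. *)
Lemma wedge_stable x x' y y' s (nu : nat) (eps : R) : 0 <= s -> (0 < nu)%N -> 0 <= eps ->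
  square_summable (pot x) y s -> square_summable (pot x') y' s ->
  (forall i : nat, `|pot x i - pot x' i| <= eps) ->
  `|s2 (y - y')| <= 2 * (1 + s) * s / nu%:R + eps * (1 + s) * (nu ^ 2)%:R * s.
Proof.
move=> s0 nu0 eps0 sx sx' close.
have := @wronskian_bound R (pot x) (s2 y) (c2 y) s (1 + s) (eps * (1 + s))
  (solution (pot x') (s2 y') (c2 y')) nu sx s0 nu0.
have s1 : 0 <= 1 + s by rewrite addr_ge0.
move=> /(_ (mulr_ge0 eps0 s1)) /(_ (fun i _ => square_summable_bound sx' s0 i)).
rewrite solution0 solution1 => h.
have -> : s2 (y - y') = c2 y' * s2 y - s2 y' * c2 y.
  by rewrite s2D c2N s2N; ring.
apply: h => i _.
have e := solutionSS (pot x') (s2 y') (c2 y') i.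
set p := solution _ _ _ in e *.
have -> : p i.+2 + p i + pot x i.+1 * p i.+1 = (pot x i.+1 - pot x' i.+1) * p i.+1.
  by rewrite -[RHS]add0r -e; ring.
rewrite normrM; apply: ler_pM => //; exact: square_summable_bound.
Qed.

Lemma stable_unique x y y' s : 0 <= s ->
  square_summable (pot x) y s -> square_summable (pot x) y' s ->
  exists k : int, y = y' + k%:~R / 2.
Proof.
move=> s0 sy sy'.
have z : s2 (y - y') = 0.
  apply/eqP; rewrite -normr_le0 leNgt; apply/negP => p0.
  set D := 2 * (1 + s) * s.
  have D0 : 0 <= D by rewrite !mulr_ge0 // addr_ge0.
  pose nu' := (Num.bound (D / `|s2 (y - y')|)).
  have nu0 : (0 < nu')%N.
    by rewrite -(ltr0n R); apply: le_lt_trans (archi_boundP _); rewrite divr_ge0 // ltW.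
  have := @wedge_stable x x y y' s nu' 0 s0 nu0 (lexx _) sy sy'.
  have h : forall i : nat, `|pot x i - pot x i| <= 0 by move=> i; rewrite subrr normr0.
  move=> /(_ h); rewrite !mul0r addr0 -/D leNgt => /negP; apply.
  rewrite ltr_pdivrMr ?ltr0n // mulrC -ltr_pdivrMr //.
  by apply: archi_boundP; rewrite divr_ge0 // ltW.
have e : c2 (2 * (y - y')) = 1.
  have -> : 2 * (y - y') = (y - y') + (y - y') by ring.
  by rewrite c2D z mulr0 subr0 -[RHS](c2s2 (y - y')) z expr0n addr0 expr2.
have [k kE] := c2_eq1 e; exists k; move: kE; lra.
Qed.

(** Dropping the first site of a decaying solution leaves a decaying solution of the shifted
    equation: the direction is invariant under the cocycle. The constant worsens by the
    normalisation [m]. *)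
Lemma stable_step x y s : square_summable (pot x) y s -> 0 <= s ->
  exists2 s' : R, 0 <= s' &
    square_summable (pot (x + alpha)) (angle_map (E - F (x + alpha)) y) s'.
Proof.
move=> sx s0; set t := E - F (x + alpha); set z := angle_map t y.
have [e1 e2] := angle_mapE t y; have n0 := img_norm_gt0 t y.
set m := img_norm t y in e1 e2 n0.
have key n : solution (pot x) (s2 y) (c2 y) n.+1
    = m * solution (pot (x + alpha)) (s2 z) (c2 z) n /\
   solution (pot x) (s2 y) (c2 y) n.+2
    = m * solution (pot (x + alpha)) (s2 z) (c2 z) n.+1.
  elim: n => [|n [IH1 IH2]].
    rewrite solution0 !solution1 mulrC e2; split=> //.
    rewrite mulrC e1; have := solutionSS (pot x) (s2 y) (c2 y) 0.
    by rewrite solution0 solution1 /pot mul1r /t; lra.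
  split=> //; have := solutionSS (pot x) (s2 y) (c2 y) n.+1.
  have := solutionSS (pot (x + alpha)) (s2 z) (c2 z) n.
  have -> : pot x n.+2 = pot (x + alpha) n.+1.
    by rewrite /pot; congr (F _ - _); rewrite -[in LHS]natr1; ring.
  rewrite IH1 IH2; set p := solution (pot (x + alpha)) _ _.
  set q := solution _ _ _ => h1 h2.
  have -> : m * p n.+2 = m * p n.+2 - m * (p n.+2 + p n + pot (x + alpha) n.+1 * p n.+1).
    by rewrite h1 mulr0 subr0.
  by rewrite -[LHS]subr0 -h2; ring.
exists (s / m); first by rewrite divr_ge0 // ltW.
move=> n; have := sx n.+1; rewrite big_ord_recl => h.
rewrite expr_div_n ler_pdivlMr ?exprn_gt0 // mulr_suml.
apply: le_trans h; rewrite -[leLHS]add0r; apply: lerD; first exact: sqr_ge0.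
by apply: ler_sum => i _; rewrite /bump /= ?add1n (key i).2 exprMn mulrC.
Qed.

End StableDirection.

(** * Winding numbers *)

Section Winding.
Variable R : realType.
Local Notation C := R[i]%C.
Implicit Types (p : {poly C}) (q : R -> C).

(* n is the mean speed of a continuous argument of q. *)
Definition winds (n : R) q : Prop := exists (a : R -> R) (B : R),
  [/\ continuous a, forall x, `|a x - n * x| <= B &
      forall x, exists2 r : R, 0 < r & q x = r%:C%C * ex (a x)].

Lemma winds_mul m n q q' : winds m q -> winds n q' ->
  winds (m + n) (fun x => q x * q' x).
Proof.
move=> [a [B [ac aB aq]]] [a' [B' [ac' aB' aq']]].
exists (fun x => a x + a' x), (B + B'); split.
- by move=> x; apply: cvgD; [exact: ac|exact: ac'].
- move=> x; have -> : a x + a' x - (m + n) * x = (a x - m * x) + (a' x - n * x) by ring.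
  by apply: le_trans (ler_normD _ _) _; apply: lerD.
move=> x; have [r r0 ->] := aq x; have [r' r0' ->] := aq' x.
by exists (r * r'); [exact: mulr_gt0|rewrite exD rmorphM /=; ring].
Qed.

Lemma winds_ex : winds 1 (@ex R).
Proof.
exists id, 0; split.
- by move=> x; apply: cvg_id.
- by move=> x; rewrite mul1r subrr normr0.
- by move=> x; exists 1; rewrite // mul1r.
Qed.

Lemma winds_cst (c : C) : c != 0 -> winds 0 (fun=> c).
Proof.
move=> c0; have n0 : 0 < nsq c.
  by rewrite -ltcR nsqE exprn_gt0 // normr_gt0.
pose r := Num.sqrt (nsq c).
have r0 : 0 < r by rewrite sqrtr_gt0.
have r2 : r ^+ 2 = nsq c by rewrite sqr_sqrtr // ltW.
have [|y _ [cy sy]] := @unit_angle R (complex.Re c / r) (complex.Im c / r).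
  by rewrite !expr_div_n -mulrDl r2 divff // gt_eqF.
exists (fun=> y), `|y|; split.
- by move=> x; apply: cvg_cst.
- by move=> x; rewrite mul0r subr0.
move=> _; exists r => //; rewrite /ex cy sy.
case: c c0 n0 r r0 r2 cy sy => u v /= _ _ r r0 _ _ _.
have e t : r * (t / r) = t by rewrite mulrC mulfVK // gt_eqF.
by apply/eqP; rewrite eq_complex /= !mul0r subr0 addr0 !e !eqxx.
Qed.

Lemma winds_right_half_plane q :
  continuous (fun x => complex.Re (q x)) -> continuous (fun x => complex.Im (q x)) ->
  (forall x, 0 < complex.Re (q x)) -> winds 0 q.
Proof.
move=> rc ic q0; pose z x := complex.Im (q x) / complex.Re (q x).
have p0 := pi_gt0 R.
have zE x : 2 * pi * (atan (z x) / (2 * pi)) = atan (z x).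
  by rewrite mulrC mulfVK // mulf_neq0 // ?gt_eqF.
exists (fun x => atan (z x) / (2 * pi)), 1; split.
- move=> x; apply: cvgM; last exact: cvg_cst.
  apply: (@continuous_comp _ _ _ z atan); last exact: continuous_atan.
  apply: cvgM; [exact: ic|apply: cvgV; [exact: lt0r_neq0|exact: rc]].
- move=> x; rewrite mul0r subr0 normrM normfV [`|2 * pi|]gtr0_norm ?mulr_gt0 //.
  rewrite ler_pdivrMr ?mulr_gt0 // mul1r ler_norml.
  have := atan_gtNpi2 (z x); have := atan_ltpi2 (z x); lra.
move=> x; have c0 : 0 < cos (atan (z x)).
  by rewrite cos_atan invr_gt0 sqrtr_gt0 ltr_pwDl ?sqr_ge0.
exists (complex.Re (q x) / cos (atan (z x))); first by rewrite divr_gt0.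
have tE : sin (atan (z x)) = z x * cos (atan (z x)).
  by rewrite -[LHS](divfK (lt0r_neq0 c0)) -[sin _ / _]/(tan _) atanK.
rewrite /ex /c2 /s2 zE tE; move: (cos _) c0 => w c0; rewrite /z.
have := q0 x; case: (q x) => u v /= u0.
have w0 : w != 0 by rewrite gt_eqF.
have u0' : u != 0 by rewrite gt_eqF.
apply/eqP; rewrite eq_complex /= !mul0r subr0 addr0 mulfVK // eqxx /=.
by rewrite mulrCA mulfVK // mulfVK.
Qed.

Lemma winds_near_one (h : R -> C) :
  continuous (fun x => complex.Re (h x)) -> continuous (fun x => complex.Im (h x)) ->
  (forall x, nsq (h x) < 1) -> winds 0 (fun x => 1 - h x).
Proof.
move=> rc ic h1; apply: winds_right_half_plane.
- have -> : (fun x => complex.Re (1 - h x)) = (fun x => 1 - complex.Re (h x)).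
    by apply/funext => x; case: (h x).
  by move=> x; apply: cvgB; [exact: cvg_cst|exact: rc].
- have -> : (fun x => complex.Im (1 - h x)) = (fun x => - complex.Im (h x)).
    by apply/funext => x; case: (h x) => u v /=; rewrite sub0r.
  by move=> x; apply: cvgN; exact: ic.
move=> x; have := h1 x; rewrite /nsq; case: (h x) => u v /= uv.
have := sqr_ge0 v; nra.
Qed.

(** According to the side of the circle, factor out [ex x] or [- z]; what remains is [1 - h] with
    [|h| < 1], which does not wind. *)
Lemma winds_linear (z : C) : nsq z != 1 ->
  exists2 k : nat, (k <= 1)%N & winds k%:R (fun x => ex x - z).
Proof.
case: ltgtP => // z1 _.
- exists 1%N => //.
  have -> : (fun x => ex x - z) = (fun x => ex x * (1 - z * ex (- x))).
    by apply/funext => x; rewrite mulrBr mulr1 mulrCA -exD subrr ex0 mulr1.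
  rewrite -[1%:R]addr0; apply: winds_mul winds_ex _; apply: winds_near_one.
  + case: z {z1} => u v; rewrite /ex /=.
    move=> x; apply: cvgB; apply: cvgM; try exact: cvg_cst.
      by apply: (continuous_comp (opp_continuous x)); exact: continuous_c2.
    by apply: (continuous_comp (opp_continuous x)); exact: continuous_s2.
  + case: z {z1} => u v; rewrite /ex /=.
    move=> x; apply: cvgD; apply: cvgM; try exact: cvg_cst.
      by apply: (continuous_comp (opp_continuous x)); exact: continuous_s2.
    by apply: (continuous_comp (opp_continuous x)); exact: continuous_c2.
  by move=> x; rewrite nsqM nsq_ex mulr1.
exists 0%N => //.
have z0 : z != 0 by apply/eqP => e; move: z1; rewrite e /nsq /= expr0n addr0 ltr10.
have -> : (fun x => ex x - z) = (fun x => (- z) * (1 - z^-1 * ex x)).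
  by apply/funext => x; rewrite mulrBr mulr1 mulrA mulNr mulfV // mulN1r opprK addrC.
rewrite -[0%:R]addr0; apply: winds_mul; first by apply: winds_cst; rewrite oppr_eq0.
apply: winds_near_one.
+ case: (z^-1) => u v; rewrite /ex /=.
  by move=> x; apply: cvgB; apply: cvgM; try exact: cvg_cst;
     [exact: continuous_c2|exact: continuous_s2].
+ case: (z^-1) => u v; rewrite /ex /=.
  by move=> x; apply: cvgD; apply: cvgM; try exact: cvg_cst;
     [exact: continuous_s2|exact: continuous_c2].
move=> x; rewrite nsqM nsq_ex mulr1.
have : nsq z * nsq z^-1 = 1 by rewrite -nsqM mulfV // /nsq /= expr0n addr0 expr1n.
by have := nsq_ge0 z^-1; nra.
Qed.

Lemma winds_poly p : (forall x, p.[ex x] != 0) ->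
  exists2 k : nat, (k < size p)%N & winds k%:R (fun x => p.[ex x]).
Proof.
move=> p0; have [r pE] := closed_field_poly_normal p.
have l0 : lead_coef p != 0.
  by apply/eqP => e; have := p0 0; rewrite (eqP (_ : p == 0)) ?horner0 ?eqxx // -lead_coef_eq0 e.
have rP z : z \in r -> nsq z != 1.
  move=> zr; apply/eqP => z1.
  have [|y _ [cy sy]] := @unit_angle R (complex.Re z) (complex.Im z); first exact: z1.
  have := p0 y; rewrite pE hornerZ mulf_eq0 negb_or l0 /= => /negP; apply.
  rewrite -/(root _ _) root_prod_XsubC; suff -> : ex y = z by [].
  by rewrite /ex cy sy; case: (z).
have [k ks kw] : exists2 k : nat, (k <= size r)%N &
    winds k%:R (fun x => (\prod_(z <- r) ('X - z%:P)).[ex x]).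
  move: rP; elim: (r) => [|z s IH] rP.
    exists 0%N => //; have -> : (fun x => (\prod_(z <- [::]) ('X - z%:P)).[ex x]) = fun x : R => (1 : C).
      by apply/funext => x; rewrite big_nil hornerC.
    by apply: winds_cst; exact: oner_neq0.
  have [|k ks kw] := IH; first by move=> t ts; apply: rP; rewrite inE ts orbT.
  have [|k' k1 kw'] := @winds_linear z; first by apply: rP; rewrite inE eqxx.
  exists (k' + k)%N; first by rewrite -[size _]/((1 + size s)%N); exact: leq_add.
  rewrite natrD.
  have -> : (fun x => (\prod_(t <- z :: s) ('X - t%:P)).[ex x])
    = (fun x => (ex x - z) * (\prod_(t <- s) ('X - t%:P)).[ex x]).
    by apply/funext => x; rewrite big_cons hornerM hornerXsubC.
  exact: winds_mul.
exists k; first by rewrite pE size_scale // size_prod_XsubC ltnS.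
have -> : (fun x => p.[ex x]) = (fun x => lead_coef p * (\prod_(z <- r) ('X - z%:P)).[ex x]).
  by apply/funext => x; rewrite {1}pE hornerZ.
by rewrite -[k%:R]add0r; apply: winds_mul kw; apply: winds_cst.
Qed.

End Winding.

(** * Approximate Green functions *)

Section Laurent.
Variable R : realType.
Local Notation C := R[i]%C.
Implicit Types q : R -> C.

(** Trigonometric polynomials of degree at most [T], shifted to ordinary polynomials so that roots
    can be counted. *)
Definition laurent (T : nat) q : Prop := exists2 p : {poly C},
  (size p <= (T + T).+1)%N & forall x, q x * ex (T%:R * x) = p.[ex x].

Lemma laurentD T q q' : laurent T q -> laurent T q' -> laurent T (fun x => q x + q' x).
Proof.
move=> [p sp pE] [p' sp' pE']; exists (p + p').
  by apply: leq_trans (size_polyD _ _) _; rewrite geq_max sp.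
by move=> x; rewrite hornerD mulrDl pE pE'.
Qed.

Lemma laurentZ T q (c : C) : laurent T q -> laurent T (fun x => c * q x).
Proof.
move=> [p sp pE]; exists (c *: p); first exact: leq_trans (size_scale_leq _ _) sp.
by move=> x; rewrite hornerZ -mulrA pE.
Qed.

Lemma laurentM T T' q q' : laurent T q -> laurent T' q' ->
  laurent (T + T') (fun x => q x * q' x).
Proof.
move=> [p sp pE] [p' sp' pE']; exists (p * p').
  apply: leq_trans (size_polyMleq _ _) _; lia.
by move=> x; rewrite hornerM -pE -pE' natrD mulrDl exD; ring.
Qed.

Lemma laurent_sum T (M : nat) (q : nat -> R -> C) :
  (forall j, laurent T (q j)) -> laurent T (fun x => \sum_(j < M) q j x).
Proof.
move=> ql; elim: M => [|M IH].
  by exists 0; rewrite ?size_poly0 // => x; rewrite big_ord0 mul0r horner0.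
have -> : (fun x => \sum_(j < M.+1) q j x) = (fun x => \sum_(j < M) q j x + q M x).
  by apply/funext => x; rewrite big_ord_recr.
exact: laurentD.
Qed.

Lemma laurent_conj T q : laurent T q -> laurent T (fun x => (q x)^*).
Proof.
move=> [p sp pE].
exists (\poly_(i < (T + T).+1) (p`_(T + T - i))^*); first exact: size_poly.
move=> x; have -> : (q x)^* * ex (T%:R * x) = (p.[ex x])^* * ex x ^+ (T + T).
  rewrite -pE rmorphM /= ex_conj -exX natrD mulrDl exD -mulrA; congr (_ * _).
  by rewrite mulrA -exD addNr ex0 mul1r.
rewrite (horner_coef_wide _ sp) rmorph_sum mulr_suml horner_poly.
rewrite (reindex_inj rev_ord_inj) /=; apply: eq_bigr => i _; rewrite subSS.
have iT : (i <= T + T)%N by rewrite -ltnS.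
rewrite rmorphM rmorphXn /= ex_conj exN -mulrA; congr (_ * _).
rewrite -[in X in _ * X](subnK iT) exprD mulrA.
by rewrite exprVn mulVf ?mul1r // expf_neq0 // ex_neq0.
Qed.

Lemma laurent_fourier T N (u : nat -> C) (c : R) :
  (forall i, ~~ ((N <= i) && (i < N + (T + T).+1))%N -> u i = 0) ->
  laurent T (fun x => ex (- ((T + N)%:R * x)) * fourier ((T + T).+1 + (N + N)) u (x + c)).
Proof.
move=> u0; exists (\poly_(i < (T + T).+1) (u (N + i)%N * ex ((N + i)%:R * c))).
  exact: size_poly.
move=> x; rewrite horner_poly /fourier.
rewrite -(big_mkord xpredT (fun i => u i * ex (i%:R * (x + c)))).
have z (m n : nat) : (forall i, (m <= i < n)%N -> u i = 0) ->
    \sum_(m <= i < n) u i * ex (i%:R * (x + c)) = 0.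
  by move=> h; rewrite big_nat_cond big1 // => i; rewrite andbT => /h ->; rewrite mul0r.
rewrite (@big_cat_nat _ _ _ N) //=; last by lia.
rewrite z ?add0r; last by move=> i h; rewrite u0 //; lia.
rewrite (@big_cat_nat _ _ _ (N + (T + T).+1)) //=; [|lia|lia].
rewrite [X in _ + X]z ?addr0; last by move=> i h; rewrite u0 //; lia.
have sh (H : nat -> C) K : \sum_(N <= i < N + K) H i = \sum_(i < K) H (i + N)%N.
  by rewrite -{1}[N]add0n big_addn addKn big_mkord.
rewrite sh mulr_sumr mulr_suml.
apply: eq_bigr => i _; rewrite [(i + N)%N]addnC -exX.
have -> : (N + i)%:R * (x + c) = (N + i)%:R * c + (N + i)%:R * x by ring.
have <- : ex (- ((T + N)%:R * x)) * ex ((N + i)%:R * x) * ex (T%:R * x) = ex (i%:R * x).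
  by rewrite -!exD; congr ex; rewrite !natrD; ring.
by rewrite exD; ring.
Qed.

End Laurent.

Lemma root_of_unity_mean (R : realType) (M k : nat) : (0 < k < M)%N ->
  \sum_(j < M) ex (k%:R * (j%:R / M%:R) : R) = 0 /\
  \sum_(j < M) ex (- k%:R * (j%:R / M%:R) : R) = 0.
Proof.
move=> /andP[k0 kM].
have M0 : M%:R != 0 :> R by rewrite pnatr_eq0; lia.
have key (s : R) : ex (s * M%:R) = 1 -> ex s != 1 -> \sum_(j < M) ex (s * j%:R) = 0.
  move=> sM s1; apply/eqP; rewrite -(mulrI_eq0 _ (lregP (_ : ex s - 1 != 0))) ?subr_eq0 //.
  have -> : \sum_(j < M) ex (s * j%:R) = \sum_(j < M) ex s ^+ j.
    by apply: eq_bigr => j _; rewrite mulrC exX.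
  by rewrite -subrX1 -exX mulrC sM subrr.
have n1 : ex (k%:R / M%:R : R) != 1.
  apply/eqP => /ex_eq1[z zE].
  have M1 : 0 < M%:R :> R by rewrite ltr0n; lia.
  have e : k%:R = z%:~R * M%:R :> R by rewrite -zE mulfVK.
  have e' : (k : int) = z * (M : int).
    by apply: (@intr_inj R); rewrite rmorphM /= -!pmulrn.
  have [z0|[z0|z0]] : (z <= -1) \/ (z = 0) \/ (1 <= z) by lia.
  - move: e'; have : z * (M : int) <= -1 * (M : int) by rewrite ler_wpM2r.
    lia.
  - by move: e'; rewrite z0 mul0r; lia.
  move: e'; have : 1 * (M : int) <= z * (M : int) by rewrite ler_wpM2r.
  lia.
split.
  have -> : \sum_(j < M) ex (k%:R * (j%:R / M%:R) : R) = \sum_(j < M) ex (k%:R / M%:R * j%:R : R).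
    by apply: eq_bigr => j _; rewrite mulrA mulrAC.
  by apply: key => //; rewrite mulfVK // -[k%:R]mulr1 exX (exZ R 1) expr1n.
have -> : \sum_(j < M) ex (- k%:R * (j%:R / M%:R) : R) = \sum_(j < M) ex (- (k%:R / M%:R) * j%:R : R).
  by apply: eq_bigr => j _; congr ex; ring.
apply: key => //; last by rewrite exN invr_eq1.
by rewrite mulNr mulfVK // exN -[k%:R]mulr1 exX (exZ R 1) expr1n invr1.
Qed.

Section Synthesis.
Variables (R : realType) (N : nat) (a b : nat -> R) (F : R -> R).
Local Notation C := R[i]%C.
Hypothesis FE : forall x, F x = \sum_(k < N.+1) (a k * cos (2 * pi * k%:R * x)
                           + b k * sin (2 * pi * k%:R * x)).
Variables (alpha E B tau : R) (T : nat) (w : R -> nat -> C) (M : nat).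
Local Notation S := ((T + T).+1 + (N + N))%N.
Hypotheses (B0 : 0 <= B) (tau0 : 0 <= tau) (M0 : (0 < M)%N).
Hypothesis w0 : forall phi i, ~~ ((N <= i) && (i + N < S))%N -> w phi i = 0.
Hypothesis wB : forall phi i, nsq (w phi i) <= B ^+ 2.

Definition residual (phi : R) (i : nat) : C :=
  \sum_(j < S) dual N a b alpha E phi i j * w phi j - (i == T + N)%N%:R.

Hypothesis wr : forall phi, \sum_(i < S) nsq (residual phi i) <= tau ^+ 2.

Definition theta (j : nat) : R := j%:R / M%:R.
(** The shift gives the source site [T + N] of the dual problem the phase [theta j]. *)
Definition phase (j : nat) : R := theta j - (T + N)%:R * alpha.

(* An approximate inverse of H_x - E applied to the site c, obtained by averaging
   the dual inverses over the phases. *)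
Definition green (c n x : R) : C :=
  (M%:R)^-1 * \sum_(j < M) (ex (- (c * theta j)) * ex (n * phase j)) *
     (ex (- ((T + N)%:R * x)) * fourier S (w (phase j)) (x + n * alpha)).

Lemma green_laurent c n : laurent T (green c n).
Proof.
apply: laurentZ; apply: (@laurent_sum R T M (fun j x => (ex (- (c * theta j)) * ex (n * phase j)) *
     (ex (- ((T + N)%:R * x)) * fourier S (w (phase j)) (x + n * alpha)))) => j.
apply: laurentZ; apply: laurent_fourier => i h; apply: w0; move: h; lia.
Qed.

Lemma fourier_le (u : nat -> C) (D : R) x : (forall i, (i < S)%N -> `|u i| <= D%:C%C) ->
  `|fourier S u x| <= (S%:R * D)%:C%C.
Proof.
move=> uD; apply: le_trans (ler_norm_sum _ _ _) _.
apply: (@le_trans _ _ (\sum_(i < S) D%:C%C)).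
  by apply: ler_sum => i _; rewrite normrM norm_ex mulr1 uD.
by rewrite sumr_const card_ord rmorphM /= rmorph_nat mulr_natl.
Qed.

Lemma mean_le (v : nat -> C) (D : R) : (forall j, `|v j| <= D%:C%C) ->
  `|(M%:R)^-1 * \sum_(j < M) v j| <= D%:C%C.
Proof.
move=> vD; rewrite normrM normfV normr_nat mulrC ler_pdivrMr ?ltr0n //.
apply: le_trans (ler_norm_sum _ _ _) _.
apply: (@le_trans _ _ (\sum_(i < M) D%:C%C)); first by apply: ler_sum.
by rewrite sumr_const card_ord mulr_natr.
Qed.

Lemma green_bound c n x : `|green c n x| <= (S%:R * B)%:C%C.
Proof.
apply: (mean_le (v := fun j => (ex (- (c * theta j)) * ex (n * phase j)) *
     (ex (- ((T + N)%:R * x)) * fourier S (w (phase j)) (x + n * alpha)))) => j.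
rewrite !normrM !norm_ex !mul1r; apply: fourier_le => i _; exact: norm_le_nsq.
Qed.

Lemma residual_le phi i : (i < S)%N -> `|residual phi i| <= tau%:C%C.
Proof.
move=> iS; apply: norm_le_nsq => //; apply: le_trans (wr phi).
rewrite (bigD1 (Ordinal iS)) //= lerDl sumr_ge0 // => j _; exact: nsq_ge0.
Qed.

(** Duality turns each dual delta into a plane wave in the site [n]. Averaging over the phases
    [j / M] with weight [ex (- c theta)] turns these waves into a delta at [n = c], as long as
    [|n - c| < M]. *)
Lemma green_equation c n x :
  `|green c (n + 1) x + green c (n - 1) x + (F (x + n * alpha) - E)%:C%C * green c n x
    - (M%:R)^-1 * \sum_(j < M) ex ((n - c) * theta j)| <= (S%:R * tau)%:C%C.
Proof.
pose X := x + n * alpha.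
pose e (j : nat) := ex (- (c * theta j)) * ex (n * phase j) * ex (- ((T + N)%:R * x)).
have -> : green c (n + 1) x + green c (n - 1) x + (F X - E)%:C%C * green c n x
    - (M%:R)^-1 * \sum_(j < M) ex ((n - c) * theta j)
  = (M%:R)^-1 * \sum_(j < M) e j * fourier S (residual (phase j)) X.
  rewrite /green; set G1 := \sum_(j < M) _; set G2 := \sum_(j < M) _.
  set G3 := \sum_(j < M) _; set G4 := \sum_(j < M) _.
  have -> : (M%:R)^-1 * G1 + (M%:R)^-1 * G2 + (F X - E)%:C%C * ((M%:R)^-1 * G3)
    - (M%:R)^-1 * G4 = (M%:R)^-1 * (G1 + G2 + (F X - E)%:C%C * G3 - G4) by ring.
  congr (_ * _); rewrite /G1 /G2 /G3 /G4 mulr_sumr -!big_split /= -sumrB.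
  apply: eq_bigr => j _; set phi := phase j.
  have -> : fourier S (residual phi) X
     = fourier S (fun i => \sum_(j < S) dual N a b alpha E phi i j * w phi j) X
       - ex ((T + N)%:R * X).
    have oS : (T + N < S)%N by lia.
    rewrite /fourier (bigD1 (Ordinal oS)) //= [in RHS](bigD1 (Ordinal oS)) //=.
    rewrite /residual eqxx mulrBl mul1r [RHS]addrAC; congr (_ + _).
    apply: eq_bigr => i io; have /negbTE -> : (i : nat) != (T + N)%N by [].
    by rewrite subr0.
  rewrite -(dual_fourier FE alpha E phi X (@w0 phi)) /e.
  have -> : X + alpha = x + (n + 1) * alpha by rewrite /X; ring.
  have -> : X - alpha = x + (n - 1) * alpha by rewrite /X; ring.
  have e0 : ex ((n - c) * theta j) = ex (- (c * theta j)) * ex (n * phi)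
      * ex (- ((T + N)%:R * x)) * ex ((T + N)%:R * X).
    by rewrite -!exD; congr ex; rewrite /phi /phase /X; ring.
  rewrite e0; have -> : ex ((n + 1) * phi) = ex (n * phi) * ex phi.
    by rewrite -exD; congr ex; ring.
  have -> : ex ((n - 1) * phi) = ex (n * phi) * ex (- phi).
    by rewrite -exD; congr ex; ring.
  by ring.
apply: (mean_le (v := fun j => e j * fourier S (residual (phase j)) X)) => j.
rewrite !normrM !norm_ex !mul1r; apply: fourier_le => i iS; exact: residual_le.
Qed.

End Synthesis.

(* Two approximate Green functions that are small at the sites 0 and 1 would span
   the left half-line solutions, contradicting that both are nearly parallel to
   the decaying one. *)
Lemma green_not_small (R : realType) (e c s V0 V1 g1 g0 gl gm h1 h0 hl hm : R) :
  c ^+ 2 + s ^+ 2 = 1 -> 0 < e -> 10 * (10 * (10 * e)) <= 1 -> `|V0| <= 4 -> `|V1| <= 4 ->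
  `|g1 + gl + V0 * g0 - 1| <= e -> `|g0 + gm + V1 * gl| <= e ->
  `|h1 + hl + V0 * h0| <= e -> `|h0 + hm + V1 * hl - 1| <= e ->
  `|gm * s - gl * c| <= e -> `|hm * s - hl * c| <= e ->
  (4 * e) ^+ 2 <= g1 ^+ 2 + g0 ^+ 2 + (h1 ^+ 2 + h0 ^+ 2).
Proof.
move=> cs e0 e1 V04 V14 G1 G0 H1 H0 Wg Wh; rewrite leNgt; apply/negP => lt.
have small (z A : R) : A < (4 * e) ^+ 2 -> z ^+ 2 <= A -> `|z| <= 4 * e.
  move=> A1 zA; rewrite -(ler_pXn2r (n := 2)) ?nnegrE ?mulr_ge0 ?(ltW e0) // real_normK ?num_real //.
  lra.
have g1s := small g1 _ lt; have g0s := small g0 _ lt.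
have h1s := small h1 _ lt; have h0s := small h0 _ lt.
have [q1 q2 q3 q4] : [/\ 0 <= g1 ^+ 2, 0 <= g0 ^+ 2, 0 <= h1 ^+ 2 & 0 <= h0 ^+ 2].
  by split; apply: sqr_ge0.
have {g1s} g1s : `|g1| <= 4 * e by apply: g1s; lra.
have {g0s} g0s : `|g0| <= 4 * e by apply: g0s; lra.
have {h1s} h1s : `|h1| <= 4 * e by apply: h1s; lra.
have {h0s} h0s : `|h0| <= 4 * e by apply: h0s; lra.
clear small q1 q2 q3 q4 lt.
have mulB (u v A D : R) : `|u| <= A -> `|v| <= D -> `|u * v| <= A * D.
  by move=> uA vD; rewrite normrM; apply: ler_pM.
have c1 : `|c| <= 1.
  rewrite -(ler_pXn2r (n := 2)) ?nnegrE // real_normK ?num_real // expr1n.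
  by have := sqr_ge0 s; lra.
have s1 : `|s| <= 1.
  rewrite -(ler_pXn2r (n := 2)) ?nnegrE // real_normK ?num_real // expr1n.
  by have := sqr_ge0 c; lra.
(* The equations at sites 0 and -1 give [gl] near 1, [hl] near 0, [hm] near 1 and [gm] bounded. The
   wedge of [h] then makes [s] small and that of [g] makes [c] small, against [c^2 + s^2 = 1]. Each
   constant adds the bounds already obtained, such as 21 = 1 + 4 + 4 * 4. *)
have glb : `|gl - 1| <= 21 * e.
  have := mulB _ _ _ _ V04 g0s; move: G1 g1s; rewrite !ler_norml; lra.
have hlb : `|hl| <= 21 * e.
  have := mulB _ _ _ _ V04 h0s; move: H1 h1s; rewrite !ler_norml; lra.
have hmb : `|hm - 1| <= 89 * e.
  have := mulB _ _ _ _ V14 hlb; move: H0 h0s; rewrite !ler_norml; lra.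
have gmb : `|gm| <= 41 / 10.
  have := mulB _ _ _ _ V14 glb; move: G0 g0s V14; rewrite mulrBr mulr1 !ler_norml; lra.
have sb : `|s| <= 111 * e.
  have := mulB _ _ _ _ hmb s1; have := mulB _ _ _ _ hlb c1.
  by move: Wh; rewrite mulrBl mul1r !ler_norml; lra.
have cb : `|c| <= 1 / 2.
  have := mulB _ _ _ _ gmb sb; have := mulB _ _ _ _ glb c1.
  by move: Wg; rewrite mulrBl mul1r !ler_norml; lra.
have {}sb : `|s| <= 1 / 2 by lra.
have := mulB _ _ _ _ sb sb; have := mulB _ _ _ _ cb cb.
by rewrite -!expr2 !ger0_norm ?sqr_ge0 //; lra.
Qed.

Section StableCone.
Variables (R : realType) (N : nat) (a b : nat -> R) (F : R -> R).
Local Notation C := R[i]%C.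
Hypothesis FE : forall x, F x = \sum_(k < N.+1) (a k * cos (2 * pi * k%:R * x)
                           + b k * sin (2 * pi * k%:R * x)).
Variables (alpha E B tau dl e : R) (T : nat) (w : R -> nat -> C) (nu : nat).
Local Notation S := ((T + T).+1 + (N + N))%N.
Hypotheses (B0 : 0 <= B) (tau0 : 0 <= tau) (nu0 : (0 < nu)%N) (dl0 : 0 < dl).
Hypothesis w0 : forall phi i, ~~ ((N <= i) && (i + N < S))%N -> w phi i = 0.
Hypothesis wB : forall phi i, nsq (w phi i) <= B ^+ 2.
Hypothesis wr : forall phi,
  \sum_(i < S) nsq (residual N a b alpha E T w phi i) <= tau ^+ 2.
Hypothesis lb : lower_bounded F alpha E dl.
Hypothesis F4 : forall x, `|F x - E| <= 4.

(** Larger than every offset [|n - c|] met below, so that the average leaves no spurious source. *)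
Let M := (nu ^ 2 + 3)%N.
Let G := green N alpha T w M.
Let g (c n x : R) : R := complex.Re (G c n x).
Let e1 : R := S%:R * tau.
Let e2 : R := 2 * (S%:R * B) * (2 / dl) / nu%:R + e1 * (nu ^ 2)%:R * (2 / dl).

Hypotheses (e0 : 0 < e) (e_small : 10 * (10 * (10 * e)) <= 1) (e1s : e1 <= e) (e2s : e2 <= e).

Let mean (t : R) : C := (M%:R)^-1 * \sum_(j < M) ex (t * theta R M j).

Let mean0 (k : nat) : (0 < k < M)%N -> mean k%:R = 0 /\ mean (- k%:R) = 0.
Proof.
by move=> /(root_of_unity_mean R)[h1 h2]; rewrite /mean /theta h1 h2 mulr0.
Qed.

Let mean1 : mean 0 = 1.
Proof.
rewrite /mean; have -> : \sum_(j < M) ex (0 * theta R M j) = M%:R :> C.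
  under eq_bigr => j _ do rewrite mul0r ex0.
  by rewrite sumr_const card_ord.
by rewrite mulVf // pnatr_eq0 /M addn3.
Qed.

Let g_equation (c n x v : R) : mean (n - c) = v%:C%C ->
  `|g c (n + 1) x + g c (n - 1) x + (F (x + n * alpha) - E) * g c n x - v| <= e1.
Proof.
move=> mv; have M0 : (0 < M)%N by rewrite /M addn3.
have := green_equation FE B0 tau0 M0 w0 wr c n x.
rewrite -/(mean (n - c)) mv => /Re_le_norm; rewrite -/e1 /g /G.
case: (green _ _ _ _ _ _ (n + 1) _) => u1 v1; case: (green _ _ _ _ _ _ (n - 1) _) => u2 v2.
by case: (green _ _ _ _ _ _ n _) => u3 v3 /=; rewrite mul0r subr0.
Qed.

Let g_bound c n x : `|g c n x| <= S%:R * B.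
Proof. by apply: Re_le_norm; apply: green_bound => //; rewrite /M addn3. Qed.

Let e1_ge0 : 0 <= e1. Proof. by rewrite mulr_ge0. Qed.
Let s_ge0 : 0 <= 2 / dl. Proof. by rewrite divr_ge0 // ltW. Qed.

(** The sources 0 and -1 lie to the left of the sites [1, 2, ...], where the Green function is
    therefore a bounded approximate solution. *)
Let right_wedge c x y : c = 0 \/ c = -1 ->
  square_summable (pot F alpha E x) y (2 / dl) ->
  `|g c 1 x * s2 y - g c 0 x * c2 y| <= e.
Proof.
move=> cc ss; apply: le_trans e2s.
apply: (@wronskian_bound R (pot F alpha E x) (s2 y) (c2 y) (2 / dl) (S%:R * B) e1
  (fun i => g c i%:R x) nu ss s_ge0 nu0 e1_ge0) => [i _|i iM].
  exact: g_bound.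
have := @g_equation c i.+1%:R x 0; rewrite subr0 /pot.
have -> : i.+1%:R + 1 = i.+2%:R :> R by rewrite natr1.
have -> : i.+1%:R - 1 = i%:R :> R by rewrite -natr1 addrK.
apply; case: cc => ->.
  by rewrite subr0; have [->] := @mean0 i.+1 ltac:(by rewrite /M; move: iM; clear; lia).
by rewrite opprK natr1; have [->] := @mean0 i.+2 ltac:(by rewrite /M; move: iM; clear; lia).
Qed.

(** The mirror image: sites [-2, -3, ...] for the reflected operator based at [x - alpha]. *)
Let left_wedge c x y : c = 0 \/ c = -1 ->
  square_summable (fun i => F ((x - alpha) - i%:R * alpha) - E) y (2 / dl) ->
  `|g c (- 2) x * s2 y - g c (- 1) x * c2 y| <= e.
Proof.
move=> cc ss; apply: le_trans e2s.
apply: (@wronskian_bound R _ (s2 y) (c2 y) (2 / dl) (S%:R * B) e1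
  (fun i => g c (- (i.+1)%:R) x) nu ss s_ge0 nu0 e1_ge0) => [i _|i iM].
  exact: g_bound.
have := @g_equation c (- (i.+2)%:R) x 0; rewrite subr0.
have -> : - i.+2%:R + 1 = - i.+1%:R :> R by rewrite -natr1; ring.
have -> : - i.+2%:R - 1 = - i.+3%:R :> R by rewrite -[in RHS]natr1; ring.
have -> : x + - i.+2%:R * alpha = x - alpha - i.+1%:R * alpha by rewrite -natr1; ring.
rewrite [g c (- i.+1%:R) x + _]addrC.
apply; case: cc => ->.
  by rewrite subr0; have [_ ->] := @mean0 i.+2 ltac:(by rewrite /M; move: iM; clear; lia).
have -> : - i.+2%:R - -1 = - i.+1%:R :> R by rewrite -natr1; ring.
by have [_ ->] := @mean0 i.+1 ltac:(by rewrite /M; move: iM; clear; lia).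
Qed.

Let green_large x :
  (4 * e) ^+ 2 <= g 0 1 x ^+ 2 + g 0 0 x ^+ 2 + (g (-1) 1 x ^+ 2 + g (-1) 0 x ^+ 2).
Proof.
have [y ss] := decaying_solution dl0 (backward_half_line (x - alpha) lb).
have Wg := left_wedge (or_introl erefl) ss.
have Wh := left_wedge (or_intror erefl) ss.
have M1 : (0 < 1 < M)%N by rewrite /M; clear; lia.
have [m1 m1'] := mean0 M1.
have G1 : `|g 0 1 x + g 0 (-1) x + (F (x + 0 * alpha) - E) * g 0 0 x - 1| <= e1.
  by have := @g_equation 0 0 x 1; rewrite subrr add0r sub0r mean1; apply.
have G0 : `|g 0 0 x + g 0 (-2) x + (F (x + -1 * alpha) - E) * g 0 (-1) x| <= e1.
  by have := @g_equation 0 (-1) x 0; rewrite !subr0 addNr -opprD m1'; apply.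
have H1 : `|g (-1) 1 x + g (-1) (-1) x + (F (x + 0 * alpha) - E) * g (-1) 0 x| <= e1.
  by have := @g_equation (-1) 0 x 0; rewrite !subr0 !sub0r opprK add0r m1; apply.
have H0 : `|g (-1) 0 x + g (-1) (-2) x + (F (x + -1 * alpha) - E) * g (-1) (-1) x - 1| <= e1.
  by have := @g_equation (-1) (-1) x 1; rewrite subrr addNr -opprD mean1; apply.
apply: (@green_not_small R e (c2 y) (s2 y) (F (x + 0 * alpha) - E)
   (F (x + -1 * alpha) - E) _ _ (g 0 (-1) x) (g 0 (-2) x) _ _ (g (-1) (-1) x) (g (-1) (-2) x));
   rewrite ?c2s2 ?e0 ?e_small //.
- exact: le_trans G1 e1s.
- exact: le_trans G0 e1s.
- exact: le_trans H1 e1s.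
- exact: le_trans H0 e1s.
Qed.

(** Each [k c x = g c 1 x + i g c 0 x] is nearly a real multiple of [ex y], so the squares are
    nearly nonnegative multiples of [ex (2 * y)] and cannot cancel. Exactly, the real part is the
    sum of the four squares minus twice the squared wedges, at least [16 e^2 - 4 e^2]. *)
Lemma stable_cone : exists2 q : R -> C, laurent (T + T) q &
  forall x y, square_summable (pot F alpha E x) y (2 / dl) ->
    0 < complex.Re (q x * ex (- (2 * y))).
Proof.
pose gc c n x : C := (g c n x)%:C%C.
have gcL c n : laurent T (gc c n).
  have -> : gc c n = fun x => 2^-1 * (G c n x + (G c n x)^*).
    apply/funext => x; rewrite /gc /g.
    apply: (mulfI (_ : 2 != 0)); rewrite ?pnatr_eq0 // mulrA mulfV ?pnatr_eq0 // mul1r.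
    rewrite mulr_natl mulr2n; case: (G c n x) => u v.
    by apply/eqP; rewrite eq_complex /= subrr addr0 !eqxx.
  have M0 : (0 < M)%N by rewrite /M addn3.
  have GL : laurent T (G c n) := green_laurent alpha B0 tau0 M0 w0 c n.
  by apply: laurentZ; apply: laurentD => //; apply: laurent_conj.
pose k c x := gc c 1 x + (0 +i* 1)%C * gc c 0 x.
have kL c : laurent T (k c) by apply: laurentD; [|apply: laurentZ]; apply: gcL.
exists (fun x => k 0 x * k 0 x + k (-1) x * k (-1) x).
  by apply: laurentD; apply: laurentM.
move=> x y ss.
have -> : complex.Re ((k 0 x * k 0 x + k (-1) x * k (-1) x) * ex (- (2 * y)))
  = (g 0 1 x ^+ 2 + g 0 0 x ^+ 2 + (g (-1) 1 x ^+ 2 + g (-1) 0 x ^+ 2))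
   - 2 * ((g 0 1 x * s2 y - g 0 0 x * c2 y) ^+ 2
         + (g (-1) 1 x * s2 y - g (-1) 0 x * c2 y) ^+ 2).
  have -> : - (2 * y) = - y + - y by ring.
  rewrite exD /ex c2N s2N /k /gc /=.
  have := c2s2 y; move: (c2 y) (s2 y) => c s cs.
  move: (g 0 1 x) (g 0 0 x) (g (-1) 1 x) (g (-1) 0 x) => g1 g0 h1 h0.
  transitivity ((g1 ^+ 2 + g0 ^+ 2 + (h1 ^+ 2 + h0 ^+ 2)) * (c ^+ 2 + s ^+ 2)
    - 2 * ((g1 * s - g0 * c) ^+ 2 + (h1 * s - h0 * c) ^+ 2)); last by rewrite cs mulr1.
  by ring.
have W0 := right_wedge (or_introl erefl) ss.
have W1 := right_wedge (or_intror erefl) ss.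
have sq (z : R) : `|z| <= e -> z ^+ 2 <= e ^+ 2.
  by move=> h; rewrite -(real_normK (num_real z)) ler_pXn2r ?nnegrE // ltW.
have := green_large x; move: (sq _ W0) (sq _ W1).
have : 0 < e ^+ 2 by rewrite exprn_gt0.
rewrite exprMn.
lra.
Qed.

End StableCone.

(** * Rotation number from the winding of the decaying direction *)

Lemma c2_pos_near (R : realType) (z : R) : 0 < c2 z ->
  exists k : int, `|z - k%:~R| < 4^-1.
Proof.
have [k [y0 [-> /andP[y1 y2]]]] := half_turn_decomp z => c0.
have y1' : - 4^-1 < y0.
  rewrite lt_neqAle y1 andbT; apply/eqP => e; move: c0; rewrite -e c2D c2N s2N.
  rewrite c2_quarter s2_quarter mul0r sub0r mulN1r opprK.
  have := s2D (k%:~R / 2 : R) (k%:~R / 2); rewrite -splitr; have [_ ->] := c2s2_int R k.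
  have := c2D (k%:~R / 2 : R) (k%:~R / 2); rewrite -splitr; have [-> _] := c2s2_int R k.
  move: (c2 _) (s2 _) => c s e1 e2 s0.
  have : s * c = 0 by lra.
  move=> /eqP; rewrite mulf_eq0 gt_eqF //= => /eqP e3; move: e1; rewrite e3.
  by have := mulr_gt0 s0 s0; lra.
have {c0} [j kE] : exists j : int, k = j * 2.
  have [j [r [kE r01]]] : exists j r : int, k = j * 2 + r /\ (r == 0) || (r == 1).
    exists (k %/ 2)%Z, (k %% 2)%Z; split; first exact: divz_eq.
    by have := modz_ge0 k (_ : 2 != 0); have := ltz_pmod k (_ : 0 < 2); lia.
  case/orP: r01 => /eqP rE; first by exists j; rewrite kE rE addr0.
  exfalso; move: c0; rewrite kE rE intrD intrM.
  have -> : y0 + (j%:~R * 2%:~R + 1%:~R) / 2 = y0 + 2^-1 + j%:~R :> R by field.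
  rewrite c2DZ c2D c2_half s2_half mulr0 subr0 mulrN1 oppr_gt0.
  by have := @c2_gt0 R y0; rewrite y1' y2 => /(_ isT); lra.
exists j; rewrite kE intrM.
have -> : y0 + j%:~R * 2%:~R / 2 - j%:~R = y0 :> R by field.
by rewrite ltr_norml y1' y2.
Qed.

Section StableRotation.
Variables (R : realType) (F : R -> R) (alpha E dl : R).
Local Notation C := R[i]%C.
Hypothesis Fu : forall e : R, 0 < e -> exists2 d : R, 0 < d &
  forall x x', `|x - x'| < d -> `|F x - F x'| <= e.
Hypotheses (dl0 : 0 < dl) (lb : lower_bounded F alpha E dl).
Variables (D : nat) (q : R -> C).
Hypothesis qL : laurent D q.
Hypothesis cone : forall x y, square_summable (pot F alpha E x) y (2 / dl) ->
  0 < complex.Re (q x * ex (- (2 * y))).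

Let s_ge0 : 0 <= 2 / dl. Proof. by rewrite divr_ge0 // ltW. Qed.

Lemma uniform_continuous_point : continuous F.
Proof.
move=> x; apply/cvgrPdist_le => e e0; have [d d0 dP] := Fu e0.
by apply/nbhs_ballP; exists d => // x' xx'; apply: dP.
Qed.

(** A decaying solution exists at every [x], so the cone condition forbids zeros of [q]. Its
    polynomial of degree at most [2D] winds between 0 and [2D] times, and the shift takes away
    [D]. *)
Lemma stable_argument : exists (n : int) (A : R -> R) (B : R), [/\ (`|n| <= D)%N,
  continuous A, forall x, `|A x - n%:~R * x| <= B &
  forall x, exists2 r : R, 0 < r & q x = r%:C%C * ex (A x)].
Proof.
have [p sp pE] := qL.
have [|k ks [A [B [Ac AB Aq]]]] := @winds_poly R p.
  move=> x; rewrite -pE mulf_neq0 ?ex_neq0 //; apply/eqP => q0.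
  have [y ss] := decaying_solution dl0 (forward_half_line x lb).
  by have := cone ss; rewrite q0 mul0r ltxx.
exists (k%:Z - D%:Z), (fun x => A x - D%:R * x), B; split.
- by move: ks sp; lia.
- move=> x; apply: cvgB; first exact: Ac.
  by apply: cvgM; [exact: cvg_cst|exact: cvg_id].
- move=> x; rewrite intrB -!pmulrn.
  by have -> : A x - D%:R * x - (k%:R - D%:R) * x = A x - k%:R * x by ring.
move=> x; have [r r0 rE] := Aq x; exists r => //.
by rewrite exD exN mulrA -rE -pE mulfK // ex_neq0.
Qed.

(** The cone condition reads [c2 (A x - 2 y) > 0]. A half turn of [y] keeps the same line and moves
    [2 y] by 1, so [y] can be placed next to [A x / 2]. *)
Lemma stable_angle (A : R -> R) :
  (forall x, exists2 r : R, 0 < r & q x = r%:C%C * ex (A x)) ->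
  exists y : R -> R, forall x,
    square_summable (pot F alpha E x) (y x) (2 / dl) /\ `|A x - 2 * y x| < 4^-1.
Proof.
move=> Aq; suff h x : exists y, square_summable (pot F alpha E x) y (2 / dl)
    /\ `|A x - 2 * y| < 4^-1.
  by have [y yP] := choice h; exists y.
have [y ss] := decaying_solution dl0 (forward_half_line x lb).
have := cone ss; have [r r0 ->] := Aq x.
have -> : complex.Re (r%:C%C * ex (A x) * ex (- (2 * y))) = r * c2 (A x - 2 * y).
  by rewrite -mulrA -exD /ex /= mul0r subr0.
rewrite pmulr_rgt0 // => /c2_pos_near[k kP].
exists (y + k%:~R / 2); split.
  by move=> n; under eq_bigr do rewrite solution_half_turn; exact: ss.
by have -> : A x - 2 * (y + k%:~R / 2) = A x - 2 * y - k%:~R by field.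
Qed.

Lemma stable_angle_continuous (A y : R -> R) : continuous A ->
  (forall x, square_summable (pot F alpha E x) (y x) (2 / dl) /\ `|A x - 2 * y x| < 4^-1) ->
  continuous y.
Proof.
move=> Ac yP x; apply/cvgrPdist_le => e0 e00.
pose e := Num.min e0 4^-1.
have e_gt0 : 0 < e by rewrite lt_min e00 invr_gt0 ltr0n.
pose s := 2 / dl; have s0 : 0 <= s := s_ge0.
have s1 : 0 <= 1 + s by rewrite addr_ge0.
pose K := 2 * (1 + s) * s.
have K0 : 0 <= K by do 2?apply: mulr_ge0 => //.
pose nu := (Num.bound (2 * K / e)).+1.
have nu0 : 0 < nu%:R :> R by rewrite ltr0n.
have nuK : K / nu%:R <= e / 2.
  have h : 2 * K / e < nu%:R.
    apply: lt_trans (archi_boundP _) _; first by apply: divr_ge0; [exact: mulr_ge0|exact: ltW].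
    by rewrite ltr_nat.
  move: h; rewrite ltr_pdivrMr // => h; rewrite ler_pdivrMr //.
  by move: h; lra.
pose L := (1 + s) * (nu ^ 2)%:R * s.
have L0 : 0 <= L by do 2?apply: mulr_ge0 => //.
have L1 : 0 < 1 + L by rewrite ltr_pwDl.
have c0 : 0 < e / 2 / (1 + L) by rewrite !divr_gt0.
have [d d0 dP] := Fu c0.
near=> x'.
have xx' : `|x - x'| < d by near: x'; apply/nbhs_ballP; exists d.
(* The wedge controls [2 (y x - y x')] only modulo integers. The argument selects the branch:
   [|y x - y x'|] is below half of [1/4 + 1/4 + 1/12], hence below [1/3]. *)
have AA' : `|A x - A x'| < 12^-1.
  by near: x'; have /cvgrPdist_lt h := Ac x; apply: h; rewrite invr_gt0 ltr0n.
have [sx ax] := yP x; have [sx' ax'] := yP x'.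
have ee : e <= e0 by rewrite ge_min lexx.
have e4 : e <= 4^-1 by rewrite ge_min lexx orbT.
apply: le_trans ee; apply: dist_small; last by lra.
  apply: le_trans (sin_pi_dist _) _.
  have -> : pi * (2 * (y x - y x')) = 2 * pi * (y x - y x') by ring.
  apply: (le_trans (@wedge_stable R F alpha E x x' (y x) (y x') s nu
    (e / 2 / (1 + L)) s_ge0 isT _ sx sx' _)).
  - exact: ltW.
  - move=> i; rewrite /pot opprB addrA subrK.
    apply: dP; have -> : x + i%:R * alpha - (x' + i%:R * alpha) = x - x' by ring.
    by [].
  rewrite [leRHS](_ : e = e / 2 + e / 2); last by field.
  apply: lerD; first exact: nuK.
  have -> : e / 2 / (1 + L) * (1 + s) * (nu ^ 2)%:R * s = e / 2 * (L / (1 + L)).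
    by rewrite /L; ring.
  have L2 : L / (1 + L) <= 1 by rewrite ler_pdivrMr // mul1r lerDr.
  by apply: ler_piMr => //; apply: divr_ge0 => //; exact: ltW.
move: ax ax' AA'; rewrite !ltr_norml !ler_norml; lra.
Unshelve. all: by end_near. Qed.

(** By invariance and uniqueness, the cocycle takes [y (x - alpha)] to [y x] plus a half-integer
    that is continuous in [x], hence a constant [k / 2]. The orbit angle after [m] steps is [y] at
    [m alpha - alpha] plus [m k / 2], and [y] has mean slope [n / 2]. *)
Lemma stable_rotation : exists (n k : int) (y : R), (`|n| <= D)%N /\
  (m%:R^-1 * orbit_angle F alpha E 0 y m @[m --> \oo] --> (n%:~R * alpha + k%:~R) / 2).
Proof.
have [n [A [B [nD Ac AB Aq]]]] := stable_argument.
have [y yP] := stable_angle Aq; have yc := stable_angle_continuous Ac yP.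
have Fc := uniform_continuous_point.
pose kf x := 2 * (angle_map (E - F x) (y (x - alpha)) - y x).
have kZ x : exists k : int, kf x = k%:~R.
  have [s' s'0] := stable_step (yP (x - alpha)).1 s_ge0; rewrite subrK => ss'.
  have le2 (u v : R) : 0 <= u -> u <= v -> u ^+ 2 <= v ^+ 2.
    by move=> u0 uv; rewrite ler_pXn2r ?nnegrE // (le_trans u0).
  have l1 : s' <= 2 / dl + s' by rewrite lerDr.
  have l2 : 2 / dl <= 2 / dl + s' by rewrite lerDl.
  have [k kE] := @stable_unique R F alpha E x (angle_map (E - F x) (y (x - alpha))) (y x)
    (2 / dl + s') (addr_ge0 s_ge0 s'0)
    (fun m => le_trans (ss' m) (le2 _ _ s'0 l1))
    (fun m => le_trans ((yP x).1 m) (le2 _ _ s_ge0 l2)).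
  by exists k; rewrite /kf kE; field.
have kc : continuous kf.
  move=> x; apply: cvgM; first exact: cvg_cst.
  apply: cvgB; last exact: yc.
  have shc : continuous (fun x => y (x - alpha)).
    move=> z; apply: (@continuous_comp _ _ _ (fun x => x - alpha) y); last exact: yc.
    by apply: cvgB; [exact: cvg_id|exact: cvg_cst].
  apply: cvgD; first exact: shc.
  have ec : continuous (fun x => E - F x) by move=> z; apply: cvgB; [exact: cvg_cst|exact: Fc].
  exact: (@continuous_angle_step R R (fun x => E - F x) (fun x => y (x - alpha)) ec shc x).
have [k kE] := kZ 0.
have {}kE x : angle_map (E - F x) (y (x - alpha)) = y x + k%:~R / 2.
  have := continuous_int_cst kc kZ x 0; rewrite kE /kf; lra.
exists n, k, (y (- alpha)); split=> //.
have orb m : orbit_angle F alpha E 0 (y (- alpha)) m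
    = y (m%:R * alpha - alpha) + (k *+ m)%:~R / 2.
  elim: m => [|m IH]; first by rewrite /= mul0r sub0r mulr0n mul0r addr0.
  have -> : (k *+ m.+1)%:~R = (k *+ m)%:~R + k%:~R :> R by rewrite mulrSr intrD.
  have -> : m.+1%:R * alpha - alpha = m%:R * alpha by rewrite -natr1; ring.
  by rewrite /= IH add0r angle_map_halfZ kE; field.
pose K := `|B| + 1 + `|n%:~R * alpha|.
apply/cvgrPdist_le => e e0; exists (Num.bound (K / e)).+1 => // m /= mb.
have K0 : 0 <= K by rewrite !addr_ge0.
have m0 : 0 < m%:R :> R by rewrite ltr0n; move: mb; lia.
rewrite orb.
have -> : (n%:~R * alpha + k%:~R) / 2 - m%:R^-1 * (y (m%:R * alpha - alpha) + (k *+ m)%:~R / 2)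
   = m%:R^-1 * (m%:R * (n%:~R * alpha) / 2 - y (m%:R * alpha - alpha)).
  have -> : (k *+ m)%:~R = m%:R * k%:~R :> R by rewrite rmorphMn /= mulr_natl.
  by field; exact: lt0r_neq0.
rewrite normrM normfV [`|m%:R|]gtr0_norm // ler_pdivrMl //.
apply: (@le_trans _ _ K).
  set z := m%:R * alpha - alpha; have := (yP z).2; have := AB z.
  have -> : n%:~R * z = m%:R * (n%:~R * alpha) - n%:~R * alpha by rewrite /z; ring.
  rewrite /K; move: (y z) (A z) (n%:~R * alpha) => y0 a0 u.
  have := ler_norm B; have := ler_norm u; have := ler_norm (- u); rewrite normrN.
  move: (m%:R * u) => v; rewrite !ler_norml !ltr_norml; lra.
rewrite -ler_pdivrMr //; apply: ltW; apply: lt_le_trans (archi_boundP _) _.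
  by rewrite divr_ge0 // ltW.
by rewrite ler_nat; exact: ltnW mb.
Qed.

End StableRotation.

(** * Choice of parameters *)

(** [X] dominates the polynomial factors and [Y] the inverse half-width. With [tau = X^-6 Y^-5] and
    [nu] about [X^2 Y^2], both parts of the last bound are at most [8 / X]; the exponents 13 and 11
    are those that the fourth power of [tau] then requires. *)
Lemma parameter_choice (R : realType) (X Y S dl e : R) :
  1 <= X -> 1 <= Y -> 0 <= S -> S <= X -> 64 <= X * e -> 0 < dl -> dl^-1 <= Y ->
  exists (tau : R) (nu : nat), [/\ 0 <= tau, (0 < nu)%N,
    S * ((X ^+ 13 * Y ^+ 11)^-1) ^+ 2 <= dl ^+ 2 * tau ^+ 4, S * tau <= e &
    2 * (S * (2 / dl)) * (2 / dl) / nu%:R + S * tau * (nu ^ 2)%:R * (2 / dl) <= e].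
Proof.
move=> X1 Y1 S0 SX Xe dl0 dY.
have X0 : 0 < X by exact: lt_le_trans X1.
have Y0 : 0 < Y by exact: lt_le_trans Y1.
have e0 : 0 < e by rewrite -(pmulr_rgt0 _ X0); exact: lt_le_trans Xe.
set D := dl^-1 in dY *; have D0 : 0 < D by rewrite invr_gt0.
pose Z := X ^+ 2 * Y ^+ 2.
have Z1 : 1 <= Z by rewrite -[1]mulr1 ler_pM // exprn_ege1.
have Z0 : 0 < Z by exact: lt_le_trans Z1.
have /andP[n1 n2] := truncn_itv (ltW Z0); set nu := (Num.truncn Z).+1 in n2.
have nu2 : nu%:R <= 2 * Z by rewrite /nu -natr1; lra.
have nu0 : 0 < nu%:R :> R by rewrite ltr0n.
pose x := X^-1; pose y := Y^-1.
have Xx : X * x = 1 by rewrite mulfV // gt_eqF.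
have Yy : Y * y = 1 by rewrite mulfV // gt_eqF.
have [x0 y0] : 0 < x /\ 0 < y by rewrite !invr_gt0.
have [x1 y1] : x <= 1 /\ y <= 1 by rewrite !invf_le1.
have xe : x <= e / 64.
  rewrite ler_pdivlMr //; have -> : e = (X * x) * e by rewrite Xx mul1r.
  by rewrite [X * x]mulrC -mulrA ler_pM2l.
have yd : y <= dl by rewrite -[dl]invrK lef_pV2 ?posrE.
pose tau := x ^+ 6 * y ^+ 5.
have tau0 : 0 < tau by rewrite mulr_gt0 // exprn_gt0.
exists tau, nu; split=> //; first exact: ltW.
- have -> : (X ^+ 13 * Y ^+ 11)^-1 = x ^+ 13 * y ^+ 11 by rewrite invfM !exprVn.
  apply: (@le_trans _ _ (X * (x ^+ 13 * y ^+ 11) ^+ 2)).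
    by rewrite ler_wpM2r // sqr_ge0.
  have -> : X * (x ^+ 13 * y ^+ 11) ^+ 2 = (X * x) * (x * (y ^+ 2 * tau ^+ 4)).
    by rewrite /tau; ring.
  rewrite Xx mul1r; apply: (@le_trans _ _ (y ^+ 2 * tau ^+ 4)).
    by rewrite ler_piMl // mulr_ge0 // exprn_ge0 // ltW.
  by rewrite ler_wpM2r ?exprn_ge0 ?(ltW tau0) // ler_pXn2r ?nnegrE // ltW.
- apply: (@le_trans _ _ (X * tau)); first by rewrite ler_wpM2r // ltW.
  have -> : X * tau = (X * x) * (x * (x ^+ 4 * y ^+ 5)) by rewrite /tau; ring.
  rewrite Xx mul1r; apply: (@le_trans _ _ x); last by lra.
  rewrite ler_piMr ?(ltW x0) // mulr_ile1 ?exprn_ge0 ?exprn_ile1 // ltW //.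
have -> : 2 * (S * (2 / dl)) * (2 / dl) / nu%:R = 8 * (S * D ^+ 2 * nu%:R^-1).
  by rewrite /D; ring.
have -> : S * tau * (nu ^ 2)%:R * (2 / dl) = 2 * (S * tau * nu%:R ^+ 2 * D).
  by rewrite natrX /D; ring.
have h1 : S * D ^+ 2 * nu%:R^-1 <= x.
  have -> : x = X * Y ^+ 2 * Z^-1.
    have -> : Z^-1 = x ^+ 2 * y ^+ 2 by rewrite invfM !exprVn.
    have -> : X * Y ^+ 2 * (x ^+ 2 * y ^+ 2) = (X * x) * (Y * y) ^+ 2 * x by ring.
    by rewrite Xx Yy expr1n !mul1r.
  apply: ler_pM; rewrite ?invr_ge0 ?mulr_ge0 ?exprn_ge0 ?(ltW D0) //.
    apply: ler_pM; rewrite ?exprn_ge0 ?(ltW D0) //.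
    by rewrite ler_pXn2r ?nnegrE ?(ltW D0) ?(ltW Y0).
  by rewrite lef_pV2 ?posrE // ltW.
have h2 : S * tau * nu%:R ^+ 2 * D <= 4 * x.
  have -> : 4 * x = X * tau * (2 * Z) ^+ 2 * Y.
    have -> : X * tau * (2 * Z) ^+ 2 * Y = 4 * ((X * x) ^+ 5 * (Y * y) ^+ 5 * x).
      by rewrite /tau /Z; ring.
    by rewrite Xx Yy !expr1n !mul1r.
  have St : S * tau <= X * tau by rewrite ler_wpM2r // ltW.
  have St0 : 0 <= S * tau by rewrite mulr_ge0 // ltW.
  have nZ : nu%:R ^+ 2 <= (2 * Z) ^+ 2.
    by rewrite ler_pXn2r ?nnegrE ?mulr_ge0 // ltW.
  have nn : 0 <= nu%:R ^+ 2 :> R by rewrite exprn_ge0.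
  by apply: ler_pM => //; [exact: mulr_ge0|exact: ltW|exact: ler_pM].
by lra.
Qed.

Lemma norm_c2s2_le1 (R : realType) (t : R) : `|c2 t| <= 1 /\ `|s2 t| <= 1.
Proof.
split; rewrite -(ler_pXn2r (n := 2)) ?nnegrE // expr1n real_normK ?num_real //.
  by rewrite -(c2s2 t) lerDl sqr_ge0.
by rewrite -(c2s2 t) lerDr sqr_ge0.
Qed.

Section UniformContinuity.
Variable R : realType.
Implicit Types g : R -> R.

Definition uniformly_continuous g : Prop := forall e : R, 0 < e ->
  exists2 d : R, 0 < d & forall x x', `|x - x'| < d -> `|g x - g x'| <= e.

Lemma uniformD g g' : uniformly_continuous g -> uniformly_continuous g' ->
  uniformly_continuous (fun x => g x + g' x).
Proof.
move=> gu gu' e e0; have e2 : 0 < e / 2 by rewrite divr_gt0.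
have [d d0 dP] := gu _ e2; have [d' d'0 dP'] := gu' _ e2.
exists (Num.min d d'); first by rewrite lt_min d0.
move=> x x'; rewrite lt_min => /andP[/dP h /dP' h'].
have -> : g x + g' x - (g x' + g' x') = (g x - g x') + (g' x - g' x') by ring.
by apply: le_trans (ler_normD _ _) _; lra.
Qed.

Lemma uniformZ (c : R) g : uniformly_continuous g -> uniformly_continuous (fun x => c * g x).
Proof.
move=> gu e e0; have c0 : 0 < `|c| + 1 by rewrite ltr_wpDl.
have [|d d0 dP] := gu (e / (`|c| + 1)); first by rewrite divr_gt0.
exists d => // x x' /dP; rewrite ler_pdivlMr // -mulrBr normrM => h.
apply: le_trans h; rewrite mulrC; apply: ler_wpM2l => //; lra.
Qed.

Lemma uniform_trig (k : R) :
  uniformly_continuous (fun x => c2 (k * x)) /\ uniformly_continuous (fun x => s2 (k * x)).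
Proof.
have small e : 0 < e -> exists2 d : R, 0 < d &
    forall t, `|t| < d -> `|1 - c2 (k * t)| + `|s2 (k * t)| <= e.
  move=> e0; have e2 : 0 < e / 2 by rewrite divr_gt0.
  have kc : continuous (fun t : R => k * t).
    by move=> t; apply: cvgM; [exact: cvg_cst|exact: cvg_id].
  have cc : continuous (fun t => c2 (k * t)).
    by move=> t; apply: (continuous_comp (kc t)); exact: continuous_c2.
  have sc : continuous (fun t => s2 (k * t)).
    by move=> t; apply: (continuous_comp (kc t)); exact: continuous_s2.
  have /cvgrPdist_lt /(_ _ e2) := cc 0; rewrite mulr0 c2_0 => /nbhs_ballP[d d0 dP].
  have /cvgrPdist_lt /(_ _ e2) := sc 0; rewrite mulr0 s2_0 => /nbhs_ballP[d' d'0 dP'].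
  exists (Num.min d d'); first by rewrite lt_min d0.
  move=> t; rewrite lt_min => /andP[td td'].
  have h : `|1 - c2 (k * t)| < e / 2 by apply: dP; rewrite /ball /= sub0r normrN.
  have h' : `|0 - s2 (k * t)| < e / 2 by apply: dP'; rewrite /ball /= sub0r normrN.
  by move: h'; rewrite sub0r normrN; lra.
have c1 t := (norm_c2s2_le1 (t : R)).1.
have s1 t := (norm_c2s2_le1 (t : R)).2.
split=> e e0; have [d d0 dP] := small e e0; exists d => // x x' /dP h;
  apply: le_trans h.
- have -> : c2 (k * x) - c2 (k * x') = c2 (k * x') * (c2 (k * (x - x')) - 1)
     - s2 (k * x') * s2 (k * (x - x')).
    have {1}-> : k * x = k * x' + k * (x - x') by ring.
    by rewrite c2D; ring.
  apply: le_trans (ler_normB _ _) _; rewrite !normrM distrC.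
  by apply: lerD; rewrite ler_piMl.
have -> : s2 (k * x) - s2 (k * x') = s2 (k * x') * (c2 (k * (x - x')) - 1)
     + c2 (k * x') * s2 (k * (x - x')).
  have {1}-> : k * x = k * x' + k * (x - x') by ring.
  by rewrite s2D; ring.
apply: le_trans (ler_normD _ _) _; rewrite !normrM [`|c2 _ - 1|]distrC.
by apply: lerD; rewrite ler_piMl.
Qed.

Lemma uniform_sum (n : nat) (g : nat -> R -> R) :
  (forall i, uniformly_continuous (g i)) -> uniformly_continuous (fun x => \sum_(i < n) g i x).
Proof.
move=> gu; elim: n => [|n IH].
  by move=> e e0; exists 1 => // x x' _; rewrite !big_ord0 subrr normr0 ltW.
have -> : (fun x => \sum_(i < n.+1) g i x) = fun x => \sum_(i < n) g i x + g n x.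
  by apply/funext => x; rewrite big_ord_recr.
exact: uniformD.
Qed.

End UniformContinuity.

Section TrigPoly.
Variables (R : realType) (N : nat) (a b : nat -> R) (F : R -> R).
Hypothesis FE : forall x, F x = \sum_(k < N.+1) (a k * cos (2 * pi * k%:R * x)
                           + b k * sin (2 * pi * k%:R * x)).

Lemma trig_c2s2 x : F x = \sum_(k < N.+1) (a k * c2 (k%:R * x) + b k * s2 (k%:R * x)).
Proof. by rewrite FE; apply: eq_bigr => k _; rewrite /c2 /s2 mulrA. Qed.

Lemma trig_uniform : uniformly_continuous F.
Proof.
have -> : F = fun x => \sum_(k < N.+1) (a k * c2 (k%:R * x) + b k * s2 (k%:R * x)).
  by apply/funext => x; exact: trig_c2s2.
apply: (@uniform_sum R N.+1 (fun k x => a k * c2 (k%:R * x) + b k * s2 (k%:R * x))) => k.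
by have [? ?] := uniform_trig (k%:R : R); apply: uniformD; apply: uniformZ.
Qed.

Lemma trig_periodic x : F (x + 1) = F x.
Proof.
rewrite !trig_c2s2; apply: eq_bigr => k _.
have -> : k%:R * (x + 1) = k%:R * x + (k : int)%:~R by rewrite -pmulrn; ring.
by rewrite c2DZ s2DZ.
Qed.

Lemma trig_bound x : `|F x| <= weight N a b.
Proof.
rewrite trig_c2s2 /weight; apply: le_trans (ler_norm_sum _ _ _) _; apply: ler_sum => k _.
apply: le_trans (ler_normD _ _) _; rewrite !normrM; apply: lerD; rewrite ler_piMr //.
  by have [] := norm_c2s2_le1 (k%:R * x).
by have [] := norm_c2s2_le1 (k%:R * x).
Qed.

End TrigPoly.

Lemma shifted_mean_limit (R : realType) (u : nat -> R) (y r : R) :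
  n%:R^-1 * (u n - y) @[n --> \oo] --> r -> n%:R^-1 * u n @[n --> \oo] --> r.
Proof.
move=> ur; have ny : n%:R^-1 * y @[n --> \oo] --> (0 : R).
  apply/cvgrPdist_le => e e0; exists (Num.bound (`|y| / e)).+1 => // n /= nb.
  have n0 : 0 < n%:R :> R by rewrite ltr0n; exact: leq_trans nb.
  rewrite sub0r normrN normrM normfV [`|n%:R|]gtr0_norm // ler_pdivrMl //.
  rewrite -ler_pdivrMr //; apply: ltW; apply: lt_le_trans (archi_boundP _) _.
    by rewrite divr_ge0 // ltW.
  by rewrite ler_nat; exact: ltnW nb.
have -> : (fun n => n%:R^-1 * u n) = (fun n : nat => n%:R^-1 * (u n - y) + n%:R^-1 * y).
  by apply/funext => n; ring.
by rewrite -[r]addr0; apply: cvgD.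
Qed.

Lemma gap_resonance (R : realType) (N : nat) (a b : nat -> R) (F : R -> R)
    (alpha E1 E2 r mu X Y : R) (h : nat) :
  (forall x, F x = \sum_(k < N.+1) (a k * cos (2 * pi * k%:R * x)
                           + b k * sin (2 * pi * k%:R * x))) ->
  irrational alpha -> 1 <= mu -> mu ^+ N * weight N a b <= 1 ->
  E1 < E2 -> `|(E1 + E2) / 2| <= 3 ->
  (forall E, E = E1 \/ E = E2 -> forall x y,
    n%:R^-1 * (orbit_angle F alpha E x y n - y) @[n --> \oo] --> r) ->
  (0 < h)%N -> (N <= h)%N -> 1 <= X -> 1 <= Y ->
  (24 * h + 1 + 2 * N)%:R <= X -> 64 * (10 * (10 * 10)) <= X ->
  ((E2 - E1) / 2)^-1 <= Y ->
  (4 * h)%:R * (4 * h * 2).+1%:R * 6 ^+ (4 * h).+1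
    <= (X ^+ 13 * Y ^+ 11)^-1
       * (\prod_(1 <= l < (4 * h * 2).+1) dist_to_Z (l%:R * alpha)) ^+ 2 * mu ^+ (h - N) ->
  exists n k : int, (`|n| <= 24 * h)%N /\ 2 * r = n%:~R * alpha + k%:~R.
Proof.
move=> FE aI mu1 small E12 E3 rot h0 Nh X1 Y1 SX X64 dY epsP.
have Fu := trig_uniform FE.
set E := (E1 + E2) / 2 in E3; set dl := (E2 - E1) / 2 in dY.
have dl0 : 0 < dl by rewrite divr_gt0 // subr_gt0.
have lb : lower_bounded F alpha E dl.
  apply: (equal_rotation_lower_bounded (r := r) aI _ (trig_periodic FE) E12).
  - exact: (uniform_continuous_point Fu).
  - by apply: shifted_mean_limit; apply: rot; left.
  - by apply: shifted_mean_limit; apply: rot; right.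
pose e : R := (10 * (10 * 10))^-1.
have e0 : 0 < e by rewrite invr_gt0.
have e1 : 10 * (10 * (10 * e)) <= 1.
  by have -> : 10 * (10 * (10 * e)) = 1 by rewrite /e; field.
have Xe : 64 * 1 <= X * e.
  by rewrite /e ler_pdivlMr //; rewrite mulr1.
rewrite mulr1 in Xe.
have [tau [nu [tau0 nu0 tauP t1 t2]]] :=
  parameter_choice X1 Y1 (ler0n _ _) SX Xe dl0 dY.
have [w wP] := choice (fun phi => dual_approx_inverse FE aI dl0 mu1 E3 small lb phi
   h0 Nh epsP tau0 tauP).
have SE : (24 * h + 1 + 2 * N = (12 * h + 12 * h).+1 + (N + N))%N by clear; lia.
rewrite SE in t1 t2 wP.
have B0 : 0 <= 2 / dl by rewrite divr_ge0 // ltW.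
have F4 x : `|F x - E| <= 4.
  have F1 : `|F x| <= 1.
    apply: le_trans (trig_bound FE x) _; apply: le_trans small.
    have w0 : 0 <= weight N a b by apply: sumr_ge0 => k _; exact: addr_ge0.
    by rewrite ler_peMl ?exprn_ege1.
  by apply: le_trans (ler_normB _ _) _; move: F1 E3; clear; lra.
have w1 phi i := let: And3 h _ _ := wP phi in h i.
have w2 phi i := let: And3 _ h _ := wP phi in h i.
have w3 phi := let: And3 _ _ h := wP phi in h.
have [q qL cone] := @stable_cone R N a b F FE alpha E (2 / dl) tau dl e (12 * h) w nu
  B0 tau0 nu0 dl0 w1 w2 w3
  lb F4 e0 e1 t1 t2.
have [n [k [y [nD lim]]]] := stable_rotation Fu dl0 lb qL cone.
exists n, k; split; first by move: nD; clear; lia.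
suff -> : r = (n%:~R * alpha + k%:~R) / 2 by field.
(* Orbit angles are monotone in the energy, so the midpoint has the rotation number of the two
   edges. *)
have limE : m%:R^-1 * orbit_angle F alpha E 0 y m @[m --> \oo] --> r.
  apply: (squeeze_cvgr (f := fun m => m%:R^-1 * orbit_angle F alpha E2 0 y m)
     (h := fun m => m%:R^-1 * orbit_angle F alpha E1 0 y m)).
  - near=> m; rewrite !ler_wpM2l ?invr_ge0 // orbit_angle_anti // /E; move: E12; clear; lra.
  - by apply: shifted_mean_limit; apply: rot; right.
  - by apply: shifted_mean_limit; apply: rot; left.
exact: (cvg_unique _ limE lim).
Unshelve. all: by end_near. Qed.

Lemma irrational_resonance (R : realType) (alpha : R) (m n j k : int) :
  irrational alpha -> m%:~R * alpha + j%:~R = n%:~R * alpha + k%:~R -> m = n.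
Proof.
move=> aI e; apply/eqP; rewrite -subr_eq0; apply/negP => /negP mn.
have d0 : (0 < `|m - n|)%N by rewrite absz_gt0.
have := dist_to_Z_irr aI d0; rewrite ltNge => /negP; apply.
have e' : (m - n)%:~R * alpha = (k - j)%:~R by rewrite !intrB; lra.
have [s|s] := leP 0 (m - n).
  have := dist_to_Z_le (`|m - n|%:R * alpha) (k - j).
  by rewrite pmulrn gez0_abs // e' subrr normr0.
have := dist_to_Z_le (`|m - n|%:R * alpha) (- (k - j)).
by rewrite pmulrn ltz0_abs // rmorphN mulNr e' rmorphN /= subrr normr0.
Qed.

Section EnergyBound.
Variables (R : realType) (F : R -> R) (alpha E r : R).
Hypothesis F1 : forall x, `|F x| <= 1.
Hypothesis r0 : 0 < r < 2^-1.
Hypothesis lim : forall x y,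
  n%:R^-1 * (orbit_angle F alpha E x y n - y) @[n --> \oo] --> r.

Let p0 := pi_gt0 R.

Let eighth : s2 (8^-1 : R) / c2 8^-1 = 1.
Proof.
have -> : s2 (8^-1 : R) / c2 8^-1 = tan (pi / 4).
  by rewrite /s2 /c2 /tan; have -> : 2 * pi * 8^-1 = pi / 4 :> R by move: pi => p; field.
exact: tan_piquarter.
Qed.

Let atan1_turn : atan (1 : R) / (2 * pi) = 8^-1.
Proof. by rewrite atan1; move: pi p0 => p h; field; exact: lt0r_neq0. Qed.

Let atan_le (u v : R) : u <= v -> atan u / (2 * pi) <= atan v / (2 * pi).
Proof.
move=> uv; rewrite ler_pM2r ?invr_gt0 ?mulr_gt0 //.
by move: uv; rewrite le_eqVlt => /orP[/eqP->//|/lt_atan/ltW].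
Qed.

(** For [E < -3] every step advances the angle [-1/8] by at least a half turn, so [r >= 1/2]. For
    [E > 3] the interval [[0, 1/8]] is invariant, so [r = 0]. Both values are excluded by [r0]. *)
Lemma rotation_energy_bound : `|E| <= 3.
Proof.
case/andP: r0 => rp r2.
rewrite ler_norml; apply/andP; split; rewrite leNgt; apply/negP => E3.
- have step x : - 8^-1 + 2^-1 <= angle_map (E - F x) (- 8^-1).
    rewrite angle_map_tan; last by apply/andP; split; lra.
    rewrite s2N c2N mulNr opprK eighth.
    have /andP[f1 f2] : -1 <= F x <= 1 by rewrite -ler_norml.
    have : E - F x + 1 <= - 1 by lra.
    by move=> /atan_le; rewrite atanN mulNr atan1_turn; lra.
  have orb n : - 8^-1 + n%:R / 2 <= orbit_angle F alpha E 0 (- 8^-1) n.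
    elim: n => [|n IH]; first by rewrite mul0r addr0.
    apply: le_trans (angle_map_mono _ IH).
    have := angle_map_halfZ (E - F (0 + n%:R * alpha)) (- 8^-1) n; rewrite -pmulrn => ->.
    have -> : n.+1%:R / 2 = n%:R / 2 + 2^-1 :> R by rewrite -natr1; field.
    by have := step (0 + n%:R * alpha); lra.
  have : 2^-1 <= r.
    apply: (cvgr_to_ge (lim 0 (- 8^-1))); near=> n.
    have n0 : 0 < n%:R :> R by rewrite ltr0n; near: n; exists 1%N.
    by rewrite opprK ler_pdivlMl //; have := orb n; lra.
  lra.
have orb n : 0 <= orbit_angle F alpha E 0 0 n <= 8^-1.
  elim: n => [|n /andP[IH1 IH2]]; first by rewrite /= lexx invr_ge0 ler0n.
  have /andP[f1 f2] : -1 <= F (0 + n%:R * alpha) <= 1 by rewrite -ler_norml.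
  apply/andP; split.
    have /andP[/ltW h _] := @angle_map_range R (E - F (0 + n%:R * alpha))
      (orbit_angle F alpha E 0 0 n) ltac:(apply/andP; split; lra).
    exact: h.
  apply: le_trans (angle_map_mono _ IH2) _.
  rewrite angle_map_tan; last by apply/andP; split; lra.
  rewrite eighth; have : 1 <= E - F (0 + n%:R * alpha) - 1 by lra.
  by move=> /atan_le; rewrite atan1_turn; lra.
suff : r <= r / 2 by lra.
apply: (cvgr_to_le (lim 0 0)); near=> n.
have nr : r^-1 < n%:R.
  apply: lt_le_trans (archi_boundP _) _; first by rewrite invr_ge0 ltW.
  by rewrite ler_nat; near: n; exists (Num.bound r^-1).
have n0 : 0 < n%:R :> R by apply: lt_trans nr; rewrite invr_gt0.
have nr1 : 1 < n%:R * r by rewrite -ltr_pdivrMr // mul1r.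
by rewrite subr0 ler_pdivrMl // mulrA; have /andP[_] := orb n; lra.
Unshelve. all: by end_near. Qed.

End EnergyBound.

Lemma large_scale (R : realType) (N : nat) : exists H : nat, forall h, (H <= h)%N ->
  [/\ (0 < h)%N, (N + N <= h)%N, (24 * h + 1 + 2 * N)%:R <= expR (h%:R : R) &
      64 * (10 * (10 * 10)) <= expR (h%:R : R)].
Proof.
have [H0 H0P] : exists H0 : nat, 64 * (10 * (10 * 10)) <= H0%:R :> R.
  by exists (Num.bound (64 * (10 * (10 * 10)) : R)); apply: ltW; apply: archi_boundP.
exists (4 * (25 + 2 * N) + H0 + 1)%N => h hH.
have h0 : (0 < h)%N by move: hH; clear; lia.
have hN : (4 * (25 + 2 * N) <= h)%N by move: hH; clear; lia.
split=> //; first by move: hN; clear; lia.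
- apply: (@le_trans _ _ ((h%:R / 2) ^+ 2)).
    have -> : (h%:R / 2) ^+ 2 = h%:R * h%:R / 4 :> R by field.
    rewrite ler_pdivlMr // -!natrM ler_nat.
    by move: h0 hN; clear; nia.
  have -> : h%:R = 2%:R * (h%:R / 2) :> R by field.
  rewrite expRM_natl ler_pXn2r ?nnegrE ?expR_ge0 ?divr_ge0 //.
  have -> : 2%:R * (h%:R / 2) / 2 = h%:R / 2 :> R by field.
  by apply: le_trans (expR_ge1Dx _); rewrite lerDr.
apply: le_trans H0P _; apply: (@le_trans _ _ h%:R).
  by rewrite ler_nat; move: hH; clear; lia.
by apply: le_trans (expR_ge1Dx _); rewrite lerDr.
Qed.

(** In units of [h] in the exponent: 32 for the left-hand side and 13 for [X], together 45, then
    [11 L] for [Y] and [2 Q] for [P ^+ 2]. The rate is doubled because the decay acts over [h - N]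
    sites only, at least half of [h]. *)
Lemma small_denominator_budget (R : realType) (P : R) (N L Q h : nat) :
  (0 < h)%N -> (N + N <= h)%N -> (24 * h + 1 + 2 * N)%:R <= expR (h%:R : R) ->
  expR (- (Q * h)%:R) <= P ->
  (4 * h)%:R * (4 * h * 2).+1%:R * 6 ^+ (4 * h).+1
    <= (expR h%:R ^+ 13 * expR (L * h)%:R ^+ 11)^-1 * P ^+ 2
       * expR (2 * (45 + 11 * L + 2 * Q))%:R ^+ (h - N).
Proof.
move=> h0 hN S1 PQ.
have e (m : nat) : expR (m%:R : R) = expR 1 ^+ m by rewrite -expRM_natl mulr1.
set Z := expR (1 : R) in e; have Z1 : 1 <= Z by rewrite -expR0 ler_expR.
have Z0 : 0 < Z by exact: expR_gt0.
have Zh : Z ^+ h = expR h%:R by rewrite e.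
apply: (@le_trans _ _ (Z ^+ (32 * h))).
  have -> : (32 * h = h + h + 30 * h)%N by clear; lia.
  rewrite (exprD Z (h + h)) (exprD Z h h); apply: ler_pM; rewrite ?mulr_ge0 ?exprn_ge0 //.
    apply: ler_pM => //; rewrite Zh; apply: le_trans S1; rewrite ler_nat; clear; lia.
  apply: (@le_trans _ _ ((Z ^+ 6) ^+ (4 * h).+1)).
    rewrite ler_pXn2r ?nnegrE ?exprn_ge0 ?(ltW Z0) // -e.
    by apply: le_trans (expR_ge1Dx _); rewrite lerDr.
  by rewrite -exprM ler_weXn2l //; move: h0; clear; lia.
have PZ : (Z ^+ (Q * h))^-1 <= P by rewrite -e -expRN.
have P2 : (Z ^+ (2 * (Q * h)))^-1 <= P ^+ 2.
  rewrite mulnC exprM -exprVn ler_pXn2r ?nnegrE ?invr_ge0 ?exprn_ge0 ?(ltW Z0) //.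
  by apply: le_trans PZ; rewrite invr_ge0 exprn_ge0 // ltW.
rewrite !e -!exprM -exprD.
apply: (@le_trans _ _ ((Z ^+ (h * 13 + L * h * 11))^-1 * (Z ^+ (2 * (Q * h)))^-1
   * Z ^+ ((45 + 11 * L + 2 * Q) * h))).
  rewrite -invfM -exprD mulrC ler_pdivlMr ?exprn_gt0 // -exprD ler_weXn2l //.
  by clear; nia.
have pos (n : nat) : 0 <= Z ^+ n by rewrite exprn_ge0 // ltW.
apply: ler_pM; rewrite ?mulr_ge0 ?invr_ge0 ?pos //.
  by rewrite ler_wpM2l ?invr_ge0.
rewrite ler_weXn2l //; have : (h <= 2 * (h - N))%N by move: hN; clear; lia.
by clear; nia.
Qed.

Theorem theorem1p2 (R : realType) (f : R -> R) (eta b : R) :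
  trig_poly f -> 0 < eta -> 0 <= b ->
  exists lam0 : R, 0 < lam0 /\
    forall alpha : R, irrational alpha -> beta alpha = b%:E ->
    forall lam : R, `|lam| <= lam0 ->
    exists mstar : R, 0 < mstar /\
      forall m : int, m != 0 -> mstar <= `|m%:~R| ->
      forall Em Ep : R, gap_edges lam f alpha m Em Ep ->
        Ep - Em <= expR (- (eta * `|m%:~R|)).
Proof.
move=> [N [u [v fE]]] eta0 b0.
(* The inverse half-width of a wide gap is below [2 exp(eta |m|)] with [|m| <= 28h + 28 <= 56h]; the
   additional 1 absorbs the factor 2. *)
pose L := Num.bound (56 * eta + 1); have LP : 56 * eta + 1 < L%:R.
  by apply: archi_boundP; rewrite addr_ge0 // mulr_ge0 // ltW.
(* The product of small divisors runs over [8h] terms and costs [3 (b + 4)] per term. *)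
pose Q := Num.bound (24 * (b + 4)); have QP : 24 * (b + 4) < Q%:R.
  by apply: archi_boundP; rewrite mulr_ge0 // addr_ge0.
pose mu : R := expR (2 * (45 + 11 * L + 2 * Q))%:R.
have mu1 : 1 <= mu by rewrite -expR0 ler_expR.
have W0 : 0 <= mu ^+ N * weight N u v.
  rewrite mulr_ge0 ?exprn_ge0 ?expR_ge0 //; apply: sumr_ge0 => k _; exact: addr_ge0.
(* The added 1 covers [f = 0] with zero coefficients. Only [f], [eta] and [b] enter, through [mu],
   as the uniformity in [alpha] demands. *)
exists (mu ^+ N * weight N u v + 1)^-1; split; first by rewrite invr_gt0 ltr_wpDl.
move=> alpha aI aB lam lamP.
have small : mu ^+ N * weight N (fun k => lam * u k) (fun k => lam * v k) <= 1.
  have -> : weight N (fun k => lam * u k) (fun k => lam * v k) = `|lam| * weight N u v.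
    by rewrite /weight mulr_sumr; apply: eq_bigr => k _; rewrite !normrM mulrDr.
  rewrite mulrCA; move: W0 lamP; set W := mu ^+ N * _ => W0 lamP.
  apply: (@le_trans _ _ ((W + 1)^-1 * W)); first by rewrite ler_wpM2r.
  by rewrite ler_pdivrMl ?ltr_wpDl // mulr1 lerDl.
pose F x := lam * f x.
have FE x : F x = \sum_(k < N.+1) (lam * u k * cos (2 * pi * k%:R * x)
                           + lam * v k * sin (2 * pi * k%:R * x)).
  by rewrite /F fE mulr_sumr; apply: eq_bigr => k _; rewrite mulrDr !mulrA.
have fc : continuous f := uniform_continuous_point (trig_uniform fE).
have F1 x : `|F x| <= 1.
  apply: le_trans (trig_bound FE x) _; apply: le_trans small.
  apply: ler_peMl; last exact: exprn_ege1.
  by apply: sumr_ge0 => k _; exact: addr_ge0.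
have [k1 k1P] := beta_lower_bound aI aB.
have [n0 n0P] := prod_dist_lower_bound aI b0 k1P.
have [H HP] := large_scale R N.
(* Ensures that [h = |m| / 28] exceeds both thresholds; the dependence on [alpha] is through
   [n0]. *)
exists (28 * (H + n0 + 1))%:R; split; first by rewrite ltr0n muln_gt0 addn1.
move=> m m0; have -> : `|m%:~R| = `|m|%N%:R :> R by rewrite -intr_norm -abszE.
rewrite ler_nat => mH Em Ep [EmEp setE].
rewrite leNgt; apply/negP => wide.
pose h := (`|m| %/ 28)%N.
have [hH hn0 hm mh] : [/\ (H <= h)%N, (n0 <= h)%N, (24 * h < `|m|)%N & (`|m| <= 28 * h + 28)%N].
  by rewrite /h; move: mH; clear; split; lia.
have [h0 hN SX X64] := HP h hH.
have lt : Em < Ep by rewrite -subr_gt0; apply: lt_trans wide; exact: expR_gt0.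
have [j1 e1] : exists j : int, 2 * rho lam f alpha Em = m%:~R * alpha + j%:~R.
  have : (`[Em, Ep]%classic : set R) Em by rewrite /= in_itv /= lexx.
  by rewrite -setE.
have [j2 e2] : exists j : int, 2 * rho lam f alpha Ep = m%:~R * alpha + j%:~R.
  have : (`[Em, Ep]%classic : set R) Ep by rewrite /= in_itv /= lexx EmEp.
  by rewrite -setE.
have [r1 lim1] := rho_gap fc aI m0 e1.
have [r2 lim2] := rho_gap fc aI m0 e2.
(* The edges satisfy the gap condition with integers that might differ a priori, but both values of
   [2 rho] lie in [(0, 1)]. *)
have j12 : j1 = j2.
  have : `|(j1 - j2)%:~R : R| < 1.
    have -> : (j1 - j2)%:~R = 2 * rho lam f alpha Em - 2 * rho lam f alpha Ep.
      by rewrite e1 e2 intrB; ring.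
    by rewrite ltr_norml; move: r1 r2; clear; lra.
  by rewrite -intr_norm ltrz1; clear; lia.
have rr : rho lam f alpha Ep = rho lam f alpha Em by move: e1 e2; rewrite j12; clear; lra.
rewrite rr in lim2 r2.
have EmB := rotation_energy_bound F1 r1 lim1.
have EpB := rotation_energy_bound F1 r1 lim2.
have [n [k [nh nk]]] : exists n k : int,
    (`|n| <= 24 * h)%N /\ 2 * rho lam f alpha Em = n%:~R * alpha + k%:~R.
  apply: (gap_resonance (mu := mu) (X := expR h%:R) (Y := expR (L * h)%:R) FE aI mu1
    small lt _ _ h0 _ _ _ SX X64).
  - by move: EmB EpB; rewrite !ler_norml; clear; lra.
  - by move=> E [->|->].
  - by move: hN; clear; lia.
  - by rewrite -expR0 ler_expR.
  - by rewrite -expR0 ler_expR.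
  - rewrite -[leRHS]invrK lef_pV2 ?posrE ?invr_gt0 ?expR_gt0 ?divr_gt0 ?subr_gt0 //.
    rewrite -expRN ler_pdivlMr //; apply: le_trans (ltW wide).
    have e2le : 2 <= expR 1 :> R by apply: le_trans (expR_ge1Dx _); rewrite lexx.
    apply: (@le_trans _ _ (expR (- (L * h)%:R) * expR 1)); first by rewrite ler_wpM2l ?expR_ge0.
    rewrite -expRD ler_expR natrM.
    have hr : 1 <= h%:R :> R by rewrite ler1n.
    have mhr : `|m|%N%:R <= 28 * h%:R + 28 :> R.
      by rewrite -natrM -natrD ler_nat.
    have := ler_wpM2l (ltW eta0) mhr; have := ler_wpM2r (ler0n R h) (ltW LP).
    have := ler_wpM2l (ltW eta0) hr; lra.
  apply: small_denominator_budget => //.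
  apply: le_trans (n0P _ _); last by move: hn0; clear; lia.
  rewrite ler_expR lerN2 !natrM.
  have := ler_wpM2r (ler0n R h) (ltW QP); lra.
have mn : m = n by apply: (irrational_resonance aI (j := j1) (k := k)); rewrite -e1.
by move: hm; rewrite mn ltnNge nh.
Qed.
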